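(* Let $(T(t))_{t\ge0}$ be a $C_0$-semigroup of contractions on a Hilbert space $X$, with generator $A$. Assume that $D(A)=D(A^* )$ and that $\sigma(A)\cap i\mathbb R$ is empty. Let $M:\mathbb R_+\to[2,\infty)$ be a continuous increasing function such that $$\|R(is,A)\|\le M(|s|),\qquad s\in\mathbb R.$$ Let $S$ be any non-negative self-adjoint extension of the symmetric non-negative operator $-(A+A^* )$ with domain $D(A)$, and let $B=S^{1/2}$. Then $$BT(\cdot)A^{-1}x\in L^2(\mathbb R_+,w,X)\cap C_0(\mathbb R_+,X),\qquad x\in X,$$ where $w(t)=w_{M,\log}(kt)$ for some $k>0$.
   Context: $\mathbb R_+=[0,\infty)$; Hilbert spaces are complex. $R(\lambda,A)=(\lambda-A)^{-1}$. Since $A$ is dissipative, $-(A+A^* )$ with domain $D(A)=D(A^* )$ is symmetric and non-negative; one has $D(A)\subset D(B)$, so $BT(t)A^{-1}x$ is defined for all $x\in X$, $t\ge0$. Define $$M_{\log}(s)=M(s)\,[\log(1+M(s))+\log(1+s)],$$ which is continuous, strictly increasing and unbounded, with inverse $M_{\log}^{-1}$, and $$w_{M,\log}(t)=\begin{cases}M_{\log}^{-1}(t),&t\ge M_{\log}(1),\\ 1,&0\le t\le M_{\log}(1).\end{cases}$$ $g\in L^2(\mathbb R_+,w,X)$ means $g\cdot w\in L^2(\mathbb R_+,X)$. $C_0(\mathbb R_+,X)$ is the space of continuous functions $\mathbb R_+\to X$ tending to $0$ at infinity. *)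

(* Defs.v *)
From mathcomp Require Export all_boot all_order all_algebra sesquilinear.
From mathcomp Require Export complex.
From mathcomp Require Export all_classical all_reals all_analysis.
Export Order.TTheory GRing.Theory Num.Theory.
Export numFieldNormedType.Exports.

Set Implicit Arguments.
Unset Strict Implicit.
Unset Printing Implicit Defensive.

Global Open Scope classical_set_scope.
Global Open Scope ring_scope.
Global Open Scope complex_scope.

(* In a normed module over R[i] the norm [`|x|] is an element of R[i] (a       *)
(* nonnegative real); [normR] is the same norm, with values in R.             *)
Definition normR (R : realType) (X : normedModType R[i]) (x : X) : R :=
  complex.Re `|x|.

(* Complex Hilbert spaces are complete normed modules over R[i] together with *)
(* a form [ip : {dot X for Num.conj}], linear in the first variable, which    *)
(* induces the norm.                                                          *)
Definition hilbert_norm (R : realType) (X : normedModType R[i])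
    (ip : {dot X for Num.conj}) : Prop :=
  forall x : X, `|x| ^+ 2 = ip x x.

Section Operators.
Context {R : realType} {X : completeNormedModType R[i]}.
Variable ip : {dot X for Num.conj}.

(* A possibly unbounded operator; the values of [app] outside of [dom] are    *)
(* irrelevant, and operators are compared with [op_extends] and [op_eq] only. *)
Record operator := Op { dom : set X ; app :> X -> X }.

Definition op_linear (A : operator) : Prop :=
  [/\ dom A 0,
      forall (a : R[i]) x y, dom A x -> dom A y -> dom A (a *: x + y) &
      forall (a : R[i]) x y, dom A x -> dom A y ->
        A (a *: x + y) = a *: A x + A y].

Definition densely_defined (A : operator) : Prop := closure (dom A) = setT.

Definition op_extends (S A : operator) : Prop :=
  dom A `<=` dom S /\ forall x, dom A x -> S x = A x.

Definition op_eq (A B : operator) : Prop := op_extends A B /\ op_extends B A.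

Definition op_opp (A : operator) : operator := Op (dom A) (fun x => - A x).

Definition op_add (A B : operator) : operator :=
  Op (dom A `&` dom B) (fun x => A x + B x).

Definition op_comp (A B : operator) : operator :=
  Op [set x | dom B x /\ dom A (B x)] (fun x => A (B x)).

Definition op_inv (A : operator) : operator :=
  Op (A @` dom A) (fun y => get [set x | dom A x /\ A x = y]).

Definition op_shift (l : R[i]) (A : operator) : operator :=
  Op (dom A) (fun x => l *: x - A x).

Definition resolvent (l : R[i]) (A : operator) : operator :=
  op_inv (op_shift l A).

Definition opnorm (F : X -> X) : \bar R :=
  ereal_sup [set (normR (F x))%:E | x in [set x : X | normR x <= 1]].

Definition resolvent_set (A : operator) : set R[i] :=
  [set l | [/\ set_inj (dom A) (op_shift l A),
               dom (resolvent l A) = setT &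
               (opnorm (resolvent l A) < +oo)%E]].

Definition spectrum (A : operator) : set R[i] := ~` resolvent_set A.

(* [z] is unique when [A] is densely defined.                                 *)
Definition adjoint_at (A : operator) (y z : X) : Prop :=
  forall x, dom A x -> ip (A x) y = ip x z.

Definition adjoint (A : operator) : operator :=
  Op [set y | exists z, adjoint_at A y z]
     (fun y => get [set z | adjoint_at A y z]).

Definition selfadjoint (S : operator) : Prop :=
  [/\ op_linear S, densely_defined S & op_eq S (adjoint S)].

(* In the order of R[i], [0 <= z] means that z is real and nonnegative.       *)
Definition op_nonneg (S : operator) : Prop :=
  forall x, dom S x -> 0 <= ip (S x) x.

(* By the spectral theorem a nonnegative self-adjoint operator has exactly    *)
(* one square root in this sense.                                             *)
Definition is_sqrt (B S : operator) : Prop :=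
  [/\ selfadjoint B, op_nonneg B & op_eq (op_comp B B) S].

(* Only the values of [T] on [0, +oo) matter.                                 *)
Definition C0_semigroup (T : R -> {linear X -> X}) : Prop :=
  [/\ forall t : R, 0 <= t -> continuous (T t),
      forall x, T 0 x = x,
      forall s t : R, 0 <= s -> 0 <= t -> forall x, T (s + t) x = T s (T t x) &
      forall x, T t x @[t --> (0 : R)^'+] --> x].

Definition contractive (T : R -> {linear X -> X}) : Prop :=
  forall t : R, 0 <= t -> forall x, `|T t x| <= `|x|.

Definition diff_quot (T : R -> {linear X -> X}) (x : X) (h : R) : X :=
  (h^-1)%:C *: (T h x - x).

Definition generator (T : R -> {linear X -> X}) : operator :=
  Op [set x | cvg (diff_quot T x h @[h --> (0 : R)^'+])]
     (fun x => lim (diff_quot T x h @[h --> (0 : R)^'+])).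

End Operators.
Arguments operator {R} X.

Section FunctionSpaces.
Context {R : realType} {X : completeNormedModType R[i]}.

Definition simple_fun (s : R -> X) : Prop :=
  finite_set (range s) /\ forall y, measurable (s @^-1` [set y]).

Definition strongly_measurable (D : set R) (f : R -> X) : Prop :=
  exists s : nat -> R -> X, (forall n, simple_fun (s n)) /\
    {ae lebesgue_measure, forall t, D t -> s n t @[n --> \oo] --> f t}.

Definition in_L2 (D : set R) (f : R -> X) : Prop :=
  strongly_measurable D f /\
  (\int[lebesgue_measure]_(t in D) (normR (f t) ^+ 2)%R%:E < +oo)%E.

Definition in_weighted_L2 (D : set R) (w : R -> R) (f : R -> X) : Prop :=
  in_L2 D (fun t => (w t)%:C *: f t).

(* The functions below are defined on R, but only their restriction to        *)
(* [0, +oo) is considered.                                                    *)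
Definition in_C0 (f : R -> X) : Prop :=
  {within `[0, +oo[%classic, continuous f} /\ f t @[t --> +oo] --> 0.

End FunctionSpaces.

Section Weight.
Context {R : realType}.

Definition Mlog (M : R -> R) (s : R) : R :=
  M s * (ln (1 + M s) + ln (1 + s)).

(* [Mlog M] is only inverted as a function on [0, +oo).                       *)
Definition Mlog_inv (M : R -> R) : R -> R :=
  'pinv_(fun=> 0) `[0, +oo[%classic (Mlog M).

Definition w_Mlog (M : R -> R) (t : R) : R :=
  if Mlog M 1 <= t then Mlog_inv M t else 1.

End Weight.

Section WellDefined.
Context {R : realType} {X : completeNormedModType R[i]}.
Variable ip : {dot X for Num.conj}.

Lemma generator_dom_invariant (T : R -> {linear X -> X}) (t : R) (x : X) :
  C0_semigroup T -> 0 <= t -> dom (generator T) x -> dom (generator T) (T t x).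
Proof.
move=> [Tcont _ Tadd _] t0 /= /cvg_ex[l xl]; apply/cvg_ex; exists (T t l).
have Tl : T t (diff_quot T x h) @[h --> (0 : R)^'+] --> T t l.
  exact: (cvg_comp _ _ xl (Tcont t t0 l)).
apply: cvg_trans Tl; apply: near_eq_cvg; near=> h.
have h0 : 0 <= h by [].
by rewrite /diff_quot linearZ linearB/= -!Tadd// [t + h]addrC.
Unshelve. all: by end_near. Qed.

(* The operator B T(t) A^{-1} of the main statement is defined everywhere.    *)
Lemma sqrt_dom (T : R -> {linear X -> X}) (S B : operator X) (t : R) (x : X) :
  let A := generator T in
  C0_semigroup T -> dom A = dom (adjoint ip A) -> resolvent_set A 0 ->
  op_extends S (op_opp (op_add A (adjoint ip A))) -> is_sqrt ip B S ->
  0 <= t -> dom B (T t (op_inv A x)).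
Proof.
move=> A TC domA [_ res _] [AS _] [_ _ [[BS _] _]] t0.
have [y Ay yx] : dom (resolvent 0 A) (- x) by rewrite res.
have [Ai _] : dom A (op_inv A x) /\ A (op_inv A x) = x.
  apply: (@getPex _ [set x0 | dom A x0 /\ A x0 = x]); exists y; split => //.
  by move: yx; rewrite /= scale0r sub0r => /oppr_inj.
have At := generator_dom_invariant TC t0 Ai.
have [//] : dom (op_comp B B) (T t (op_inv A x)).
by apply/BS/AS; split => //; rewrite -domA.
Qed.

End WellDefined.

(* Main.v *)
Require Import Defs.
From mathcomp Require Import ring lra measurable_realfun.

Set Implicit Arguments.
Unset Strict Implicit.
Unset Printing Implicit Defensive.

(** The energy [E t = |T(t) y|^2] of an orbit with [y] in [D(A)] satisfies
    [E' = 2 Re <A T(t) y, T(t) y> = - |B T(t) y|^2], because [B] is a square root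
    of an extension of minus the sum of [A] and its adjoint
    ([sqrt_orbit_energy]). If the half-line is cut at the times [t_n] at which
    the weight takes the value [2^n], then on [[t_n, t_(n+1)]] the weight is at
    most [2^(n+1)] and the energy that is lost is at most [E t_n]. The weighted
    integral is thus bounded by [E 0 + 4 sum_n 4^n E t_n], and the theorem
    reduces to the square summability of [2^n |T(t_n) A^-1 x|]
    ([dyadic_decay]), which also gives the decay of [B T(t) y] at infinity.
    For [k = 1/32] one has [t_n = 32 * Mlog M (2^n)].

    The summability separates frequencies at [N = 2^n]. The operators
    [l (l - A)^-1] act as frequency cut-offs at [l]. By dissipativity the
    differences [d_n] of the cut-offs of [x] at [N / 2] and at [N] are square
    summable ([sum_octaves]), and [A^-1 x] is the sum of a term of norm at most
    [9 |d_n| / N] and of a vector [y] in [D(A^2)] with [|A^2 y| <= 3 N |d_n|]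
    ([octave_split]). The semigroup being contractive, the first term is
    harmless, and for the second one it is enough that
    [|T(t_n) y| <= C (|A^2 y| / N^2 + |y| / N^3)] ([low_frequency_rate]).

    The last estimate uses the resolvent only on the segment [i [-N, N]]. Let
    [v = T(t) y], let [p(s) = (1 - s)^3 (1 + 3 s)] on [[0, 1]], and let [g(r)] be
    the integral over [s] of the sum over the two signs [e] of
    [Re (p(s) exp(i e N s r) <R(i e N s, A) T(t - r) y, v>)]. Differentiation in
    [r] cancels the resolvent: [g'(r)] is [Re <T(t - r) y, v>] times twice the
    cosine transform of [p] at [N r], and this transform is nonnegative. Since
    [T(t - r) + T(t + r) - 2 T(t) = T(t - r) (T(r) - 1)^2], the sum
    [Re <T(t - r) y, v> + Re <T(t + r) y, v>] is at least
    [2 |v|^2 - r^2 |A^2 y| |v|]. Integration over [[0, t / 2]] therefore bounds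
    [|v|^2] by a multiple of [N (g(t / 2) - g(- t / 2))] and an error of size
    [|A^2 y| |v| / N^2] ([low_frequency_decay]).

    The boundary terms [g(+- t / 2)] are small because the resolvent extends to
    a strip of width of order [1 / m] around the segment, where [m] bounds it on
    the segment. Moving the contour by [x] inside the strip gains
    [exp(- t N x / 2)]. It costs only the values of the integrand at the ends
    of the two segments, and these are of order [x^3]: [p] vanishes to third
    order at [1], and at [0] the two signs contribute
    [p(i x) - p(- i x) = 16 (i x)^3] ([contour_bound]). *)

(** * Complex moduli and the real inner product *)

Notation ReC := complex.Re.
Notation ImC := complex.Im.

Section ComplexAbs.
Context {R : realType}.
Implicit Types l : R[i].

Definition cabs l : R := ReC `|l|.

Lemma ReCD l m : ReC (l + m) = ReC l + ReC m. Proof. by case: l m => ? ? []. Qed.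
Lemma ImCD l m : ImC (l + m) = ImC l + ImC m. Proof. by case: l m => ? ? []. Qed.
Lemma ReCN l : ReC (- l) = - ReC l. Proof. by case: l. Qed.
Lemma ImCN l : ImC (- l) = - ImC l. Proof. by case: l. Qed.
Lemma ReCM l m : ReC (l * m) = ReC l * ReC m - ImC l * ImC m.
Proof. by case: l m => ? ? []. Qed.
Lemma ImCM l m : ImC (l * m) = ReC l * ImC m + ImC l * ReC m.
Proof. by case: l m => ? ? []. Qed.

Lemma cabsE l : `|l| = (cabs l)%:C.
Proof. by rewrite /cabs RRe_real// ger0_real. Qed.

Lemma cabs_ge0 l : 0 <= cabs l.
Proof. by rewrite -lecR -cabsE normr_ge0. Qed.

Lemma cabsM l m : cabs (l * m) = cabs l * cabs m.
Proof. by apply: complexI; rewrite rmorphM/= -!cabsE normrM. Qed.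

Lemma cabsX l n : cabs (l ^+ n) = cabs l ^+ n.
Proof. by apply: complexI; rewrite rmorphXn/= -!cabsE normrX. Qed.

Lemma cabsN l : cabs (- l) = cabs l.
Proof. by rewrite /cabs normrN. Qed.

Lemma cabsD l m : cabs (l + m) <= cabs l + cabs m.
Proof. by rewrite -lecR rmorphD/= -!cabsE ler_normD. Qed.

Lemma cabs_real (a : R) : cabs a%:C = `|a|.
Proof. by rewrite /cabs normc_def/= expr0n addr0 sqrtr_sqr. Qed.

Lemma cabs_complex (a b : R) : cabs (a +i* b) = Num.sqrt (a ^+ 2 + b ^+ 2).
Proof. by rewrite /cabs normc_def. Qed.

Lemma cabs_complexE l : cabs l = Num.sqrt (ReC l ^+ 2 + ImC l ^+ 2).
Proof. by case: l => a b; rewrite cabs_complex. Qed.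

Lemma cabs_i : cabs ('i : R[i]) = 1.
Proof. by rewrite cabs_complex expr0n/= add0r expr1n sqrtr1. Qed.

Lemma Re_le_cabs l : `|ReC l| <= cabs l.
Proof. by rewrite -lecR -cabsE normc_ge_Re. Qed.

Lemma Im_le_cabs l : `|ImC l| <= cabs l.
Proof.
rewrite cabs_complexE -sqrtr_sqr ler_wsqrtr// lerDr sqr_ge0//.
Qed.

Lemma cabs_le_ReIm l : cabs l <= `|ReC l| + `|ImC l|.
Proof.
rewrite {1}[l]complexE.
by rewrite (le_trans (cabsD _ _))// cabsM cabs_i mul1r !cabs_real.
Qed.

End ComplexAbs.

Section RealInnerProduct.
Context {R : realType} {X : completeNormedModType R[i]}.
Variable ip : {dot X for Num.conj}.
Hypothesis ip_norm : hilbert_norm ip.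

(** Dissipativity, the derivative of the energy and the Cauchy-Schwarz
    inequality only see the real part of the form. *)
Definition rip (x y : X) : R := complex.Re (ip x y).

Lemma normR_complex (x : X) : `|x| = (normR x)%:C.
Proof. by rewrite /normR RRe_real// ger0_real. Qed.

Lemma normR_ge0 (x : X) : 0 <= normR x.
Proof. by rewrite -lecR -normR_complex normr_ge0. Qed.
Hint Resolve normR_ge0 : core.

Lemma normR0 : normR (0 : X) = 0.
Proof. by rewrite /normR normr0. Qed.

Lemma normR0_eq0 (x : X) : normR x = 0 -> x = 0.
Proof. by move=> x0; apply/normr0_eq0; rewrite normR_complex x0. Qed.

Lemma normRN (x : X) : normR (- x) = normR x.
Proof. by rewrite /normR normrN. Qed.

Lemma normRB (x y : X) : normR (x - y) = normR (y - x).
Proof. by rewrite /normR distrC. Qed.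

Lemma ler_normRD (x y : X) : normR (x + y) <= normR x + normR y.
Proof. by rewrite -lecR rmorphD/= -!normR_complex ler_normD. Qed.

Lemma ler_normRB (x y : X) : normR (x - y) <= normR x + normR y.
Proof. by rewrite (le_trans (ler_normRD _ _))// normRN. Qed.

Lemma normRZ (l : R[i]) (x : X) : normR (l *: x) = cabs l * normR x.
Proof.
by apply: complexI; rewrite rmorphM/= -!normR_complex -cabsE normrZ.
Qed.

Lemma normRZr (a : R) (x : X) : normR (a%:C *: x) = `|a| * normR x.
Proof. by rewrite normRZ cabs_real. Qed.

Lemma ripC x y : rip x y = rip y x.
Proof. by rewrite /rip hermC/= expr0 mul1r; case: (ip y x). Qed.

Lemma ripDl x y z : rip (x + y) z = rip x z + rip y z.
Proof. by rewrite /rip linearDl; exact: ReCD. Qed.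

Lemma ripDr x y z : rip x (y + z) = rip x y + rip x z.
Proof. by rewrite ripC ripDl !(ripC x). Qed.

Lemma ripNl x y : rip (- x) y = - rip x y.
Proof. by rewrite /rip linearNl; exact: ReCN. Qed.

Lemma ripNr x y : rip x (- y) = - rip x y.
Proof. by rewrite ripC ripNl ripC. Qed.

Lemma ripBl x y z : rip (x - y) z = rip x z - rip y z.
Proof. by rewrite ripDl ripNl. Qed.

Lemma ripBr x y z : rip x (y - z) = rip x y - rip x z.
Proof. by rewrite ripDr ripNr. Qed.

Lemma ripZ (l : R[i]) x y : rip (l *: x) y = ReC (l * ip x y).
Proof. by rewrite /rip linearZl_LR. Qed.

Lemma ripZl (a : R) x y : rip (a%:C *: x) y = a * rip x y.
Proof. by rewrite ripZ ReCM/= mul0r subr0. Qed.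

Lemma ripZr (a : R) x y : rip x (a%:C *: y) = a * rip x y.
Proof. by rewrite ripC ripZl ripC. Qed.

Lemma rip_normR x : rip x x = normR x ^+ 2.
Proof. by rewrite /rip -ip_norm normR_complex -rmorphXn. Qed.

Lemma rip_le x y : rip x y <= normR x * normR y.
Proof.
have [->|x0] := eqVneq x 0; first by rewrite /rip linear0l normR0 mul0r.
have [->|y0] := eqVneq y 0; first by rewrite ripC /rip linear0l normR0 mulr0.
have nx : 0 < normR x.
  by rewrite lt_neqAle normR_ge0 andbT eq_sym; apply: contra_neq x0 => /normR0_eq0.
have ny : 0 < normR y.
  by rewrite lt_neqAle normR_ge0 andbT eq_sym; apply: contra_neq y0 => /normR0_eq0.
have := sqr_ge0 (normR ((normR y)%:C *: x - (normR x)%:C *: y)).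
rewrite -rip_normR ripBl !ripBr !(ripZl, ripZr) !rip_normR (ripC y x).
have nxy : 0 < normR x * normR y by exact: mulr_gt0.
set a := normR x in nx nxy *; set b := normR y in ny nxy *; set c := rip x y.
move=> H; rewrite -(ler_pM2l nxy); nra.
Qed.

Lemma rip_norm_le x y : `|rip x y| <= normR x * normR y.
Proof.
by rewrite ler_norml rip_le andbT -(normRN x) lerNl -ripNl rip_le.
Qed.

Lemma Re_mul_ip_le (c : R[i]) x y :
  `|ReC (c * ip x y)| <= cabs c * normR x * normR y.
Proof. by rewrite -ripZ (le_trans (rip_norm_le _ _))// normRZ. Qed.

Lemma Im_mul_ip_le (c : R[i]) x y :
  `|ImC (c * ip x y)| <= cabs c * normR x * normR y.
Proof.
rewrite -normrN -ReiNIm mulrAC (le_trans (Re_mul_ip_le _ _ _))//.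
by rewrite cabsM cabs_i mulr1.
Qed.

(** The radii that define the topology of [X] are elements of [R[i]]; this
    equivalence replaces them by real numbers. *)
Lemma cvg_normR (T : Type) (F : set_system T) (FF : Filter F) (f : T -> X) (l : X) :
  (forall e : R, 0 < e -> \forall t \near F, normR (l - f t) < e) <->
  f @ F --> l.
Proof.
split=> [H|/cvgrPdist_lt H e e0].
  apply/cvgrPdist_lt => e e0.
  have er : e = (ReC e)%:C by rewrite RRe_real// gtr0_real.
  have : 0 < ReC e by rewrite -ltcR -er.
  move=> /H; apply: filterS => t; rewrite er normR_complex ltcR//.
have : 0 < e%:C by rewrite ltcR.
by move=> /H; apply: filterS => t; rewrite normR_complex ltcR.
Qed.

End RealInnerProduct.

(* The sign conditions of the many products of norms below are left to [//]. *)
#[local] Hint Extern 0 (is_true (@Order.le _ _ _ (normR _))) => (exact: normR_ge0) : core.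
#[local] Hint Extern 0 (is_true (@Order.le _ _ _ (cabs _))) => (exact: cabs_ge0) : core.

(** * Fixed points and differentiation of curves *)

Lemma normR_continuous {R : realType} {X : completeNormedModType R[i]}
    (F : R -> X) : continuous F -> continuous (fun t => normR (F t)).
Proof.
move=> Fc t; apply/cvgrPdist_lt => e e0.
have /cvg_normR/(_ _ e0) := Fc t; apply: filterS => s.
apply: le_lt_trans; rewrite ler_norml; apply/andP; split.
- have := ler_normRB (F t) (F t - F s); rewrite subKr; lra.
- have := ler_normRD (F t - F s) (F s); rewrite subrK; lra.
Qed.

Section ContractionPrinciple.
Context {R : realType} {X : completeNormedModType R[i]}.

(** The iterates of [0] form a Cauchy sequence, since their increments are
    dominated by a geometric series. *)
Lemma contraction_fixed_point (F : X -> X) (q : R) : 0 <= q -> q < 1 ->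
  (forall x y, normR (F x - F y) <= q * normR (x - y)) -> exists p, F p = p.
Proof.
move=> q0 q1 FL.
pose z n := iter n F 0.
pose d := normR (z 1%N - z 0%N).
pose s := series (geometric d q).
have step n : normR (z n.+1 - z n) <= geometric d q n.
  elim: n => [|k ih]; first by rewrite /geometric/= expr0 mulr1.
  rewrite (le_trans (FL _ _))// (le_trans (ler_wpM2l q0 ih))//.
  by rewrite /geometric/= exprS mulrCA.
have zs n m : (n <= m)%N -> normR (z m - z n) <= s m - s n.
  move=> nm; rewrite -(subnKC nm); move: (m - n)%N => k; elim: k => [|k ih].
    by rewrite addn0 !subrr normR0.
  rewrite addnS -[_ - z n](subrKA (z (n + k)%N)) /s [X in _ <= X - _]seriesSr.
  by rewrite (le_trans (ler_normRD _ _))// addrAC [leRHS]addrC lerD.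
have s_cvg : cvgn s by apply: is_cvg_geometric_series; rewrite ger0_norm.
have zsabs n m : normR (z m - z n) <= `|s m - s n|.
  have [nm|mn] := leqP n m; first by rewrite (le_trans (zs _ _ nm))// ler_norm.
  by rewrite normRB distrC (le_trans (zs _ _ (ltnW mn)))// ler_norm.
have z_cvg : cvgn z.
  apply/cauchy_cvgP/cauchy_ballP => e e0; near_simpl.
  have er : e = (ReC e)%:C by rewrite RRe_real// gtr0_real.
  have e0' : 0 < ReC e by rewrite -ltcR -er.
  move/cauchy_cvgP/cauchy_ballP : s_cvg => /(_ _ e0'); near_simpl.
  apply: filterS => -[n m] /=; rewrite -!ball_normE/= => sn.
  by rewrite er normR_complex ltcR (le_lt_trans (zsabs _ _)).
have /cvg_ex[p zp] := z_cvg; exists p.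
have zp' : z n.+1 @[n --> \oo] --> p by rewrite cvg_shiftS.
apply: (cvg_unique _ _ zp') => //.
apply/cvg_normR => e e0.
move/cvg_normR : zp => /(_ _ e0); apply: filterS => n zn.
apply: le_lt_trans zn; rewrite (le_trans (FL _ _))//.
by apply: ler_piMl => //; exact: ltW.
Unshelve. all: by end_near. Qed.

End ContractionPrinciple.

Lemma addr_split (V : zmodType) (a b c : V) : a = b + (c + (a - b - c)).
Proof. by rewrite [c + _]addrC subrK addrC subrK. Qed.

Section VectorDerivative.
Context {R : realType} {X : completeNormedModType R[i]}.
Variable ip : {dot X for Num.conj}.
Hypothesis ip_norm : hilbert_norm ip.

(** Differentiability of a curve in [X] with respect to a real parameter. As
    [X] is normed over [R[i]], the derivative of a function between normed
    spaces over one field does not cover this case. *)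
Definition vderiv (F : R -> X) (t : R) (D : X) : Prop :=
  forall e : R, 0 < e -> exists2 d : R, 0 < d &
    forall h, `|h| < d -> normR (F (t + h) - F t - h%:C *: D) <= e * `|h|.

Lemma is_derive_le (f : R -> R) (t D : R) :
  (forall e : R, 0 < e -> exists2 d : R, 0 < d &
    forall h, `|h| < d -> `|f (t + h) - f t - h * D| <= e * `|h|) ->
  is_derive t 1 f D.
Proof.
move=> H.
have fD : h^-1 *: (f (h *: 1 + t) - f t) @[h --> 0^'] --> D.
  apply/cvgrPdist_le => e e0.
  have [d d0 Hd] := H _ e0.
  near=> h.
  have h0 : h != 0 by near: h; exact: nbhs_dnbhs_neq.
  have hd : `|h| < d.
    by near: h; apply: dnbhs0_lt.
  rewrite [h *: 1]mulr1 [h + t]addrC [_ *: _]mulrC.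
  have -> : D - (f (t + h) - f t) / h = - (f (t + h) - f t - h * D) / h.
    by field.
  by rewrite normrM normrN normfV ler_pdivrMr ?normr_gt0//; exact: Hd.
by apply: DeriveDef; [apply/cvg_ex; exists D|apply: cvg_lim].
Unshelve. all: by end_near. Qed.

(** A remainder that is quadratic in [h] is in particular [o(h)]. *)
Lemma is_derive_quadratic (f : R -> R) (t D C d : R) : 0 < d ->
  (forall h, `|h| < d -> `|f (t + h) - f t - h * D| <= C * h ^+ 2) ->
  is_derive t 1 f D.
Proof.
move=> d0 H; apply: is_derive_le => e e0.
have C0 : 0 < `|C| + 1 by rewrite ltr_wpDl.
exists (Num.min d (e / (`|C| + 1))); first by rewrite lt_min d0 divr_gt0.
move=> h; rewrite lt_min => /andP[hd he]; rewrite (le_trans (H _ hd))//.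
rewrite -real_normK ?num_real// expr2 mulrA ler_wpM2r//.
move: he; rewrite ltr_pdivlMr// => he.
have := ler_norm C; have := normr_ge0 h; nra.
Qed.

Lemma is_derive_rip (F G : R -> X) (t : R) (D E : X) :
  vderiv F t D -> vderiv G t E ->
  is_derive t 1 (fun s => rip ip (F s) (G s)) (rip ip D (G t) + rip ip (F t) E).
Proof.
move=> dF dG; apply: is_derive_le => e e0.
pose K := normR (F t) + normR (G t) + 1.
have K0 : 0 < K by apply: ltr_wpDl => //; exact: addr_ge0.
have [d1 d10 H1] := dF _ (divr_gt0 e0 (mulr_gt0 (ltr0n _ 2) K0)).
have [d2 d20 H2] := dG _ (divr_gt0 e0 (mulr_gt0 (ltr0n _ 2) K0)).
have [d3 d30 H3] := dF _ ltr01.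
have [d4 d40 H4] := dG _ ltr01.
pose L := (normR D + 1) * (normR E + 1).
have L0 : 0 < L by rewrite mulr_gt0// ltr_wpDl.
exists (Num.min (Num.min d1 d2) (Num.min (Num.min d3 d4) (e / (2 * L)))).
  by rewrite !lt_min d10 d20 d30 d40 divr_gt0// mulr_gt0.
move=> h; rewrite !lt_min => /andP[/andP[hd1 hd2] /andP[/andP[hd3 hd4] hL]].
have {}H1 := H1 _ hd1; have {}H2 := H2 _ hd2.
have {}H3 := H3 _ hd3; have {}H4 := H4 _ hd4.
set rF := F (t + h) - F t - h%:C *: D in H1 H3.
set rG := G (t + h) - G t - h%:C *: E in H2 H4.
have EF : F (t + h) = F t + (h%:C *: D + rF).
  exact: addr_split.
have EG : G (t + h) = G t + (h%:C *: E + rG).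
  exact: addr_split.
have dFn : normR (h%:C *: D + rF) <= (normR D + 1) * `|h|.
  by rewrite (le_trans (ler_normRD _ _))// normRZr mulrDl [normR D * _]mulrC lerD.
have dGn : normR (h%:C *: E + rG) <= (normR E + 1) * `|h|.
  by rewrite (le_trans (ler_normRD _ _))// normRZr mulrDl [normR E * _]mulrC lerD.
have -> : rip ip (F (t + h)) (G (t + h)) - rip ip (F t) (G t) -
    h * (rip ip D (G t) + rip ip (F t) E) =
    rip ip rF (G t) + rip ip (F t) rG + rip ip (h%:C *: D + rF) (h%:C *: E + rG).
  rewrite EF EG; rewrite (ripDl ip (F t)) (ripDr ip (F t)) (ripDr ip (h%:C *: D + rF)).
  rewrite (ripDr ip (F t)) (ripDl ip (h%:C *: D) rF (G t)) ripZl ripZr; ring.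
have B1 := rip_norm_le ip_norm rF (G t).
have B2 := rip_norm_le ip_norm (F t) rG.
have B3 := rip_norm_le ip_norm (h%:C *: D + rF) (h%:C *: E + rG).
rewrite (le_trans (ler_normD _ _))//.
have {}B3 : `|rip ip (h%:C *: D + rF) (h%:C *: E + rG)| <= e / 2 * `|h|.
  apply: (le_trans B3); apply: (@le_trans _ _ (L * `|h| * `|h|)).
    rewrite /L.
    rewrite [X in _ <= X](_ : _ = ((normR D + 1) * `|h|) * ((normR E + 1) * `|h|)); last ring.
    by rewrite ler_pM.
  rewrite ler_wpM2r//; move: hL; rewrite ltr_pdivlMr; last exact: mulr_gt0.
  move=> hL.
  by rewrite ler_pdivlMr//; lra.
have {B1 B2} : `|rip ip rF (G t) + rip ip (F t) rG| <= e / 2 * `|h|.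
  rewrite (le_trans (ler_normD _ _))//.
  apply: (@le_trans _ _ (e / (2 * K) * `|h| * (normR (F t) + normR (G t)))).
    rewrite mulrDr addrC lerD//.
      by rewrite (le_trans B2)// mulrC ler_wpM2r.
    by rewrite (le_trans B1)// ler_wpM2r.
  rewrite mulrAC ler_wpM2r//.
  have SK : (normR (F t) + normR (G t)) / K <= 1.
    by rewrite ler_pdivrMr// mul1r /K lerDl.
  rewrite (_ : _ * (_ + _) = e / 2 * ((normR (F t) + normR (G t)) / K)); last first.
    by rewrite invfM; ring.
  by apply: ler_piMr => //; apply: divr_ge0 => //; exact: ltW.
move=> B1; rewrite (le_trans (lerD B1 B3))// -mulrDl; lra.
Qed.

Lemma vderiv_cst (v : X) (t : R) : vderiv (fun=> v) t 0.
Proof.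
move=> e e0; exists 1 => // h _.
by rewrite scaler0 subr0 subrr normR0 mulr_ge0// ltW.
Qed.

End VectorDerivative.

(** * Contraction semigroups and their orbits *)

Section ContractionSemigroup.
Context {R : realType} {X : completeNormedModType R[i]}.
Variable ip : {dot X for Num.conj}.
Hypothesis ip_norm : hilbert_norm ip.
Variable T : R -> {linear X -> X}.
Hypothesis T_C0 : C0_semigroup T.
Hypothesis T_contr : contractive T.
Let A := generator T.

Lemma contr_normR (t : R) (x : X) : 0 <= t -> normR (T t x) <= normR x.
Proof. by move=> t0; rewrite -lecR -!normR_complex; exact: T_contr. Qed.

Lemma semigroup0 (x : X) : T 0 x = x.
Proof. by case: T_C0 => _ + _ _; apply. Qed.

Lemma semigroupD (s t : R) (x : X) : 0 <= s -> 0 <= t -> T (s + t) x = T s (T t x).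
Proof. by case: T_C0 => _ _ TD _ s0 t0; exact: TD. Qed.

Lemma semigroupB (s : R) (x y : X) : T s (x - y) = T s x - T s y.
Proof. exact: linearB. Qed.

Lemma semigroupZ (s : R) (a : R[i]) (x : X) : T s (a *: x) = a *: T s x.
Proof. exact: linearZ. Qed.

Lemma near_right0 (P : R -> Prop) : (\forall h \near (0 : R)^'+, P h) <->
  exists2 d : R, 0 < d & forall h, 0 < h -> h < d -> P h.
Proof.
split=> [|[d d0 Pd]].
  rewrite /at_right near_withinE => -[d /= d0 Pd]; exists d => // h h0 hd.
  by apply: Pd => //=; rewrite sub0r normrN gtr0_norm.
near=> h; apply: Pd; first by near: h; exact: nbhs_right_gt.
by near: h; exact: nbhs_right_lt.
Unshelve. all: by end_near. Qed.

Lemma semigroup_cvg0 (x : X) (e : R) : 0 < e ->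
  exists2 d : R, 0 < d & forall h, 0 <= h -> h < d -> normR (T h x - x) <= e.
Proof.
move=> e0; case: T_C0 => _ _ _ /(_ x)/cvg_normR/(_ _ e0)/near_right0[d d0 Hd].
exists d => // h; rewrite le_eqVlt => /predU1P[<- _|h0 hd].
  by rewrite semigroup0 subrr normR0 ltW.
by rewrite normRB ltW// Hd.
Qed.

Lemma scaler_invB (K : fieldType) (V : lmodType K) (h : K) (a l : V) :
  h != 0 -> l - h^-1 *: a = - h^-1 *: (a - h *: l).
Proof.
by move=> h0; rewrite scaleNr scalerBr scalerA mulVf// scale1r opprB.
Qed.

(** Membership in the domain of the generator as a first order expansion at
    [0] on the right. *)
Lemma generatorP (z l : X) : (dom A z /\ A z = l) <->
  (forall e : R, 0 < e -> exists2 d : R, 0 < d &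
    forall h, 0 < h -> h < d -> normR (T h z - z - h%:C *: l) <= e * h).
Proof.
have E h : 0 < h -> normR (l - diff_quot T z h) = normR (T h z - z - h%:C *: l) / h.
  move=> h0; rewrite /diff_quot fmorphV scaler_invB ?(inj_eq (@complexI R)) ?gt_eqF//.
  rewrite scaleNr normRN -fmorphV normRZr mulrC gtr0_norm ?invr_gt0//.
split=> [[Az Azl] e e0|H].
  have : diff_quot T z h @[h --> 0^'+] --> l by rewrite -Azl; exact: Az.
  move=> /cvg_normR/(_ _ e0)/near_right0[d d0 Hd]; exists d => // h h0 hd.
  by have := Hd h h0 hd; rewrite E// ltr_pdivrMr// => /ltW.
have dl : diff_quot T z h @[h --> 0^'+] --> l.
  apply/cvg_normR => e e0; apply/near_right0.
  have [d d0 Hd] := H _ (divr_gt0 e0 (ltr0n _ 2)); exists d => // h h0 hd.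
  rewrite E// ltr_pdivrMr// (le_lt_trans (Hd h h0 hd))// ltr_pM2r//; lra.
by split; [apply/cvg_ex; exists l|exact: cvg_lim].
Qed.

Lemma generator_orbit (t : R) (z : X) : 0 <= t -> dom A z ->
  dom A (T t z) /\ A (T t z) = T t (A z).
Proof.
move=> t0 Az; apply/generatorP => e e0.
have [d d0 Hd] := (generatorP z (A z)).1 (conj Az erefl) _ e0.
exists d => // h h0 hd; rewrite -semigroupD ?(ltW h0)// [h + t]addrC semigroupD ?(ltW h0)//.
rewrite -linearZ -!linearB/=.
by rewrite (le_trans (contr_normR _ _))// Hd.
Qed.

Lemma generator_linear (a : R[i]) (x y : X) : dom A x -> dom A y ->
  dom A (a *: x + y) /\ A (a *: x + y) = a *: A x + A y.
Proof.
move=> Ax Ay; apply/generatorP => e e0.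
have a0 : 0 < cabs a + 1 by apply: ltr_wpDl.
have [d1 d10 H1] := (generatorP x (A x)).1 (conj Ax erefl) _ (divr_gt0 (divr_gt0 e0 (ltr0n _ 2)) a0).
have [d2 d20 H2] := (generatorP y (A y)).1 (conj Ay erefl) _ (divr_gt0 e0 (ltr0n _ 2)).
exists (Num.min d1 d2); first by rewrite lt_min d10.
move=> h h0; rewrite lt_min => /andP[hd1 hd2].
rewrite linearP.
have -> : a *: T h x + T h y - (a *: x + y) - h%:C *: (a *: A x + A y) =
    a *: (T h x - x - h%:C *: A x) + (T h y - y - h%:C *: A y).
  rewrite !scalerBr scalerDr !scalerA (mulrC a) !opprD !addrA.
  by rewrite (ACl (1*3*5*2*4*6)).
rewrite (le_trans (ler_normRD _ _))// normRZ.
apply: (le_trans (lerD (ler_wpM2l (cabs_ge0 a) (H1 _ h0 hd1)) (H2 _ h0 hd2))).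
rewrite mulrA -mulrDl ler_wpM2r ?(ltW h0)//.
have : cabs a / (cabs a + 1) <= 1 by rewrite ler_pdivrMr// mul1r lerDl.
rewrite mulrCA; set c := _ / (_ + 1) => c1.
have : e / 2 * c <= e / 2 by rewrite ler_piMr// divr_ge0// ltW.
lra.
Qed.

Lemma generator0 : dom A 0 /\ A 0 = 0.
Proof.
apply/generatorP => e e0; exists 1; first exact: ltr01.
by move=> h h0 _; rewrite linear0 scaler0 !subr0 normR0 mulr_ge0// ltW.
Qed.

Lemma generatorZ (a : R[i]) (x : X) : dom A x ->
  dom A (a *: x) /\ A (a *: x) = a *: A x.
Proof.
move=> Ax; have [A0 A00] := generator0.
by have := generator_linear a Ax A0; rewrite A00 !addr0.
Qed.

Lemma generatorD (x y : X) : dom A x -> dom A y ->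
  dom A (x + y) /\ A (x + y) = A x + A y.
Proof. by move=> Ax Ay; have := generator_linear 1 Ax Ay; rewrite !scale1r. Qed.

Lemma generatorN (x : X) : dom A x -> dom A (- x) /\ A (- x) = - A x.
Proof. by move=> Ax; have := generatorZ (-1) Ax; rewrite !scaleN1r. Qed.

Lemma generatorB (x y : X) : dom A x -> dom A y ->
  dom A (x - y) /\ A (x - y) = A x - A y.
Proof.
by move=> Ax Ay; have [Ny NyE] := generatorN Ay; rewrite -NyE; exact: generatorD.
Qed.

(** The derivative at [0] of the nonincreasing function [|T(h) z|^2] is not
    positive. *)
Lemma generator_dissipative (z : X) : dom A z -> rip ip (A z) z <= 0.
Proof.
move=> Az; apply/ler_addgt0Pr => e e0; rewrite add0r.
have n0 : 0 < normR z + 1 by apply: ltr_wpDl.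
have [d d0 Hd] := (generatorP z (A z)).1 (conj Az erefl) _ (divr_gt0 e0 n0).
have h0 : 0 < d / 2 by rewrite divr_gt0.
have hd : d / 2 < d by lra.
have := Hd _ h0 hd; move: (d / 2) h0 => h h0 Hh.
have : h * rip ip (A z) z <= h * e; last by rewrite ler_pM2l.
rewrite -ripZl.
have -> : h%:C *: A z = (T h z - z) - (T h z - z - h%:C *: A z).
  by rewrite opprB addrC subrK.
rewrite ripBl ripBl rip_normR//.
have B1 : rip ip (T h z) z <= normR z ^+ 2.
  rewrite (le_trans (rip_le ip_norm _ _))// expr2 ler_wpM2r//.
  by rewrite contr_normR// ltW.
have B2 := rip_norm_le ip_norm (T h z - z - h%:C *: A z) z.
have B3 : normR (T h z - z - h%:C *: A z) * normR z <= h * e.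
  apply: (le_trans (ler_wpM2r (normR_ge0 z) Hh)).
  rewrite (mulrC _ h) -mulrA ler_pM2l// mulrAC ler_pdivrMr// ler_pM2l//; lra.
have := ler_norm (- rip ip (T h z - z - h%:C *: A z) z); rewrite normrN; lra.
Qed.

(** Constant for negative times, which makes it a continuous function on the
    whole line. *)
Definition orbit (z : X) (s : R) : X := T (Num.max 0 s) z.

Lemma orbit_normR (z : X) (s : R) : normR (orbit z s) <= normR z.
Proof. by rewrite contr_normR// le_max lexx. Qed.

(** The derivative on the right is the definition of the generator. On the
    left, [T(t) = T(t - k) T(k)] transports the expansion at [0] by the
    contraction [T(t - k)]. *)
Lemma vderiv_orbit (z : X) (t : R) : 0 < t -> dom A z ->
  vderiv (orbit z) t (T t (A z)).
Proof.
move=> t0 Az e e0.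
have e20 := divr_gt0 e0 (ltr0n _ 2).
have [d1 d10 H1] := (generatorP z (A z)).1 (conj Az erefl) _ e20.
have [d2 d20 H2] := semigroup_cvg0 (A z) e20.
exists (Num.min t (Num.min d1 d2)); first by rewrite !lt_min t0 d10.
move=> h; rewrite !lt_min => /and3P[ht hd1 hd2].
have [h0|h0|->] := ltgtP h 0; last first.
- by rewrite addr0 subrr scale0r subrr normR0 normr0 mulr0.
- rewrite /orbit !max_r ?(ltW t0)//; last by rewrite addr_ge0// ltW.
  move: hd1; rewrite gtr0_norm// => hd1.
  rewrite semigroupD ?(ltW t0) ?(ltW h0)// -linearZ -!linearB/=.
  rewrite (le_trans (contr_normR _ _)) ?ltW//.
  by rewrite (le_lt_trans (H1 _ h0 hd1))// ltr_pM2r//; lra.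
- move: ht hd1 hd2 h0; rewrite -[h]opprK; move: (- h) => k.
  rewrite oppr_lt0 normrN => + + + k0; rewrite gtr0_norm// => kt kd1 kd2.
  rewrite /orbit !max_r ?(ltW t0) ?subr_ge0 ?(ltW kt)//.
  have tk0 : 0 <= t - k by rewrite subr_ge0 ltW.
  have Tt u : T t u = T (t - k) (T k u) by rewrite -semigroupD// ?subrK// ltW.
  have -> : T (t - k) z - T t z - (- k)%:C *: T t (A z) =
     T (t - k) (k%:C *: (T k (A z) - A z) - (T k z - z - k%:C *: A z)).
    rewrite semigroupB semigroupZ !semigroupB semigroupZ -!Tt rmorphN scaleNr opprK.
    by rewrite scalerBr !opprB addrA subrK addrC.
  rewrite (le_trans (contr_normR _ _))// (le_trans (ler_normRB _ _))//.
  rewrite normRZr gtr0_norm//.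
  apply: (le_trans (lerD (ler_wpM2l (ltW k0) (H2 _ (ltW k0) kd2)) (H1 _ k0 kd1))).
  lra.
Qed.

(** By contractivity the modulus of continuity of an orbit is governed by its
    behaviour at [0]. *)
Lemma orbit_dist (z : X) (s t : R) : 0 <= s -> 0 <= t ->
  normR (T t z - T s z) <= normR (T `|t - s| z - z).
Proof.
wlog st : s t / s <= t => [H s0 t0|s0 t0].
  have [st|/ltW ts] := leP s t; first exact: H.
  by rewrite normRB distrC; exact: H.
rewrite ger0_norm ?subr_ge0// -[in T t z](subrK s t) [t - s + s]addrC.
by rewrite (semigroupD (s := s)) ?subr_ge0// -semigroupB contr_normR.
Qed.

Lemma continuous_orbit (z : X) : continuous (orbit z).
Proof.
move=> t; apply/cvg_normR => e e0.
have [d d0 Hd] := semigroup_cvg0 z (divr_gt0 e0 (ltr0n _ 2)).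
near=> s; have ts : `|t - s| < d by near: s; exact: cvgr_dist_lt.
rewrite (@le_lt_trans _ _ (e / 2)) ?gtr_pMr ?invf_lt1 ?ltr1n//.
rewrite (le_trans (orbit_dist _ _ _)) ?le_max ?lexx// Hd//.
apply: le_lt_trans ts; rewrite ler_norml.
have := ler_norm (s - t); have := ler_norm (t - s); rewrite distrC.
by rewrite /Num.max; case: ltP => ?; case: ltP => ? ? ?; apply/andP; split; lra.
Unshelve. all: by end_near. Qed.

End ContractionSemigroup.

(** * The resolvent of the generator *)

Section Resolvent.
Context {R : realType} {X : completeNormedModType R[i]}.
Variable ip : {dot X for Num.conj}.
Hypothesis ip_norm : hilbert_norm ip.
Variable T : R -> {linear X -> X}.
Hypothesis T_C0 : C0_semigroup T.
Hypothesis T_contr : contractive T.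
Let A := generator T.

(** Surjectivity of [l - A] together with a lower bound is equivalent to a
    resolvent of norm at most [m], and it is the form that is stable under
    perturbation of [l]. *)
Definition resolvent_bound (l : R[i]) (m : R) : Prop :=
  (forall x, exists2 z, dom A z & l *: z - A z = x) /\
  (forall z, dom A z -> normR z <= m * normR (l *: z - A z)).

Definition res (l : R[i]) (x : X) : X := resolvent l A x.

Lemma resolvent_boundW (l : R[i]) (m m' : R) : m <= m' ->
  resolvent_bound l m -> resolvent_bound l m'.
Proof.
move=> mm' [Hs Hb]; split=> // z Az.
by rewrite (le_trans (Hb _ Az))// ler_wpM2r.
Qed.

Lemma res_dom_eq (l : R[i]) (m : R) (x : X) : resolvent_bound l m ->
  dom A (res l x) /\ l *: res l x - A (res l x) = x.
Proof.
move=> [Hs _]; have [z Az zx] := Hs x.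
by apply: (@getPex _ [set x0 | dom A x0 /\ l *: x0 - A x0 = x]); exists z.
Qed.

Lemma res_dom (l : R[i]) (m : R) (x : X) : resolvent_bound l m -> dom A (res l x).
Proof. by move=> H; have [] := res_dom_eq x H. Qed.

Lemma resK (l : R[i]) (m : R) (x : X) : resolvent_bound l m ->
  A (res l x) = l *: res l x - x.
Proof.
by move=> H; have [_ {3}<-] := res_dom_eq x H; rewrite subKr.
Qed.

Lemma res_unique (l : R[i]) (m : R) (x z : X) : resolvent_bound l m ->
  dom A z -> l *: z - A z = x -> res l x = z.
Proof.
move=> H Az zx; have [Ar rx] := res_dom_eq x H.
have [dB BE] := generatorB Ar Az.
apply/eqP; rewrite -subr_eq0; apply/eqP/normR0_eq0/le_anti.
rewrite normR_ge0 andbT; case: H => _ /(_ _ dB) /le_trans -> //.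
by rewrite BE scalerBr opprD addrACA -opprD rx zx subrr normR0 mulr0.
Qed.

Lemma res_normR (l : R[i]) (m : R) (x : X) : resolvent_bound l m ->
  normR (res l x) <= m * normR x.
Proof. by move=> H; have [Ar {2}<-] := res_dom_eq x H; exact: H.2. Qed.

Lemma res_linear (l : R[i]) (m : R) (a : R[i]) (x y : X) : resolvent_bound l m ->
  res l (a *: x + y) = a *: res l x + res l y.
Proof.
move=> H.
have [Ax Ex] := res_dom_eq x H; have [Ay Ey] := res_dom_eq y H.
have [AD DE] := generator_linear a Ax Ay.
apply: (res_unique H) => //; rewrite DE -[in RHS]Ex -[in RHS]Ey.
by rewrite scalerDr scalerBr !scalerA (mulrC l) opprD !addrA (ACl (1*3*2*4)).
Qed.

Lemma resB (l : R[i]) (m : R) (x y : X) : resolvent_bound l m ->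
  res l (x - y) = res l x - res l y.
Proof.
by move=> H; rewrite addrC -scaleN1r (res_linear _ _ _ H) scaleN1r addrC.
Qed.

Lemma resZ (l : R[i]) (m : R) (a : R[i]) (x : X) : resolvent_bound l m ->
  res l (a *: x) = a *: res l x.
Proof.
move=> H; have r0 : res l 0 = 0 by have := resB 0 0 H; rewrite !subrr.
by have := res_linear a x 0 H; rewrite r0 !addr0.
Qed.

Lemma semigroup_res (l : R[i]) (m : R) (t : R) (x : X) : resolvent_bound l m ->
  0 <= t -> T t (res l x) = res l (T t x).
Proof.
move=> H t0; have [Ax Ex] := res_dom_eq x H.
have [AT ATE] := generator_orbit T_C0 T_contr t0 Ax.
by symmetry; apply: (res_unique H) => //; rewrite ATE -semigroupZ -semigroupB Ex.
Qed.

Lemma res_identity (l k : R[i]) (m n : R) (x : X) :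
  resolvent_bound l m -> resolvent_bound k n ->
  res l x - res k x = (k - l) *: res l (res k x).
Proof.
move=> Hl Hk; have [Ak Ek] := res_dom_eq x Hk.
set w := res k x in Ak Ek *.
have {1}-> : x = (k - l) *: w + (l *: w - A w) by rewrite scalerBl addrA subrK.
by rewrite (res_linear _ _ _ Hl) (res_unique Hl Ak erefl) addrK.
Qed.

Lemma res_comm (l k : R[i]) (m n : R) (x : X) :
  resolvent_bound l m -> resolvent_bound k n ->
  res l (res k x) = res k (res l x).
Proof.
move=> Hl Hk; have [->//|kl] := eqVneq l k.
apply: (@scalerI _ _ (k - l)); first by rewrite subr_eq0 eq_sym.
rewrite -(res_identity _ Hl Hk) -opprB (res_identity _ Hk Hl).
by rewrite -scaleNr opprB.
Qed.

(** The equation [k z - A z = x] is the fixed point equation [z = R(l, A) (x +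
    (l - k) z)], in which the right-hand side is contractive for [k] near [l];
    this is the Neumann series without series. *)
Lemma res_surj_near (l k : R[i]) (m : R) : 0 <= m -> resolvent_bound l m ->
  cabs (k - l) * m < 1 -> forall x, exists2 z, dom A z & k *: z - A z = x.
Proof.
move=> m0 H klm x.
pose F z := res l (x + (l - k) *: z).
have [|||p Fp] := @contraction_fixed_point _ _ F (cabs (k - l) * m) => //.
- by rewrite mulr_ge0.
- move=> y z; rewrite /F -(resB _ _ H) opprD addrACA subrr add0r -scalerBr.
  rewrite (le_trans (res_normR _ H))// normRZ -opprB cabsN mulrA.
  by rewrite [m * _]mulrC.
have [Ap Ep] := res_dom_eq (x + (l - k) *: p) H.
rewrite -/(F p) Fp in Ap Ep; exists p => //.
apply: (@addIr _ ((l - k) *: p)); rewrite -Ep scalerBl.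
by rewrite addrC addrA subrK.
Qed.

Lemma resolvent_bound_near (l k : R[i]) (m : R) : 0 <= m -> resolvent_bound l m ->
  cabs (k - l) * m <= 2^-1 -> resolvent_bound k (2 * m).
Proof.
move=> m0 H klm; split.
  by apply: (res_surj_near m0 H); rewrite (le_lt_trans klm)// invf_lt1// ltr1n.
move=> z Az; have B1 := H.2 z Az.
have B2 : normR (l *: z - A z) <= normR (k *: z - A z) + cabs (k - l) * normR z.
  have -> : l *: z - A z = (k *: z - A z) - (k - l) *: z.
    by rewrite scalerBl opprB [RHS]addrC addrA subrK.
  by rewrite -normRZ ler_normRB.
have := ler_wpM2l m0 B2; have := normR_ge0 z; nra.
Qed.

(** For positive [k] dissipativity gives the lower bound with constant [1 /
    k]. Surjectivity starts from [0], where it holds by hypothesis, and is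
    continued along the half-line by steps of length [1 / (4 m)]; the lower
    bound keeps the length of the steps from shrinking. *)
Lemma resolvent_bound_pos (m l : R) : 0 < m -> resolvent_bound 0 m ->
  0 < l -> resolvent_bound l%:C l^-1.
Proof.
move=> m0 H0; have bnd k : 0 < k -> forall z, dom A z ->
    normR z <= k^-1 * normR (k%:C *: z - A z).
  move=> k0 z Az; rewrite mulrC ler_pdivlMr//.
  (* Dissipativity gives [k |z|^2 <= Re <k z - A z, z>]. *)
  have [->|z0] := eqVneq z 0; first by rewrite normR0 mul0r.
  have nz : 0 < normR z.
    by rewrite lt_neqAle normR_ge0 andbT eq_sym; apply: contra_neq z0 => /normR0_eq0.
  rewrite -(ler_pM2r nz) (le_trans _ (rip_le ip_norm _ _))//.
  rewrite ripBl ripZl rip_normR//.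
  have := generator_dissipative ip_norm T_contr Az; rewrite -/A; lra.
suff surj n : forall k, 0 < k -> k < m^-1 * (1 + n%:R / 4) ->
    forall x, exists2 z, dom A z & k%:C *: z - A z = x.
  move=> l0; split; last exact: bnd.
  apply: (surj (Num.bound (4 * l * m))) => //.
  rewrite mulrC ltr_pdivlMr//.
  have := archi_boundP (ltW (mulr_gt0 (mulr_gt0 (ltr0n _ 4) l0) m0)).
  lra.
elim: n => [|n ih] k k0 kn.
  apply: (res_surj_near (ltW m0) H0).
  rewrite subr0 cabs_real gtr0_norm//.
  by move: kn; rewrite mul0r addr0 mulr1 -ltr_pdivlMr// mul1r.
have m1 : 0 < m^-1 by rewrite invr_gt0.
have [km|km] := ltP k m^-1.
  by apply: ih => //; rewrite (lt_le_trans km)// ler_peMr ?(ltW m1)// lerDl divr_ge0.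
pose k' := k - m^-1 / 4.
have k'0 : 0 < k' by rewrite /k'; lra.
have rb : resolvent_bound k'%:C k'^-1.
  split; last exact: bnd.
  apply: ih => //; rewrite /k'; move: kn; rewrite -natr1 !mulrDr; lra.
apply: (res_surj_near _ rb); first by rewrite ltW// invr_gt0.
rewrite -rmorphB cabs_real ltr_pdivrMr// mul1r /k' opprB addrC subrK gtr0_norm; lra.
Qed.

Lemma resolvent_bound_opnorm (l : R[i]) (m : R) : resolvent_set A l ->
  (opnorm (resolvent l A) <= m%:E)%E -> resolvent_bound l m.
Proof.
move=> [inj dres _] lm.
have surj x : exists2 z, dom A z & l *: z - A z = x.
  have [z Az zx] : dom (resolvent l A) x by rewrite dres.
  by exists z.
split=> // z Az.
have rz y : dom A y -> res l (l *: y - A y) = y.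
  move=> Ay.
  have [] : dom A (res l (l *: y - A y)) /\
      l *: res l (l *: y - A y) - A (res l (l *: y - A y)) = l *: y - A y.
    by apply: (@getPex _ [set x0 | dom A x0 /\ l *: x0 - A x0 = _]); exists y.
  by move=> Ar Er; apply: inj; rewrite ?inE.
set x := l *: z - A z.
have [x0|x0] := eqVneq x 0.
  have [A0 A00] := generator0 T.
  have r0 : res l 0 = 0 by have := rz 0 A0; rewrite [A 0]A00 scaler0 subr0.
  have -> : z = 0 by rewrite -[LHS](rz z Az) -/x x0.
  by rewrite normR0 x0 normR0 mulr0.
have nx : 0 < normR x.
  by rewrite lt_neqAle normR_ge0 andbT eq_sym; apply: contra_neq x0 => /normR0_eq0.
pose c := ((normR x)^-1)%:C : R[i].
have [Acz Ecz] := generatorZ c Az.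
have cx : l *: (c *: z) - A (c *: z) = c *: x.
  by rewrite Ecz /x scalerBr !scalerA mulrC.
have : ((normR (res l (c *: x)))%:E <= m%:E)%E.
  apply: le_trans lm; apply: ereal_sup_ubound; exists (c *: x) => //=.
  by rewrite normRZr gtr0_norm ?invr_gt0// mulVf// gt_eqF.
by rewrite lee_fin -cx rz// normRZr gtr0_norm ?invr_gt0// mulrC ler_pdivrMr.
Qed.

End Resolvent.

(** * Integrals over the unit interval *)

Section UnitIntervalIntegral.
Context {R : realType}.
Local Notation mu := (@lebesgue_measure R).
Implicit Types f g : R -> R.

Definition int01 f : R := \int[mu]_(s in `[0, 1]) f s.

Lemma continuous01_integrable f : {within `[0, 1], continuous f} ->
  mu.-integrable `[0, 1] (EFin \o f).
Proof. by move=> cf; apply: continuous_compact_integrable => //; exact: segment_compact. Qed.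

Lemma derivable01_continuous f (df : R -> R) :
  (forall s : R, 0 <= s <= 1 -> is_derive s 1 f (df s)) -> {within `[0, 1], continuous f}.
Proof.
move=> fdf; apply: derivable_within_continuous => s; rewrite in_itv/= => s01.
by have [] := fdf _ s01.
Qed.

Lemma int01_derivative f (F : R -> R) : {within `[0, 1], continuous f} ->
  (forall s : R, 0 <= s <= 1 -> is_derive s 1 F (f s)) -> int01 f = F 1 - F 0.
Proof.
move=> cf dF; rewrite /int01 /Rintegral (@continuous_FTC2 _ f F)//.
  have cF := derivable01_continuous dF.
  split.
  - move=> s; rewrite in_itv/= => /andP[/ltW s0 /ltW s1].
    by have [] := dF s (introT andP (conj s0 s1)).
  - by have [_ + _] := (continuous_within_itvP _ ltr01).1 cF.
  - by have [_ _ +] := (continuous_within_itvP _ ltr01).1 cF.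
move=> s; rewrite in_itv/= => /andP[/ltW s0 /ltW s1].
by rewrite derive1E; have [_ ->] := dF s (introT andP (conj s0 s1)).
Qed.

(** Differentiation under the integral sign with a constant dominating
    function. *)
Lemma is_derive_int01 (f df : R -> R -> R) (a u v C : R) : u < a -> a < v ->
  (forall x : R, u < x -> x < v -> {within `[0, 1], continuous (f x)}) ->
  (forall x s : R, u < x -> x < v -> 0 <= s <= 1 -> is_derive x 1 (f ^~ s) (df x s)) ->
  (forall x s : R, u < x -> x < v -> 0 <= s <= 1 -> `|df x s| <= C) ->
  is_derive a 1 (fun x => int01 (f x)) (int01 (df a)).
Proof.
move=> ua av cf fdf dfC.
have C0 : 0 <= C by have := dfC a 0 ua av; rewrite lexx ler01 => /(_ isT); apply: le_trans.
have Ia : `]u, v[%classic a by rewrite /= in_itv/= ua av.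
have intf x : `]u, v[%classic x -> mu.-integrable `[0, 1] (EFin \o f x).
  by rewrite /= in_itv/= => /andP[ux xv]; exact/continuous01_integrable/cf.
have der x s : `]u, v[%classic x -> `[0, 1]%classic s -> derivable (f ^~ s) x 1.
  by rewrite /= !in_itv/= => /andP[ux xv] s01; have [] := fdf _ _ ux xv s01.
have E x s : `]u, v[%classic x -> `[0, 1]%classic s -> partial1of2 f x s = df x s.
  rewrite /= !in_itv/= => /andP[ux xv] s01; rewrite partial1of2E.
  by have [_ ->] := fdf _ _ ux xv s01.
have intC : mu.-integrable `[0, 1] (EFin \o cst C).
  by apply: continuous01_integrable => x; exact: cvg_cst.
have ub x s : `]u, v[%classic x -> `[0, 1]%classic s -> `|partial1of2 f x s| <= cst C s.
  by move=> Ix Bs; rewrite E//; move: Ix Bs; rewrite /= !in_itv/= => /andP[? ?] ?; exact: dfC.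
have mB := measurable_itv `[0 : R, 1].
have D := @derivable_under_integral R _ (measurableTypeR R) mu f `[0, 1]%classic mB a u v Ia intf der (cst C) (fun _ => C0) intC ub.
have V := @differentiation_under_integral R _ (measurableTypeR R) mu f `[0, 1]%classic mB a u v Ia intf der (cst C) (fun _ => C0) intC ub.
apply: DeriveDef; first exact: D.
rewrite -derive1E [LHS]V; apply: eq_Rintegral => s; rewrite inE => Bs.
exact: E.
Qed.

Lemma int01Zl (c : R) f : {within `[0, 1], continuous f} ->
  int01 (fun s => c * f s) = c * int01 f.
Proof. by move=> cf; rewrite /int01 RintegralZl//; exact: continuous01_integrable. Qed.

Lemma int01D f g : {within `[0, 1], continuous f} -> {within `[0, 1], continuous g} ->
  int01 (fun s => f s + g s) = int01 f + int01 g.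
Proof. by move=> cf cg; rewrite /int01 RintegralD//; exact: continuous01_integrable. Qed.

Lemma le_int01 f g : {within `[0, 1], continuous f} -> {within `[0, 1], continuous g} ->
  (forall s : R, 0 <= s <= 1 -> f s <= g s) -> int01 f <= int01 g.
Proof.
by move=> cf cg fg; apply: le_Rintegral => //; exact: continuous01_integrable.
Qed.

Lemma int01_cst (c : R) : int01 (fun=> c) = c.
Proof.
have dc (s : R) : 0 <= s <= 1 -> is_derive s 1 (c \*: (@id R)) c.
  by move=> _; apply: is_derive_eq; rewrite [_ *: _]mulr1.
have cc : {within `[0, 1], continuous (fun _ : R => c)} by move=> x; exact: cvg_cst.
by rewrite (int01_derivative cc dc) /= [_ *: 1]mulr1 [_ *: 0]mulr0 subr0.
Qed.

Lemma norm_int01_le f (C : R) : {within `[0, 1], continuous f} ->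
  (forall s : R, 0 <= s <= 1 -> `|f s| <= C) -> `|int01 f| <= C.
Proof.
move=> cf fC; have cc (c : R) : {within `[0, 1], continuous (fun _ : R => c)} by move=> x; exact: cvg_cst.
rewrite ler_norml; apply/andP; split; [rewrite -[leLHS]int01_cst|rewrite -[leRHS]int01_cst];
  apply: le_int01 => // s s01; by have := fC s s01; rewrite ler_norml => /andP[].
Qed.

End UnitIntervalIntegral.

(** * Complex differentiability along lines *)

Section Holomorphic.
Context {R : realType}.
Implicit Types (f g : R[i] -> R[i]) (u v : R -> R).

Lemma is_derive_fD u v (x a b : R) : is_derive x 1 u a -> is_derive x 1 v b ->
  is_derive x 1 (fun t => u t + v t) (a + b).
Proof. by move=> ? ?; exact: is_deriveD. Qed.

Lemma is_derive_fB u v (x a b : R) : is_derive x 1 u a -> is_derive x 1 v b ->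
  is_derive x 1 (fun t => u t - v t) (a - b).
Proof. by move=> ? ?; exact: is_deriveB. Qed.

Lemma is_derive_fM u v (x a b : R) : is_derive x 1 u a -> is_derive x 1 v b ->
  is_derive x 1 (fun t => u t * v t) (a * v x + u x * b).
Proof.
move=> ua vb; have := is_deriveM ua vb; rewrite /GRing.scale/= => H.
by apply: is_derive_eq; rewrite addrC [v x * a]mulrC.
Qed.

Lemma is_derive_fcomp u v (x a b : R) : is_derive (v x) 1 u a -> is_derive x 1 v b ->
  is_derive x 1 (fun t => u (v t)) (a * b).
Proof.
move=> ua vb; have := is_derive1_comp ua vb => H.
by apply: is_derive_eq; rewrite mulrC.
Qed.

Lemma is_derive_affine (a b x : R) : is_derive x 1 (fun t => a + t * b) b.
Proof.
have H : is_derive x 1 (fun t => a + t * b) (0 + (1 * b + x * 0)).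
  by apply: is_derive_fD; apply: is_derive_fM.
by rewrite mul1r mulr0 addr0 add0r in H.
Qed.

Lemma is_derive_feq u (x a b : R) : is_derive x 1 u a -> a = b -> is_derive x 1 u b.
Proof. by move=> ? <-. Qed.

(** Defined by components, so that it reduces to differentiation of real
    functions. *)
Definition cderiv (F : R -> R[i]) (t : R) (d : R[i]) : Prop :=
  is_derive t 1 (fun s => ReC (F s)) (ReC d) /\
  is_derive t 1 (fun s => ImC (F s)) (ImC d).

Lemma cderiv_eq (F : R -> R[i]) t d d' : cderiv F t d -> d = d' -> cderiv F t d'.
Proof. by move=> ? <-. Qed.

Lemma cderivD (F G : R -> R[i]) t d e : cderiv F t d -> cderiv G t e ->
  cderiv (fun s => F s + G s) t (d + e).
Proof.
move=> [Fr Fi] [Gr Gi]; split.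
  under eq_fun do rewrite ReCD; rewrite ReCD; exact: is_derive_fD.
under eq_fun do rewrite ImCD; rewrite ImCD; exact: is_derive_fD.
Qed.

Lemma cderivM (F G : R -> R[i]) t d e : cderiv F t d -> cderiv G t e ->
  cderiv (fun s => F s * G s) t (d * G t + F t * e).
Proof.
move=> [Fr Fi] [Gr Gi]; split.
  under eq_fun do rewrite ReCM; rewrite ReCD !ReCM.
  apply: (is_derive_feq (is_derive_fB (is_derive_fM Fr Gr) (is_derive_fM Fi Gi))).
  ring.
under eq_fun do rewrite ImCM; rewrite ImCD !ImCM.
apply: (is_derive_feq (is_derive_fD (is_derive_fM Fr Gi) (is_derive_fM Fi Gr))).
ring.
Qed.

Lemma cderiv_cst (c : R[i]) t : cderiv (fun=> c) t 0.
Proof. by split; exact: is_derive_cst. Qed.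

(** Differentiability at [z] with complex derivative [d] along every real line
    through [z]. Comparing the directions [w = 1] and [w = 'i] gives the
    Cauchy-Riemann equations, which is all that shifting a contour uses. *)
Definition holo f (z d : R[i]) : Prop :=
  forall w, cderiv (fun t : R => f (z + t%:C * w)) 0 (w * d).

Lemma holo_eq f z d d' : holo f z d -> d = d' -> holo f z d'.
Proof. by move=> ? <-. Qed.

Lemma holoD f g z d e : holo f z d -> holo g z e ->
  holo (fun l => f l + g l) z (d + e).
Proof. by move=> hf hg w; rewrite mulrDr; exact: cderivD. Qed.

Lemma holoM f g z d e : holo f z d -> holo g z e ->
  holo (fun l => f l * g l) z (d * g z + f z * e).
Proof.
move=> hf hg w; apply: cderiv_eq; first exact: (cderivM (hf w) (hg w)).
have z0 : z + 0%:C * w = z by rewrite rmorph0 mul0r addr0.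
by rewrite /= z0; ring.
Qed.

Lemma holo_cst (c : R[i]) z : holo (fun=> c) z 0.
Proof. by move=> w; rewrite mulr0; exact: cderiv_cst. Qed.

Lemma holo_id z : holo id z 1.
Proof.
move=> w; rewrite mulr1; case: z w => a b [c d]; split => /=.
  under eq_fun do rewrite mul0r subr0; exact: is_derive_affine.
under eq_fun do rewrite mul0r addr0; exact: is_derive_affine.
Qed.

Lemma holoZ (c : R[i]) f z d : holo f z d -> holo (fun l => c * f l) z (c * d).
Proof.
by move=> hf; apply: holo_eq; first exact: (holoM (holo_cst c z) hf); rewrite mul0r add0r.
Qed.

(** Euler's formula. *)
Definition cexp (z : R[i]) : R[i] :=
  (expR (ReC z) * cos (ImC z)) +i* (expR (ReC z) * sin (ImC z)).

Lemma cabs_cexp z : cabs (cexp z) = expR (ReC z).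
Proof.
by rewrite cabs_complex !exprMn -mulrDr cos2Dsin2 mulr1 sqrtr_sqr ger0_norm// expR_ge0.
Qed.

Lemma holo_cexp (c z : R[i]) : holo (fun l => cexp (c * l)) z (c * cexp (c * z)).
Proof.
move=> w; rewrite mulrA [w * c]mulrC.
have E (t : R) : c * (z + t%:C * w) = c * z + t%:C * (c * w) by ring.
rewrite /cderiv; under eq_fun do rewrite E; under [X in _ /\ is_derive _ _ X _]eq_fun do rewrite E.
move: (c * z) (c * w) => [a b] [p q] {E z w}; rewrite /cexp; split => /=.
- have -> : (fun s => expR (a + (s * p - 0 * q)) * cos (b + (s * q + 0 * p))) =
            (fun s => expR (a + s * p) * cos (b + s * q)).
    by apply/funext => s; rewrite !mul0r subr0 addr0.
  apply: (is_derive_feq (is_derive_fM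
    (is_derive_fcomp (is_derive_expR _) (is_derive_affine a p 0))
    (is_derive_fcomp (is_derive_cos _) (is_derive_affine b q 0)))).
  by rewrite /= !mul0r !addr0; ring.
- have -> : (fun s => expR (a + (s * p - 0 * q)) * sin (b + (s * q + 0 * p))) =
            (fun s => expR (a + s * p) * sin (b + s * q)).
    by apply/funext => s; rewrite !mul0r subr0 addr0.
  apply: (is_derive_feq (is_derive_fM
    (is_derive_fcomp (is_derive_expR _) (is_derive_affine a p 0))
    (is_derive_fcomp (is_derive_sin _) (is_derive_affine b q 0)))).
  by rewrite /= !mul0r !addr0; ring.
Qed.

(** The real line is reparametrized so that the point of differentiation
    becomes its origin. *)
Lemma holo_line f (z w d : R[i]) (t : R) : holo f (z + t%:C * w) d ->
  cderiv (fun s : R => f (z + s%:C * w)) t (w * d).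
Proof.
move=> /(_ w) [Hr Hi].
have sh : is_derive t 1 (fun s : R => - t + s * 1) 1 := is_derive_affine _ _ _.
have E (s : R) : z + s%:C * w = z + t%:C * w + (- t + s * 1)%:C * w.
  by rewrite mulr1 rmorphD rmorphN/=; ring.
have t0 : - t + t * 1 = 0 by rewrite mulr1 addNr.
split.
  under eq_fun do rewrite E.
  have := @is_derive_fcomp (fun s => ReC (f (z + t%:C * w + s%:C * w))) _ t (ReC (w * d)) _ _ sh.
  by rewrite t0 mulr1; apply.
under eq_fun do rewrite E.
have := @is_derive_fcomp (fun s => ImC (f (z + t%:C * w + s%:C * w))) _ t (ImC (w * d)) _ _ sh.
by rewrite t0 mulr1; apply.
Qed.

(** Second order Taylor estimates, which follow from algebraic identities for
    the resolvent, give complex differentiability without power series. *)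
Lemma holo_quadratic f (z d : R[i]) (C r : R) : 0 < r ->
  (forall h, cabs h < r -> cabs (f (z + h) - f z - h * d) <= C * cabs h ^+ 2) ->
  holo f z d.
Proof.
move=> r0 H w.
have w0 : 0 < cabs w + 1 by rewrite ltr_wpDl.
have rw : 0 < r / (cabs w + 1) by rewrite divr_gt0.
have Hw (h : R) : `|h| < r / (cabs w + 1) ->
    cabs (f (z + h%:C * w) - f z - h%:C * (w * d)) <= C * cabs w ^+ 2 * h ^+ 2.
  move=> hr; rewrite mulrA; have -> : C * cabs w ^+ 2 * h ^+ 2 = C * cabs (h%:C * w) ^+ 2.
    by rewrite cabsM cabs_real exprMn real_normK ?num_real//; ring.
  apply: H; rewrite cabsM cabs_real.
  move: hr; rewrite ltr_pdivlMr// => hr; apply: le_lt_trans hr.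
  by rewrite ler_wpM2l// lerDl.
split; apply: (is_derive_quadratic rw) => h hr; have := Hw h hr; rewrite add0r mul0r addr0.
  apply: le_trans; rewrite (_ : _ - _ = ReC (f (z + h%:C * w) - f z - h%:C * (w * d))) ?Re_le_cabs//.
  by rewrite !ReCD !ReCN [ReC (_%:C * _)]ReCM/= mul0r subr0.
apply: le_trans; rewrite (_ : _ - _ = ImC (f (z + h%:C * w) - f z - h%:C * (w * d))) ?Im_le_cabs//.
by rewrite !ImCD !ImCN [ImC (_%:C * _)]ImCM/= mul0r addr0.
Qed.

End Holomorphic.

(** * Holomorphy of the resolvent *)

Section ResolventHolomorphic.
Context {R : realType} {X : completeNormedModType R[i]}.
Variable ip : {dot X for Num.conj}.
Hypothesis ip_norm : hilbert_norm ip.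
Variable T : R -> {linear X -> X}.
Hypothesis T_C0 : C0_semigroup T.
Hypothesis T_contr : contractive T.
Local Notation rb := (resolvent_bound T).
Local Notation res := (res T).

Lemma cabs_ip_le (x v : X) : cabs (ip x v) <= 2 * normR x * normR v.
Proof.
have c1 : cabs (1 : R[i]) = 1 by rewrite /cabs normr1.
have := Re_mul_ip_le ip_norm 1 x v; have := Im_mul_ip_le ip_norm 1 x v.
rewrite !mul1r c1 mul1r => i r; rewrite (le_trans (cabs_le_ReIm _))//; lra.
Qed.

Lemma ip_subl (x y v : X) : ip (x - y) v = ip x v - ip y v.
Proof. by rewrite linearBl. Qed.

Lemma ip_scalel (c : R[i]) (x v : X) : ip (c *: x) v = c * ip x v.
Proof. by rewrite linearZl_LR. Qed.

Lemma ip_addl (x y v : X) : ip (x + y) v = ip x v + ip y v.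
Proof. by rewrite linearDl. Qed.

Lemma ip_oppl (x v : X) : ip (- x) v = - ip x v.
Proof. by rewrite linearNl. Qed.

(** Testing against all vectors reduces identities between vectors to
    identities between scalars, which are decided by [ring]. *)
Lemma ip_ext (x y : X) : (forall v, ip x v = ip y v) -> x = y.
Proof.
move=> H; apply/eqP; rewrite -subr_eq0; apply/eqP/normR0_eq0/eqP.
by rewrite -sqrf_eq0 -(rip_normR ip_norm) /rip ip_subl H subrr.
Qed.

Definition ipE := (ip_subl, ip_addl, ip_oppl, ip_scalel).

Lemma holo_of_vector (F : R[i] -> X) (l : R[i]) (D v : X) (C r : R) : 0 < r ->
  (forall h, cabs h < r -> normR (F (l + h) - F l - h *: D) <= C * cabs h ^+ 2) ->
  holo (fun z => ip (F z) v) l (ip D v).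
Proof.
move=> r0 H; apply: (holo_quadratic (C := 2 * C * normR v) r0) => h hr.
rewrite -ip_scalel -!ip_subl (le_trans (cabs_ip_le _ _))//.
have -> : 2 * C * normR v * cabs h ^+ 2 = 2 * (C * cabs h ^+ 2) * normR v by ring.
by rewrite ler_wpM2r// ler_pM2l//; exact: H.
Qed.

Section AtPoint.
Variables (l : R[i]) (m : R).
Hypothesis m0 : 0 < m.
Hypothesis lm : rb l m.

Let near (h : R[i]) : cabs h < (2 * m)^-1 -> rb (l + h) (2 * m).
Proof.
move=> hm; apply: (resolvent_bound_near (ltW m0) lm).
rewrite addrAC subrr add0r -ler_pdivlMr// -invfM ltW//.
Qed.

Let step (h : R[i]) (x : X) : cabs h < (2 * m)^-1 ->
  res (l + h) x - res l x = - h *: res (l + h) (res l x).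
Proof.
move=> /near H; rewrite (res_identity _ H lm); congr (_ *: _).
by rewrite opprD addrA subrr add0r.
Qed.

Let step' (h : R[i]) (x : X) : cabs h < (2 * m)^-1 ->
  res (l + h) x = res l x - h *: res (l + h) (res l x).
Proof. by move=> hm; rewrite -[LHS](subrK (res l x)) (step _ hm) addrC scaleNr. Qed.

Let r0 : 0 < (2 * m)^-1. Proof. by rewrite invr_gt0 mulr_gt0. Qed.

(** The remainder of order two is [h^2 R(l + h) R(l)^2] by the resolvent
    identity. *)
Lemma holo_res (y v : X) :
  holo (fun z => ip (res z y) v) l (- ip (res l (res l y)) v).
Proof.
have -> : - ip (res l (res l y)) v = ip (- res l (res l y)) v by rewrite linearNl.
apply: (holo_of_vector (C := 2 * m * (m * (m * normR y))) _ r0) => h hr.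
have H := near hr.
have -> : res (l + h) y - res l y - h *: - res l (res l y) =
    h ^+ 2 *: res (l + h) (res l (res l y)).
  rewrite (step' y hr) (step' (res l y) hr).
  by apply: ip_ext => w; rewrite !ipE; ring.
rewrite normRZ cabsX mulrC ler_wpM2r ?sqr_ge0//.
rewrite (le_trans (res_normR _ H))// ler_pM2l ?mulr_gt0//.
by rewrite (le_trans (res_normR _ lm))// ler_pM2l// res_normR.
Qed.

(** The derivative of the square of the resolvent is [- 2 R(l)^3]; that of its
    first power is minus this square, hence both are needed for two
    derivatives of the resolvent. *)
Lemma holo_res2 (y v : X) :
  holo (fun z => ip (res z (res z y)) v) l (ip (- ((2 : R)%:C *: res l (res l (res l y)))) v).
Proof.
set R3 := res l (res l (res l y)).
apply: (holo_of_vector (C := 8 * m ^+ 4 * normR y) _ r0) => h hr.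
have H := near hr.
have E : res (l + h) (res (l + h) y) - res l (res l y) - h *: - ((2 : R)%:C *: R3) =
    (h ^+ 2) *: (res (l + h) (res (l + h) (res l (res l y))) +
      (2 : R)%:C *: res (l + h) (res l (res l (res l y)))).
  have e1 x := step' x hr.
  have S1 : res (l + h) (res (l + h) y) =
      res (l + h) (res l y) - h *: res (l + h) (res (l + h) (res l y)).
    by rewrite {1}(e1 y) (resB _ _ H) (resZ _ _ H).
  have S2 : res (l + h) (res (l + h) (res l y)) =
      res (l + h) (res l (res l y)) - h *: res (l + h) (res (l + h) (res l (res l y))).
    by rewrite {1}(e1 (res l y)) (resB _ _ H) (resZ _ _ H).
  rewrite S1 S2 (e1 (res l y)) (e1 (res l (res l y))) -/R3.
  by apply: ip_ext => w; rewrite !ipE rmorphMn/=; ring.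
rewrite E normRZ cabsX mulrC ler_wpM2r ?sqr_ge0// (le_trans (ler_normRD _ _))//.
rewrite normRZr ger0_norm//.
have m20 : 0 <= 2 * m by rewrite mulr_ge0// ltW.
have mm0 := ltW m0.
have B0 := res_normR y lm.
have B1 : normR (res l (res l y)) <= m * (m * normR y).
  by rewrite (le_trans (res_normR _ lm))// ler_wpM2l.
have B2 : normR R3 <= m * (m * (m * normR y)).
  by rewrite (le_trans (res_normR _ lm))// ler_wpM2l.
have B3 : normR (res (l + h) R3) <= 2 * m * (m * (m * (m * normR y))).
  by rewrite (le_trans (res_normR _ H))// ler_wpM2l.
have B4 : normR (res (l + h) (res (l + h) (res l (res l y)))) <= 2 * m * (2 * m * (m * (m * normR y))).
  rewrite (le_trans (res_normR _ H))// ler_wpM2l// (le_trans (res_normR _ H))// ler_wpM2l//.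
have -> : 8 * m ^+ 4 * normR y = 2 * m * (2 * m * (m * (m * normR y))) +
    2 * (2 * m * (m * (m * (m * normR y)))) by ring.
by rewrite lerD// ler_pM2l.
Qed.

End AtPoint.
End ResolventHolomorphic.

(** * Shifting a segment of integration *)

Section StripIntegral.
Context {R : realType}.

(** For [e = 1] and [e = - 1] the segment [i e N [0, 1]], shifted to the left
    by [N x]. *)
Definition strip_pt (N e x s : R) : R[i] := (- (N * x))%:C + s%:C * ((e * N)%:C * 'i).

Lemma strip_pt_slice (N e x s : R) :
  strip_pt N e x s = s%:C * ((e * N)%:C * 'i) + x%:C * (- N%:C).
Proof. by rewrite /strip_pt rmorphN rmorphM/=; ring. Qed.

(** As [strip_pt N e x s] has derivatives [- N] in [x] and [i e N] in [s], and
    [e^2 = 1], the [x]-derivative of [f] along the segment is [i e] times its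
    [s]-derivative. The latter integrates to the difference of the values of
    [f] at the ends. *)
Lemma strip_is_derive (f f' : R[i] -> R[i]) (N e C x0 x : R) : e ^+ 2 = 1 ->
  (forall a s, `|a| < x0 -> 0 <= s <= 1 -> holo f (strip_pt N e a s) (f' (strip_pt N e a s))) ->
  (forall a s, `|a| < x0 -> 0 <= s <= 1 -> exists d, holo f' (strip_pt N e a s) d) ->
  (forall a s, `|a| < x0 -> 0 <= s <= 1 -> cabs (f' (strip_pt N e a s)) <= C) ->
  `|x| < x0 ->
  is_derive x 1 (fun a => int01 (fun s => ReC (f (strip_pt N e a s))))
    (- e * (ImC (f (strip_pt N e x 1)) - ImC (f (strip_pt N e x 0)))).
Proof.
move=> e1 hf hf' fC xx0.
pose df a s := ReC (- N%:C * f' (strip_pt N e a s)).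
have <- : int01 (df x) = - e * (ImC (f (strip_pt N e x 1)) - ImC (f (strip_pt N e x 0))).
  have cdf : {within `[0, 1], continuous (df x)}.
    apply: (@derivable01_continuous _ _
      (fun s => ReC (- N%:C * ((e * N)%:C * 'i * xget 0 (holo f' (strip_pt N e x s)))))) => s s01.
    have [d hd] := hf' x s xx0 s01.
    have hd' : holo f' (strip_pt N e x s) (xget 0 (holo f' (strip_pt N e x s))).
      exact: (@xgetPex _ 0 (holo f' (strip_pt N e x s)) (ex_intro _ d hd)).
    have [+ _] := holo_line (holoZ (- N%:C) hd').
    by rewrite mulrCA.
  have dF (s : R) : 0 <= s <= 1 -> is_derive s 1 (fun s => - e * ImC (f (strip_pt N e x s))) (df x s).
    move=> s01; have [_ Hi] := holo_line (hf x s xx0 s01).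
    apply: (is_derive_feq (is_derive_fM (is_derive_cst (- e) s 1) Hi)).
    rewrite /df mul0r add0r; case: (f' _) => a b; simpc => /=.
    by rewrite !mulrA -expr2 e1 mul1r.
  by rewrite (int01_derivative cdf dF) mulrBr.
have axx0 (a : R) : - x0 < a -> a < x0 -> `|a| < x0 by move=> ? ?; rewrite ltr_norml; apply/andP.
move: (xx0); rewrite ltr_norml => /andP[x0x xx0'].
apply: (@is_derive_int01 _ (fun a s => ReC (f (strip_pt N e a s))) df x (- x0) x0 (`|N| * C)) => //.
- move=> a a1 a2; apply: (@derivable01_continuous _ _
    (fun s => ReC (((e * N)%:C * 'i) * f' (strip_pt N e a s)))) => s s01.
  by have [] := holo_line (hf a s (axx0 _ a1 a2) s01).
- move=> a s a1 a2 s01.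
  have := hf a s (axx0 _ a1 a2) s01; rewrite strip_pt_slice => /holo_line [].
  under eq_fun do rewrite -strip_pt_slice; move=> H _.
  by apply: (is_derive_feq H); rewrite -strip_pt_slice.
- move=> a s a1 a2 s01; rewrite (le_trans (Re_le_cabs _))// cabsM cabsN cabs_real.
  by rewrite ler_wpM2l// fC// axx0.
Qed.

End StripIntegral.

(** * The window polynomial *)

Section Window.
Context {R : realType}.

(** The polynomial [(1 - z)^3 (1 + 3 z) = 1 - 6 z^2 + 8 z^3 - 3 z^4]. The
    triple zero at [1] and the absence of a linear term make the end point
    contributions of a shifted contour small. *)
Definition window (z : R[i]) : R[i] := (1 - z) ^+ 3 * (1 + (3 : R)%:C * z).
Definition dwindow (z : R[i]) : R[i] := - ((12 : R)%:C * z * (1 - z) ^+ 2).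

Lemma cabs1 : cabs (1 : R[i]) = 1.
Proof. by rewrite /cabs normr1. Qed.

Lemma holo_affine (a b l : R[i]) : holo (fun z => a + b * z) l b.
Proof.
by apply: holo_eq; [exact: (holoD (holo_cst a l) (holoZ b (holo_id l)))|rewrite add0r mulr1].
Qed.

Lemma holo_window (k l : R[i]) : holo (fun z => window (k * z)) l (k * dwindow (k * l)).
Proof.
pose u := holo_affine 1 (- k) l; pose w := holo_affine 1 ((3 : R)%:C * k) l.
have -> : (fun z => window (k * z)) = (fun z =>
   ((1 + - k * z) * (1 + - k * z)) * (1 + - k * z) * (1 + (3 : R)%:C * k * z)).
  by apply/funext => z; rewrite /window; ring.
apply: holo_eq; first exact: (holoM (holoM (holoM u u) u) w).
rewrite /dwindow.
have -> : (12 : R)%:C = 4 * (3 : R)%:C :> R[i] by rewrite !rmorph_nat -natrM.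
have -> : (3 : R)%:C = 3 :> R[i] by rewrite rmorph_nat.
ring.
Qed.

Lemma holo_dwindow (k l : R[i]) : exists d, holo (fun z => dwindow (k * z)) l d.
Proof.
pose u := holo_affine 1 (- k) l; pose w := holo_affine 0 (- ((12 : R)%:C * k)) l.
have -> : (fun z => dwindow (k * z)) = (fun z =>
   ((1 + - k * z) * (1 + - k * z)) * (0 + - ((12 : R)%:C * k) * z)).
  by apply/funext => z; rewrite /dwindow; ring.
by eexists; exact: (holoM (holoM u u) w).
Qed.

Lemma cabs_1B (z : R[i]) : cabs (1 - z) <= 1 + cabs z.
Proof. by rewrite (le_trans (cabsD _ _))// cabsN cabs1. Qed.

Lemma cabs_window (z : R[i]) : cabs z <= 2 -> cabs (window z) <= 189.
Proof.
move=> z2; rewrite cabsM cabsX.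
have a3 : cabs (1 - z) <= 3 by rewrite (le_trans (cabs_1B z))//; lra.
have b7 : cabs (1 + (3 : R)%:C * z) <= 7.
  by rewrite (le_trans (cabsD _ _))// cabs1 cabsM cabs_real ger0_norm//; lra.
have a27 : cabs (1 - z) ^+ 3 <= 27.
  have -> : 27 = 3 ^+ 3 :> R by ring.
  by rewrite lerXn2r// nnegrE.
have -> : 189 = 27 * 7 :> R by ring.
by rewrite ler_pM// exprn_ge0.
Qed.

Lemma cabs_dwindow (z : R[i]) : cabs z <= 2 -> cabs (dwindow z) <= 216.
Proof.
move=> z2; rewrite /dwindow cabsN cabsM [cabs (_ * z)]cabsM cabsX cabs_real ger0_norm//.
have a3 : cabs (1 - z) <= 3 by rewrite (le_trans (cabs_1B z))//; lra.
have a9 : cabs (1 - z) ^+ 2 <= 9.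
  have -> : 9 = 3 ^+ 2 :> R by ring.
  by rewrite lerXn2r// nnegrE.
have -> : 216 = 12 * 2 * 9 :> R by ring.
by rewrite ler_pM ?mulr_ge0 ?exprn_ge0// ler_pM2l.
Qed.

Lemma window_near1 (z : R[i]) : cabs z <= 1 -> cabs (window (1 + z)) <= 7 * cabs z ^+ 3.
Proof.
move=> z1; rewrite /window cabsM cabsX opprD addrA subrr add0r cabsN mulrC.
rewrite ler_wpM2r ?exprn_ge0// (_ : _ + _ = (4 : R)%:C + (3 : R)%:C * z); last first.
  by rewrite !rmorph_nat; ring.
rewrite (le_trans (cabsD _ _))// cabsM !cabs_real !ger0_norm//; lra.
Qed.

(** At the common end [0] of the two segments only the odd part of the window
    survives, and it is cubic. *)
Lemma window_odd_part (z : R[i]) : window z - window (- z) = (16 : R)%:C * z ^+ 3.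
Proof. by rewrite /window !rmorph_nat; ring. Qed.

Lemma window_real (s : R) : window s%:C = ((1 - s) ^+ 3 * (1 + 3 * s))%:C.
Proof. by rewrite /window -(rmorph1 (real_complex R)) -rmorphB -rmorphXn -rmorphM -rmorphD -rmorphM. Qed.

End Window.

(** * The contour estimate *)

Section Contour.
Context {R : realType} {X : completeNormedModType R[i]}.
Variable ip : {dot X for Num.conj}.
Hypothesis ip_norm : hilbert_norm ip.
Variable T : R -> {linear X -> X}.
Hypothesis T_C0 : C0_semigroup T.
Hypothesis T_contr : contractive T.
Local Notation rb := (resolvent_bound T).
Local Notation res := (res T).
Variables (N m : R).
Hypothesis N1 : 1 <= N.
Hypothesis m1 : 1 <= m.
Hypothesis Nm : forall s, `|s| <= N -> rb (0 +i* s) m.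

Let N0 : 0 < N. Proof. exact: lt_le_trans ltr01 N1. Qed.
Let m0 : 0 < m. Proof. exact: lt_le_trans ltr01 m1. Qed.
Let strip_width : R := (2 * m * N)^-1.

Lemma strip_ptE (e a s : R) : strip_pt N e a s = (- (N * a)) +i* (e * N * s).
Proof.
by apply/eqP; rewrite eq_complex/=; apply/andP; split; apply/eqP; ring.
Qed.

(** The Neumann series extends the resolvent from the segment to a strip of
    width proportional to the inverse of its bound. *)
Lemma strip_resolvent_bound (e a s : R) : e ^+ 2 = 1 -> `|a| <= strip_width -> 0 <= s <= 1 ->
  rb (strip_pt N e a s) (2 * m).
Proof.
move=> e1 ax s01; have en : `|e| = 1.
  by apply/eqP; rewrite -(@eqrXn2 _ 2)// ?normr_ge0// real_normK ?num_real// e1 expr1n.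
have H : rb (0 +i* (e * N * s)) m.
  apply: Nm; rewrite !normrM en mul1r (gtr0_norm N0) ler_piMr ?(ltW N0)//.
  by case/andP: s01 => s0 s1; rewrite ger0_norm.
apply: (resolvent_bound_near (ltW m0) H); rewrite strip_ptE.
have -> : (- (N * a)) +i* (e * N * s) - (0 +i* (e * N * s)) = (- (N * a))%:C.
  by apply/eqP; rewrite eq_complex/= subr0 subrr !eqxx.
rewrite cabs_real normrN normrM (gtr0_norm N0).
move: ax; rewrite /strip_width => ax.
rewrite -ler_pdivlMr// mulrC -ler_pdivlMr//.
by rewrite -!invfM.
Qed.

Variables (tau : R) (y v : X).

(** Multiplication by [unscale e] brings the segment [i e N [0, 1]] back to
    [[0, 1]], on which the window lives. *)
Definition unscale (e : R) : R[i] := (- e / N)%:C * 'i.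

Lemma unscale_strip_pt (e a s : R) : e ^+ 2 = 1 -> unscale e * strip_pt N e a s = s%:C + (e * a)%:C * 'i.
Proof.
move=> e1; rewrite strip_ptE /unscale.
apply/eqP; rewrite eq_complex/=; apply/andP; split; apply/eqP.
  have es : s = e ^+ 2 * s by rewrite e1 mul1r.
  by rewrite [in RHS]es; field; rewrite gt_eqF.
by field; rewrite gt_eqF.
Qed.

Definition contour_weight (e : R) (l : R[i]) : R[i] := window (unscale e * l) * cexp (tau%:C * l).
Definition contour_fun (e : R) (l : R[i]) : R[i] := contour_weight e l * ip (res l y) v.
Definition contour_fun_deriv (e : R) (l : R[i]) : R[i] :=
  (unscale e * dwindow (unscale e * l) * cexp (tau%:C * l) +
   window (unscale e * l) * (tau%:C * cexp (tau%:C * l))) * ip (res l y) v +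
  contour_weight e l * - ip (res l (res l y)) v.

Lemma holo_contour_fun e l k : 0 < k -> rb l k -> holo (contour_fun e) l (contour_fun_deriv e l).
Proof.
move=> k0 lk; apply: holo_eq.
  exact: (holoM (holoM (holo_window (unscale e) l) (holo_cexp tau%:C l)) (holo_res ip_norm k0 lk y v)).
by rewrite /contour_fun_deriv /contour_weight.
Qed.

Lemma holo_contour_fun_deriv e l k : 0 < k -> rb l k -> exists d, holo (contour_fun_deriv e) l d.
Proof.
move=> k0 lk; have [d hd] := holo_dwindow (unscale e) l.
pose hw := holo_window (unscale e) l; pose he := holo_cexp tau%:C l.
pose hq := holo_res ip_norm k0 lk y v; pose hq2 := holo_res2 ip_norm k0 lk y v.
have -> : contour_fun_deriv e = (fun l =>
  (unscale e * dwindow (unscale e * l) * cexp (tau%:C * l) +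
   window (unscale e * l) * (tau%:C * cexp (tau%:C * l))) * ip (res l y) v +
  window (unscale e * l) * cexp (tau%:C * l) * (-1 * ip (res l (res l y)) v)).
  by apply/funext => z; rewrite /contour_fun_deriv /contour_weight; ring.
by eexists; exact: (holoD (holoM (holoD (holoM (holoZ (unscale e) hd) he) (holoM hw (holoZ tau%:C he))) hq)
   (holoM (holoM hw he) (holoZ (-1) hq2))).
Qed.

Lemma strip_width_le1 : strip_width <= 1.
Proof.
rewrite /strip_width invf_le1 ?mulr_gt0//; have := ler_pM (ler01) ler01 m1 N1.
rewrite mul1r -mulrA => H; apply: (le_trans H); rewrite ler_peMl ?mulr_ge0 ?(ltW m0) ?(ltW N0)//.
by rewrite ler1n.
Qed.

Lemma strip_bounds (e a s : R) (x : X) : e ^+ 2 = 1 -> `|a| <= strip_width -> 0 <= s <= 1 ->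
  [/\ cabs (unscale e * strip_pt N e a s) <= 2,
      cabs (cexp (tau%:C * strip_pt N e a s)) = expR (- (tau * N * a)) ,
      normR (res (strip_pt N e a s) x) <= 2 * m * normR x &
      cabs (unscale e) <= 1].
Proof.
move=> e1 ax s01; have en : `|e| = 1.
  by apply/eqP; rewrite -(@eqrXn2 _ 2)// ?normr_ge0// real_normK ?num_real// e1 expr1n.
split.
- rewrite unscale_strip_pt// (le_trans (cabsD _ _))// cabsM cabs_i !cabs_real normrM en mul1r mulr1.
  have := le_trans ax strip_width_le1; case/andP: s01 => s0 s1; rewrite (ger0_norm s0); lra.
- rewrite cabs_cexp strip_ptE; congr expR; simpc => /=; ring.
- exact: (res_normR _ (strip_resolvent_bound e1 ax s01)).
- rewrite /unscale cabsM cabs_i mulr1 cabs_real normrM normrN en mul1r normfV (gtr0_norm N0).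
  by rewrite invf_le1.
Qed.

(** The integral over both segments shifted by [N a]; [contour_int 0] is the
    quantity to be estimated. *)
Definition contour_int (a : R) : R :=
  int01 (fun s => ReC (contour_fun 1 (strip_pt N 1 a s))) + int01 (fun s => ReC (contour_fun (-1) (strip_pt N (-1) a s))).

Lemma norm_contour_fun (e a s : R) : e ^+ 2 = 1 -> `|a| <= strip_width -> 0 <= s <= 1 ->
  `|ReC (contour_fun e (strip_pt N e a s))| <= 378 * m * expR (- (tau * N * a)) * normR y * normR v.
Proof.
move=> e1 ax s01; have [k2 ce ry _] := strip_bounds y e1 ax s01.
rewrite /contour_fun (le_trans (Re_mul_ip_le ip_norm _ _ _))// ler_wpM2r// /contour_weight cabsM ce.
have -> : 378 * m * expR (- (tau * N * a)) * normR y =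
  189 * expR (- (tau * N * a)) * (2 * m * normR y) by ring.
by rewrite ler_pM ?mulr_ge0 ?expR_ge0// ler_wpM2r ?expR_ge0// cabs_window.
Qed.

Lemma contour_fun_continuous (e a : R) : e ^+ 2 = 1 -> `|a| <= strip_width ->
  {within `[0, 1], continuous (fun s => ReC (contour_fun e (strip_pt N e a s)))}.
Proof.
move=> e1 ax; apply: (@derivable01_continuous _ _
    (fun s => ReC (((e * N)%:C * 'i) * contour_fun_deriv e (strip_pt N e a s)))) => s s01.
have H := strip_resolvent_bound e1 ax s01.
by have [] := holo_line (holo_contour_fun e (mulr_gt0 (ltr0n _ 2) m0) H).
Qed.

Lemma contour_int_le (a : R) : `|a| <= strip_width ->
  `|contour_int a| <= 756 * m * expR (- (tau * N * a)) * normR y * normR v.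
Proof.
move=> ax; rewrite /contour_int (le_trans (ler_normD _ _))//.
have e1 : (1 : R) ^+ 2 = 1 by rewrite expr1n.
have e2 : (-1 : R) ^+ 2 = 1 by rewrite sqrrN expr1n.
have -> : 756 * m * expR (- (tau * N * a)) * normR y * normR v =
  378 * m * expR (- (tau * N * a)) * normR y * normR v +
  378 * m * expR (- (tau * N * a)) * normR y * normR v by ring.
rewrite lerD// norm_int01_le//; try exact: contour_fun_continuous.
- by move=> s s01; exact: norm_contour_fun.
- by move=> s s01; exact: norm_contour_fun.
Qed.

(** The end point contributions to the derivative of [contour_int]. *)
Definition contour_slope (a : R) : R :=
  - 1 * (ImC (contour_fun 1 (strip_pt N 1 a 1)) - ImC (contour_fun 1 (strip_pt N 1 a 0))) +
  - -1 * (ImC (contour_fun (-1) (strip_pt N (-1) a 1)) - ImC (contour_fun (-1) (strip_pt N (-1) a 0))).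

Lemma contour_fun_deriv_bounded (e : R) : e ^+ 2 = 1 -> exists C, forall a s, `|a| <= strip_width -> 0 <= s <= 1 ->
  cabs (contour_fun_deriv e (strip_pt N e a s)) <= C.
Proof.
move=> e1; pose E := expR (`|tau| * N).
exists ((216 * E + 189 * (`|tau| * E)) * (2 * (2 * m * normR y) * normR v) +
  189 * E * (2 * (2 * m * (2 * m * normR y)) * normR v)) => a s ax s01.
have [k2 ce ry k1] := strip_bounds y e1 ax s01.
have [_ _ rry _] := strip_bounds (res (strip_pt N e a s) y) e1 ax s01.
have eE : expR (- (tau * N * a)) <= E.
  rewrite ler_expR (le_trans (ler_norm _))// normrN !normrM (gtr0_norm N0).
  by rewrite ler_piMr ?mulr_ge0 ?(ltW N0)// (le_trans ax strip_width_le1).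
have E0 := expR_ge0 (- (tau * N * a)).
have m20 : 0 <= 2 * m by rewrite mulr_ge0// ltW.
have w1 := cabs_window k2; have w2 := cabs_dwindow k2.
rewrite /contour_fun_deriv (le_trans (cabsD _ _))// lerD//.
  rewrite cabsM ler_pM//.
    rewrite (le_trans (cabsD _ _))// lerD//.
      rewrite cabsM [cabs (unscale e * _)]cabsM ce ler_pM ?mulr_ge0//.
      by rewrite -[leRHS]mul1r ler_pM.
    by rewrite cabsM cabsM cabs_real ce ler_pM ?mulr_ge0// ler_wpM2l.
  rewrite (le_trans (cabs_ip_le ip_norm _ _))// ler_wpM2r// ler_pM2l//.
rewrite cabsM ler_pM//.
  by rewrite /contour_weight cabsM ce ler_pM.
rewrite cabsN (le_trans (cabs_ip_le ip_norm _ _))// ler_wpM2r// ler_pM2l//.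
by rewrite (le_trans rry)// ler_wpM2l.
Qed.

Lemma is_derive_contour_int (a : R) : `|a| < strip_width -> is_derive a 1 contour_int (contour_slope a).
Proof.
move=> ax.
have e1 : (1 : R) ^+ 2 = 1 by rewrite expr1n.
have e2 : (-1 : R) ^+ 2 = 1 by rewrite sqrrN expr1n.
have K0 : 0 < 2 * m by rewrite mulr_gt0.
have D (e : R) : e ^+ 2 = 1 ->
  is_derive a 1 (fun a => int01 (fun s => ReC (contour_fun e (strip_pt N e a s))))
    (- e * (ImC (contour_fun e (strip_pt N e a 1)) - ImC (contour_fun e (strip_pt N e a 0)))).
  move=> ee; have [C HC] := contour_fun_deriv_bounded ee.
  apply: (strip_is_derive (f' := contour_fun_deriv e) (C := C) ee _ _ _ ax) => b s /ltW bx s01.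
  - exact: holo_contour_fun K0 (strip_resolvent_bound ee bx s01).
  - exact: holo_contour_fun_deriv K0 (strip_resolvent_bound ee bx s01).
  - exact: HC.
exact: is_derive_fD (D 1 e1) (D (-1) e2).
Qed.

(** The ends over [s = 1] contribute the third order zero of the window. The
    ends over [s = 0] coincide for both signs and leave the odd part of the
    window. *)
Lemma contour_slope_le (a : R) : `|a| <= strip_width -> 0 <= tau * a ->
  `|contour_slope a| <= 60 * m * `|a| ^+ 3 * normR y * normR v.
Proof.
move=> ax ta.
have e1 : (1 : R) ^+ 2 = 1 by rewrite expr1n.
have e2 : (-1 : R) ^+ 2 = 1 by rewrite sqrrN expr1n.
have i1 : 0 <= (1 : R) <= 1 by rewrite ler01 lexx.
have i0 : 0 <= (0 : R) <= 1 by rewrite ler01 lexx.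
have a1 : `|a| <= 1 := le_trans ax strip_width_le1.
have Ele : expR (- (tau * N * a)) <= 1.
  by rewrite -expR0 ler_expR oppr_le0 mulrAC mulr_ge0// ltW.
have B1 (e : R) : e ^+ 2 = 1 ->
    `|ImC (contour_fun e (strip_pt N e a 1))| <= 14 * m * `|a| ^+ 3 * normR y * normR v.
  move=> ee; have en : `|e| = 1.
    by apply/eqP; rewrite -(@eqrXn2 _ 2)// ?normr_ge0// real_normK ?num_real// ee expr1n.
  have [_ ce ry _] := strip_bounds y ee ax i1.
  rewrite /contour_fun (le_trans (Im_mul_ip_le ip_norm _ _ _))// ler_wpM2r// /contour_weight cabsM ce.
  have -> : 14 * m * `|a| ^+ 3 * normR y = 7 * `|a| ^+ 3 * 1 * (2 * m * normR y) by ring.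
  rewrite ler_pM ?mulr_ge0 ?expR_ge0// ler_pM ?expR_ge0// unscale_strip_pt//.
  have ca : cabs ((e * a)%:C * 'i) = `|a| by rewrite cabsM cabs_i mulr1 cabs_real normrM en mul1r.
  by rewrite -ca; apply: window_near1; rewrite ca.
have strip_pt0 (e : R) : strip_pt N e a 0 = (- (N * a))%:C.
  by rewrite strip_ptE mulr0.
have B0 : `|ImC (contour_fun 1 (strip_pt N 1 a 0)) - ImC (contour_fun (-1) (strip_pt N (-1) a 0))| <=
    32 * m * `|a| ^+ 3 * normR y * normR v.
  have -> : ImC (contour_fun 1 (strip_pt N 1 a 0)) - ImC (contour_fun (-1) (strip_pt N (-1) a 0)) =
     ImC (((16 : R)%:C * (a%:C * 'i) ^+ 3 * cexp (tau%:C * strip_pt N 1 a 0)) * ip (res (strip_pt N 1 a 0) y) v).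
    rewrite -ImCN -ImCD; congr ImC; rewrite /contour_fun /contour_weight !unscale_strip_pt// !strip_pt0.
    by rewrite -window_odd_part mul1r mulN1r (rmorph0 (real_complex R)) !add0r (rmorphN (real_complex R) a) mulNr; ring.
  have [_ ce ry _] := strip_bounds y e1 ax i0.
  rewrite (le_trans (Im_mul_ip_le ip_norm _ _ _))// ler_wpM2r//.
  have -> : 32 * m * `|a| ^+ 3 * normR y = 16 * `|a| ^+ 3 * 1 * (2 * m * normR y) by ring.
  rewrite ler_pM// cabsM ce ler_pM ?expR_ge0// cabsM cabs_real ger0_norm// cabsX.
  by rewrite cabsM cabs_i mulr1 cabs_real.
rewrite /contour_slope.
have := B1 _ e1; have := B1 _ e2; move: B0.
set p := ImC _; set q := ImC _; set r := ImC _; set s := ImC _.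
have -> : 60 * m * `|a| ^+ 3 * normR y * normR v =
   14 * m * `|a| ^+ 3 * normR y * normR v + 14 * m * `|a| ^+ 3 * normR y * normR v +
   32 * m * `|a| ^+ 3 * normR y * normR v by ring.
move: (14 * m * _ * _ * _) (32 * m * _ * _ * _) => c d.
rewrite !ler_norml => /andP[? ?] /andP[? ?] /andP[? ?]; apply/andP; split; lra.
Qed.

(** Integration of the slope from [0] to the shift [a], taken in the direction
    in which the exponential decays, loses [a * a^3], and the integral over
    the shifted segments is exponentially small. *)
Lemma contour_bound (a : R) : 0 <= a -> a < strip_width ->
  `|contour_int 0| <= (756 * m * expR (- (`|tau| * N * a)) + 60 * m * a ^+ 4) * normR y * normR v.
Proof.
move=> a0 ax.
pose b := if 0 <= tau then a else - a.
have ba : `|b| = a by rewrite /b; case: ifP => _; rewrite ?normrN ger0_norm.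
have tb : tau * N * b = `|tau| * N * a.
  rewrite /b; case: ifPn => [t0|]; first by rewrite ger0_norm.
  by rewrite -ltNge => t0; rewrite ltr0_norm//; ring.
have tb0 c : 0 <= c <= 1 -> 0 <= tau * (c * b).
  move=> /andP[c0 _]; rewrite mulrCA mulr_ge0//.
  by rewrite -(pmulr_lge0 _ N0) mulrAC tb !mulr_ge0// ltW.
pose g c := contour_int (c * b).
have cb (c : R) : 0 <= c <= 1 -> `|c * b| <= a.
  by move=> /andP[c0 c1]; rewrite normrM ba ger0_norm// ler_piMl.
have dg (c : R) : 0 <= c <= 1 -> is_derive c 1 g (contour_slope (c * b) * b).
  move=> c01; apply: (is_derive_fcomp (v := fun c => c * b)).
    by apply: is_derive_contour_int; rewrite (le_lt_trans (cb _ c01)).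
  have := is_derive_affine 0 b c.
  by under eq_fun do rewrite add0r.
have [c c01 E] : exists2 c, c \in `[0, 1] & g 1 - g 0 = contour_slope (c * b) * b * (1 - 0).
  apply: MVT_segment => //; last exact: derivable01_continuous dg.
  by move=> c; rewrite in_itv/= => /andP[/ltW c0 /ltW c1]; apply: dg; rewrite c0.
rewrite in_itv/= in c01.
have {}E : contour_int 0 = contour_int b - contour_slope (c * b) * b.
  move: E; rewrite /g mul0r mul1r subr0 mulr1 => <-; ring.
rewrite E (le_trans (ler_normB _ _))// [leRHS](_ : _ =
  756 * m * expR (- (`|tau| * N * a)) * normR y * normR v + 60 * m * a ^+ 4 * normR y * normR v); last ring.
rewrite lerD//.
  by rewrite -tb; apply: contour_int_le; rewrite ba ltW.
rewrite normrM ba.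
have cbx : `|c * b| <= strip_width by rewrite (le_trans (cb _ c01))// ltW.
have -> : 60 * m * a ^+ 4 * normR y * normR v = 60 * m * a ^+ 3 * normR y * normR v * a by ring.
rewrite ler_wpM2r// (le_trans (contour_slope_le cbx (tb0 _ c01)))//.
rewrite !ler_wpM2r// ler_wpM2l ?mulr_ge0 ?(ltW m0)// lerXn2r ?nnegrE//; exact: cb.
Qed.

End Contour.

(** * The cosine transform of the window *)

Section Kernel.
Context {R : realType}.

Lemma ge0_of_derive (f df : R -> R) (b : R) : 0 <= f 0 ->
  (forall x : R, 0 <= x <= b -> is_derive x 1 f (df x)) ->
  (forall x : R, 0 <= x <= b -> 0 <= df x) ->
  forall x : R, 0 <= x <= b -> 0 <= f x.
Proof.
move=> f0 fdf df0 x /andP[x0 xb].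
have cx (c : R) : 0 <= c -> c <= x -> 0 <= c <= b by move=> -> cx; rewrite (le_trans cx).
have [c] : exists2 c, c \in `[0, x] & f x - f 0 = df c * (x - 0).
  apply: MVT_segment => //.
    by move=> c; rewrite in_itv/= => /andP[/ltW c0 /ltW c1]; exact/fdf/cx.
  apply: derivable_within_continuous => c; rewrite in_itv/= => /andP[c0 c1].
  by have [] := fdf c (cx c c0 c1).
rewrite in_itv/= subr0 => /andP[c0 c1] E.
have := mulr_ge0 (df0 c (cx c c0 c1)) x0; lra.
Qed.

Definition rwindow (s : R) : R := (1 - s) ^+ 3 * (1 + 3 * s).

Lemma rwindowE (s : R) : rwindow s = 1 - 6 * s ^+ 2 + 8 * s ^+ 3 - 3 * s ^+ 4.
Proof. by rewrite /rwindow; ring. Qed.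

Lemma rwindow_ge0 (s : R) : 0 <= s <= 1 -> 0 <= rwindow s.
Proof.
move=> /andP[s0 s1]; rewrite /rwindow mulr_ge0 ?exprn_ge0 ?subr_ge0//; lra.
Qed.

Lemma rwindow_le1 (s : R) : 0 <= s <= 1 -> rwindow s <= 1.
Proof.
move=> _; rewrite rwindowE.
have : 0 <= s ^+ 2 * (6 - 8 * s + 3 * s ^+ 2).
  rewrite mulr_ge0 ?sqr_ge0//.
  have -> : 6 - 8 * s + 3 * s ^+ 2 = 3 * (s - 4 / 3) ^+ 2 + 2 / 3 by field.
  by apply: addr_ge0; [apply: mulr_ge0 => //; exact: sqr_ge0|exact: divr_ge0].
rewrite !exprS expr0; lra.
Qed.

Lemma sin_le_id (x : R) : 0 <= x -> sin x <= x.
Proof.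
move=> x0; rewrite -subr_ge0.
pose f (x : R) := x - sin x; pose df (x : R) := 1 - cos x.
have f0 : 0 <= f 0 by rewrite /f sin0 subr0.
have dfE (y : R) : 0 <= y <= x -> is_derive y 1 f (df y) by move=> _; exact: is_derive_fB.
have df0 (y : R) : 0 <= y <= x -> 0 <= df y by rewrite subr_ge0 cos_le1.
by apply: (ge0_of_derive f0 dfE df0); rewrite x0 lexx.
Qed.

Lemma cos_ge_quadratic (x : R) : 0 <= x -> 1 - x ^+ 2 / 2 <= cos x.
Proof.
move=> x0; rewrite -subr_ge0.
pose f (x : R) := cos x - (1 - x ^+ 2 / 2); pose df (x : R) := x - sin x.
have f0 : 0 <= f 0 by rewrite /f cos0 expr0n/= mul0r subr0 subrr.
have dfE (y : R) : 0 <= y <= x -> is_derive y 1 f (df y).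
  by move=> _; apply: is_derive_eq; rewrite /df /GRing.scale/=; field.
have df0 (y : R) : 0 <= y <= x -> 0 <= df y.
  by move=> /andP[y0 _]; rewrite subr_ge0 sin_le_id.
by apply: (ge0_of_derive f0 dfE df0); rewrite x0 lexx.
Qed.

(** The Cusa-Huygens inequality. For [x >= 2] it follows from the
    Cauchy-Schwarz bound [|3 sin x - x cos x|^2 <= 9 + x^2], and on [[0, 2]]
    by three integrations from [x sin x >= 0]. It is equivalent to the
    nonnegativity of the cosine transform of the window. *)
Lemma cusa_huygens (x : R) : 0 <= x -> 3 * sin x <= x * (2 + cos x).
Proof.
move=> x0; have [x2|x2] := leP 2 x.
  have E : (3 * sin x - x * cos x) ^+ 2 + (3 * cos x + x * sin x) ^+ 2 = 9 + x ^+ 2.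
    have -> : 9 + x ^+ 2 = (9 + x ^+ 2) * (cos x ^+ 2 + sin x ^+ 2).
      by rewrite cos2Dsin2 mulr1.
    ring.
  have := sqr_ge0 (3 * cos x + x * sin x).
  have : 4 <= x ^+ 2 by rewrite (_ : 4 = 2 ^+ 2) ?lerXn2r ?nnegrE//; ring.
  move=> x4 q0; have : (3 * sin x - x * cos x) ^+ 2 <= (2 * x) ^+ 2.
    rewrite exprMn; lra.
  set t := 3 * sin x - x * cos x => tx; have : t <= 2 * x by nra.
  rewrite /t; lra.
have h1 (y : R) : 0 <= y <= 2 -> 0 <= y * sin y.
  by move=> /andP[y0 y2]; rewrite mulr_ge0// sin_ge0_pi// y0/= (le_trans y2)// pi_ge2.
have h2 : forall y : R, 0 <= y <= 2 -> 0 <= sin y - y * cos y.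
  apply: (ge0_of_derive (df := fun y => y * sin y)) h1.
    by rewrite sin0 mul0r subr0.
  by move=> y _; apply: is_derive_eq; rewrite /GRing.scale/=; ring.
have h3 : forall y : R, 0 <= y <= 2 -> 0 <= 2 - 2 * cos y - y * sin y.
  apply: (ge0_of_derive (df := fun y => sin y - y * cos y)) h2.
    by rewrite [cos _]cos0 mul0r; lra.
  by move=> y _; apply: is_derive_eq; rewrite /GRing.scale/=; ring.
rewrite -subr_ge0; apply: (ge0_of_derive (f := fun y => y * (2 + cos y) - 3 * sin y) _ _ h3).
- by rewrite [sin _]sin0; lra.
- by move=> y _; apply: is_derive_eq; rewrite /GRing.scale/=; ring.
- by rewrite x0 ltW.
Qed.

Definition window_cos (r : R) : R := int01 (fun s => rwindow s * cos (r * s)).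

Lemma window_cos_integrand_continuous (r : R) :
  {within `[0, 1], continuous (fun s => rwindow s * cos (r * s))}.
Proof.
apply: derivable_within_continuous => s _.
by rewrite /rwindow; apply: ex_derive.
Qed.

Lemma window_cosN (r : R) : window_cos (- r) = window_cos r.
Proof. by rewrite /window_cos; congr int01; apply/funext => s; rewrite mulNr cosN. Qed.

Lemma window_cos_le1 (r : R) : window_cos r <= 1.
Proof.
rewrite (le_trans (ler_norm _))// norm_int01_le//; first exact: window_cos_integrand_continuous.
move=> s s01; rewrite normrM (ger0_norm (rwindow_ge0 s01)) mulr_ile1 ?rwindow_ge0 ?rwindow_le1//.
by rewrite ler_norml cos_geN1 cos_le1.
Qed.

Lemma int01_rwindow : int01 rwindow = 2 / 5.
Proof.
have cw : {within `[0, 1], continuous rwindow}.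
  by apply: derivable_within_continuous => s _; rewrite /rwindow; apply: ex_derive.
have dw (s : R) : 0 <= s <= 1 ->
    is_derive s 1 (fun s => s - 2 * s ^+ 3 + 2 * s ^+ 4 - 3 / 5 * s ^+ 5) (rwindow s).
  by move=> _; apply: is_derive_eq; rewrite rwindowE /GRing.scale/=; field.
by rewrite (int01_derivative cw dw); field.
Qed.

Lemma window_cos_ge (r : R) : 0 <= r <= 1 -> 5^-1 <= window_cos r.
Proof.
move=> /andP[r0 r1].
have cw : {within `[0, 1], continuous rwindow}.
  by apply: derivable_within_continuous => s _; rewrite /rwindow; apply: ex_derive.
have -> : 5^-1 = 2^-1 * int01 rwindow by rewrite int01_rwindow; field.
rewrite -int01Zl//; apply: le_int01 => //.
- by apply: derivable_within_continuous => s _; rewrite /rwindow; apply: ex_derive.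
- exact: window_cos_integrand_continuous.
move=> s s01; rewrite mulrC ler_wpM2l ?rwindow_ge0//.
case/andP: s01 => s0 s1.
rewrite (le_trans _ (cos_ge_quadratic _)) ?mulr_ge0//.
have : (r * s) ^+ 2 <= 1 by rewrite expr_le1 ?mulr_ge0// mulr_ile1.
lra.
Qed.

(** Integration by parts, packaged in an explicit primitive. *)
Lemma window_cos_formula (r : R) : r ^+ 5 * window_cos r = 24 * (r * (2 + cos r) - 3 * sin r).
Proof.
have crs (s : R) : is_derive s 1 (fun s => cos (r * s)) (- r * sin (r * s)).
  by apply: is_derive_eq; rewrite /GRing.scale/=; ring.
rewrite /window_cos -int01Zl; last exact: window_cos_integrand_continuous.
have cf : {within `[0, 1], continuous (fun s => r ^+ 5 * (rwindow s * cos (r * s)))}.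
  by apply: derivable_within_continuous => s _; rewrite /rwindow; apply: ex_derive.
pose w1 (s : R) := - 12 * s + 24 * s ^+ 2 - 12 * s ^+ 3 : R.
pose w2 (s : R) := - 12 + 48 * s - 36 * s ^+ 2 : R.
pose w3 (s : R) := 48 - 72 * s : R.
pose F (s : R) := (rwindow s * r ^+ 4 - w2 s * r ^+ 2 - 72) * sin (r * s) +
   (w1 s * r ^+ 3 - w3 s * r) * cos (r * s).
have dF (s : R) : 0 <= s <= 1 -> is_derive s 1 F (r ^+ 5 * (rwindow s * cos (r * s))).
  move=> _; rewrite /F /rwindow /w1 /w2 /w3; apply: is_derive_eq.
  by rewrite /GRing.scale/=; ring.
rewrite (int01_derivative cf dF) /F /w1 /w2 /w3 (mulr1 r) (mulr0 r) [sin 0]sin0 [cos 0]cos0 !rwindowE; ring.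
Qed.

Lemma window_cos_ge0 (r : R) : 0 <= r -> 0 <= window_cos r.
Proof.
rewrite le_eqVlt => /predU1P[<-|r0].
  by rewrite (le_trans _ (window_cos_ge _)) ?lexx ?ler01// invr_ge0.
rewrite -(pmulr_rge0 _ (exprn_gt0 5 r0)) window_cos_formula mulr_ge0// subr_ge0 cusa_huygens// ltW//.
Qed.

Lemma window_cos_decay (r : R) : 1 <= r -> window_cos r <= 144 / r ^+ 4.
Proof.
move=> r1; have r0 : 0 < r by rewrite (lt_le_trans ltr01).
rewrite ler_pdivlMr ?exprn_gt0// -(ler_pM2r r0) -mulrA -exprSr mulrC window_cos_formula.
have c1 := cos_le1 r; have s1 := sin_geN1 r.
have : r * cos r <= r by rewrite ler_piMr// ltW.
lra.
Qed.

End Kernel.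

(** * Decay at low frequencies *)

Section LowFrequency.
Context {R : realType} {X : completeNormedModType R[i]}.
Variable ip : {dot X for Num.conj}.
Hypothesis ip_norm : hilbert_norm ip.
Variable T : R -> {linear X -> X}.
Hypothesis T_C0 : C0_semigroup T.
Hypothesis T_contr : contractive T.
Local Notation A := (generator T).
Local Notation rb := (resolvent_bound T).
Local Notation res := (res T).
Local Notation orb := (orbit T).

Lemma Im_ip (x v : X) : ImC (ip x v) = rip ip x ('i *: v).
Proof.
rewrite ripC ripZ [ip v x]hermC/= expr0 mul1r.
by case: (ip x v) => a b; rewrite ReCM/= mul0r mul1r sub0r opprK.
Qed.

Lemma orbit_rip_continuous (z w : X) : continuous (fun s => rip ip (orb z s) w).
Proof.
move=> s; apply/cvgrPdist_lt => e e0.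
have w0 : 0 < normR w + 1 by apply: ltr_wpDl.
have /cvg_normR/(_ _ (divr_gt0 e0 w0)) := @continuous_orbit _ _ _ T_C0 T_contr z s.
apply: filterS => r; rewrite ltr_pdivlMr// -ripBl => Hd.
rewrite (le_lt_trans (rip_norm_le ip_norm _ _))// (le_lt_trans _ Hd)//.
by rewrite ler_wpM2l// lerDl.
Qed.

Lemma cderiv_orbit (z v : X) (s : R) : 0 < s -> dom A z ->
  cderiv (fun s => ip (orb z s) v) s (ip (T s (A z)) v).
Proof.
move=> s0 Az; have dz := vderiv_orbit T_C0 T_contr s0 Az.
have D w : is_derive s 1 (fun r => rip ip (orb z r) w) (rip ip (T s (A z)) w).
  apply: (is_derive_feq (is_derive_rip ip_norm dz (vderiv_cst w s))).
  by rewrite [rip ip (orb z s) 0]ripC /rip linear0l addr0.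
split; first exact: D.
by under eq_fun do rewrite Im_ip; rewrite Im_ip; exact: D.
Qed.

Lemma cderiv_cexp_line (l : R[i]) (r : R) :
  cderiv (fun r : R => cexp (r%:C * l)) r (l * cexp (r%:C * l)).
Proof.
have := holo_line (w := 1) (holo_cexp l (0 + r%:C * 1)); rewrite mul1r add0r mulr1 [l * r%:C]mulrC.
by rewrite /cderiv; under eq_fun do rewrite add0r mulr1 mulrC;
   under [X in _ /\ is_derive _ _ X _]eq_fun do rewrite add0r mulr1 mulrC.
Qed.

Lemma cderiv_reverse (F : R -> R[i]) (t r : R) (d : R[i]) :
  cderiv F (t - r) d -> cderiv (fun r => F (t - r)) r (- d).
Proof.
have tr : is_derive r 1 (fun r : R => t - r) (-1).
  have := is_derive_affine t (-1) r; by under eq_fun do rewrite mulrN1.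
move=> [Fr Fi]; split.
  apply: (is_derive_feq (is_derive_fcomp (u := fun s => ReC (F s)) (v := fun r => t - r) Fr tr)).
  by rewrite mulrN1 ReCN.
apply: (is_derive_feq (is_derive_fcomp (u := fun s => ImC (F s)) (v := fun r => t - r) Fi tr)).
by rewrite mulrN1 ImCN.
Qed.

Variables (N m : R).
Hypothesis N1 : 1 <= N.
Hypothesis m1 : 1 <= m.
Hypothesis Nm : forall s, `|s| <= N -> rb (0 +i* s) m.
Let N0 : 0 < N. Proof. exact: lt_le_trans ltr01 N1. Qed.
Let m0 : 0 < m. Proof. exact: lt_le_trans ltr01 m1. Qed.
Variables (y v : X) (t : R).
Hypothesis Ay : dom A y.

Let zero_small : `|0 : R| <= (2 * m * N)^-1.
Proof. by rewrite normr0 invr_ge0 !mulr_ge0// ltW. Qed.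

(** The function [g] whose derivative in [r] is a nonnegative kernel times the
    correlation of the orbit with [v]: the unshifted contour integral with [y]
    replaced by [T(t - r) y]. *)
Definition probe (r : R) : R := contour_int ip T N r (orb y (t - r)) v 0.

(** The integrand of the derivative of [probe]; the resolvent has disappeared
    from it. *)
Definition dprobe (e r s : R) : R :=
  ReC ((rwindow s)%:C * cexp (r%:C * strip_pt N e 0 s) * ip (orb y (t - r)) v).

(** The derivative of [exp(r l)] contributes [l R(l)] and that of [T(t - r) y]
    contributes [- A R(l)]; they add up to the identity. *)
Lemma probe_slice (e r s : R) : e ^+ 2 = 1 -> 0 <= s <= 1 -> r < t ->
  is_derive r 1 (fun r => ReC (contour_fun ip T N r (orb y (t - r)) v e (strip_pt N e 0 s))) (dprobe e r s).
Proof.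
move=> e1 s01 rt; have tr0 : 0 < t - r by rewrite subr_gt0.
have H := strip_resolvent_bound N1 m1 Nm e1 zero_small s01.
set l := strip_pt N e 0 s in H *.
have Az := res_dom (x := y) H.
have E (r' : R) : contour_fun ip T N r' (orb y (t - r')) v e l =
    (rwindow s)%:C * (cexp (r'%:C * l) * ip (orb (res l y) (t - r')) v).
  rewrite /contour_fun /contour_weight /orbit (semigroup_res T_C0 T_contr _ H) ?le_max ?lexx//.
  by rewrite /l (unscale_strip_pt N1)// mulr0 rmorph0 mul0r addr0 window_real -mulrA.
have := cderivM (cderiv_cst (rwindow s)%:C r)
  (cderivM (cderiv_cexp_line l r) (cderiv_reverse (cderiv_orbit v tr0 Az))).
move=> [+ _]; under eq_fun do rewrite -E; move=> D; apply: (is_derive_feq D).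
congr ReC; rewrite mul0r add0r -/l (resK _ H) (semigroupB T) (semigroupZ T) ip_subl ip_scalel.
by rewrite /orbit max_r ?ltW//; ring.
Qed.

Lemma dprobeE (e r s : R) : dprobe e r s =
  rwindow s * (cos (e * (N * r * s)) * ReC (ip (orb y (t - r)) v) -
            sin (e * (N * r * s)) * ImC (ip (orb y (t - r)) v)).
Proof.
rewrite /dprobe strip_ptE mulr0 oppr0 -mulrA ReCM ReCM /cexp.
have -> : r%:C * (0 +i* (e * N * s)) = 0 +i* (e * (N * r * s)).
  by apply/eqP; rewrite eq_complex/=; apply/andP; split; apply/eqP; ring.
by rewrite /= expR0 !mul1r; ring.
Qed.

Lemma dprobe_le (e r s : R) : 0 <= s <= 1 -> `|dprobe e r s| <= normR y * normR v.
Proof.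
move=> s01; rewrite /dprobe (le_trans (Re_mul_ip_le ip_norm _ _ _))// ler_wpM2r//.
rewrite -[leRHS]mul1r ler_pM ?cabs_ge0 ?normR_ge0//; last exact: orbit_normR.
rewrite cabsM cabs_real cabs_cexp (ger0_norm (rwindow_ge0 s01)) strip_ptE mulr0 oppr0.
have -> : ReC (r%:C * (0 +i* (e * N * s))) = 0 by rewrite /=; ring.
by rewrite expR0 mulr1 rwindow_le1.
Qed.

Lemma dprobe_continuous (e r : R) : {within `[0, 1], continuous (dprobe e r)}.
Proof.
have -> : dprobe e r = (fun s => rwindow s * (cos ((e * (N * r)) * s) * ReC (ip (orb y (t - r)) v) -
            sin ((e * (N * r)) * s) * ImC (ip (orb y (t - r)) v))).
  by apply/funext => s; rewrite dprobeE !mulrA.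
by apply: derivable_within_continuous => s _; rewrite /rwindow; apply: ex_derive.
Qed.

Lemma is_derive_probe (r : R) : r < t ->
  is_derive r 1 probe (2 * window_cos (N * r) * rip ip (orb y (t - r)) v).
Proof.
move=> rt.
have e1 : (1 : R) ^+ 2 = 1 by rewrite expr1n.
have e2 : (-1 : R) ^+ 2 = 1 by rewrite sqrrN expr1n.
have D (e : R) : e ^+ 2 = 1 -> is_derive r 1
    (fun r => int01 (fun s => ReC (contour_fun ip T N r (orb y (t - r)) v e (strip_pt N e 0 s))))
    (int01 (dprobe e r)).
  move=> ee; apply: (@is_derive_int01 _
    (fun r s => ReC (contour_fun ip T N r (orb y (t - r)) v e (strip_pt N e 0 s)))
    (dprobe e) r (r - 1) t (normR y * normR v)) => //.
  - by rewrite ltrBlDr ltrDl.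
  - move=> x _ _; exact: (contour_fun_continuous ip_norm N1 m1 Nm).
  - by move=> x s _ xt s01; exact: probe_slice.
  - by move=> x s _ _ s01; exact: dprobe_le.
apply: (is_derive_feq (is_derive_fD (D 1 e1) (D (-1) e2))).
rewrite -int01D; try exact: dprobe_continuous.
have -> : 2 * window_cos (N * r) * rip ip (orb y (t - r)) v =
    (2 * rip ip (orb y (t - r)) v) * window_cos (N * r) by ring.
rewrite /window_cos -int01Zl; last exact: window_cos_integrand_continuous.
congr int01; apply/funext => s; rewrite !dprobeE mul1r mulN1r cosN sinN /rip; ring.
Qed.

(** The second difference is [T(t - r) (T(r) - 1)^2 y], and each factor [T(r)
    - 1] costs one power of [r] and one application of [A]. *)
Lemma orbit_second_difference (r : R) : 0 <= r -> r <= t -> dom A (A y) ->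
  rip ip (T (t - r) y) v + rip ip (T (t + r) y) v - 2 * rip ip (T t y) v >=
  - (r ^+ 2 * normR (A (A y)) * normR v).
Proof.
move=> r0 rt AAy.
have lip z : dom A z -> normR (T r z - z) <= r * normR (A z).
  move=> Az; have [E0|E0] := eqVneq (T r z - z) 0.
    by rewrite E0 normR0 mulr_ge0.
  (* The mean value theorem for the scalar function obtained by testing the
     orbit against its increment. *)
  pose w := T r z - z.
  have nw : 0 < normR w.
    by rewrite lt_neqAle normR_ge0 andbT eq_sym; apply: contra_neq E0 => /normR0_eq0.
  have [c] : exists2 c, c \in `[0, r] & rip ip (orb z r) w - rip ip (orb z 0) w =
      rip ip (orb (A z) c) w * (r - 0).
    apply: (MVT_segment (f := fun c => rip ip (orb z c) w)) => //.
      move=> c; rewrite in_itv/= => /andP[c0 _]; have [+ _] := cderiv_orbit w c0 Az.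
      by have -> : orb (A z) c = T c (A z) by rewrite /orbit max_r// ltW.
    by apply: continuous_subspaceT => c; exact: orbit_rip_continuous.
  move=> _; rewrite subr0 -ripBl {1 2}/orbit maxxx (semigroup0 T_C0) max_r// -/w rip_normR// => E.
  rewrite -(ler_pM2r nw) -expr2 E mulrC -mulrA ler_wpM2l// (le_trans (rip_le ip_norm _ _))//.
  by rewrite ler_wpM2r// orbit_normR.
have t0 : 0 <= t := le_trans r0 rt.
have tr0 : 0 <= t - r by rewrite subr_ge0.
have -> : rip ip (T (t - r) y) v + rip ip (T (t + r) y) v - 2 * rip ip (T t y) v =
    rip ip (T (t - r) (T r (T r y - y) - (T r y - y))) v.
  have e1 z : T t z = T (t - r) (T r z) by rewrite -(semigroupD T_C0)// subrK.
  rewrite (semigroupD T_C0 _ t0 r0) !e1 !(semigroupB T) !ripBl; ring.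
have [ATy ATE] := generator_orbit T_C0 T_contr r0 Ay.
have [AD DE] := generatorB ATy Ay.
rewrite lerNl -ripNl (le_trans (rip_le ip_norm _ _))// normRN ler_wpM2r//.
rewrite (le_trans (contr_normR T_contr _ tr0))// (le_trans (lip _ AD))//.
by rewrite DE ATE expr2 -mulrA ler_wpM2l// lip.
Qed.

End LowFrequency.

Section LowFrequencyArithmetic.
Context {R : realType}.
Implicit Types ph V q b kk : R.

Lemma kernel_step_near ph V q b kk : 5^-1 <= ph -> ph <= 1 -> 0 <= V -> 0 <= b -> b <= q ->
  2 * V - b <= kk -> 4 / 5 * V - 2 * q <= 2 * ph * kk.
Proof.
move=> ph1 ph2 V0 b0 bq kl.
have ph0 : 0 <= ph by rewrite (le_trans _ ph1)// invr_ge0.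
have := ler_wpM2l ph0 kl; have := ler_wpM2r V0 ph1; have := ler_wpM2r b0 ph2; lra.
Qed.

Lemma kernel_step_far ph V b kk q : 0 <= ph -> 0 <= V -> 2 * V - b <= kk ->
  ph * b <= q / 2 -> 0 <= 2 * ph * kk + q.
Proof.
by move=> ph0 V0 kl pb; have := ler_wpM2l ph0 kl; have := mulr_ge0 ph0 V0; lra.
Qed.

(** The balance between the gain [V = |v|^2] on [[0, 1 / N]], the loss on [[1
    / N, t / 2]] and the boundary terms, in which [g1] and [g2] are the values
    of the symmetrized probe at [1 / N] and [t / 2]. *)
Lemma kernel_balance N V q g1 g2 b C : 0 <= N -> N * (C * N) = 288 * q ->
  4 / 5 * V - 2 * q <= N * g1 -> g1 - C * N <= g2 -> g2 <= 2 * b ->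
  0 <= q -> 0 <= N * b -> V <= 3 * (N * b) + 363 * q.
Proof.
move=> N0 NC P1 P2 P3 q0 b0.
have : N * g1 <= N * (2 * b + C * N) by rewrite ler_wpM2l//; lra.
rewrite mulrDr NC; lra.
Qed.

End LowFrequencyArithmetic.

Section LowFrequencyDecay.
Context {R : realType} {X : completeNormedModType R[i]}.
Variable ip : {dot X for Num.conj}.
Hypothesis ip_norm : hilbert_norm ip.
Variable T : R -> {linear X -> X}.
Hypothesis T_C0 : C0_semigroup T.
Hypothesis T_contr : contractive T.
Local Notation A := (generator T).
Local Notation orb := (orbit T).

(** The symmetrized probe [gam r = g r - g (- r)] has derivative [2 window_cos
    (N r) (k (t - r) + k (t + r))]. On [[0, 1 / N]] the kernel is at least [1
    / 5]; beyond [1 / N] the integrand could be negative only by the second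
    difference error, which the decay [144 / (N r)^4] of the kernel makes
    integrable. *)
Lemma low_frequency_decay (N m t : R) (y : X) : 1 <= N -> 1 <= m ->
  (forall s, `|s| <= N -> resolvent_bound T (0 +i* s) m) ->
  2 <= N * t -> dom A y -> dom A (A y) ->
  normR (T t y) <= 3 * N * (756 * m * expR (- (t / (8 * m))) + 60 * m / (4 * m * N) ^+ 4) * normR y
    + 363 / N ^+ 2 * normR (A (A y)).
Proof.
move=> N1 m1 Nm Nt Ay AAy.
have N0 : 0 < N := lt_le_trans ltr01 N1.
have m0 : 0 < m := lt_le_trans ltr01 m1.
have t0 : 0 < t by rewrite -(pmulr_rgt0 _ N0) (lt_le_trans _ Nt).
pose a := (4 * m * N)^-1.
have m40 : 0 < 4 * m := mulr_gt0 (ltr0n _ 4) m0.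
have a0 : 0 <= a by rewrite invr_ge0 ltW// mulr_gt0.
have ax : a < (2 * m * N)^-1.
  have mN := mulr_gt0 m0 N0.
  by rewrite /a ltf_pV2 ?posrE -?mulrA; [|exact: mulr_gt0..]; rewrite ltr_pM2r// ltr_nat.
pose Bd := 756 * m * expR (- (t / (8 * m))) + 60 * m * a ^+ 4.
have Bd0 : 0 <= Bd.
  apply: addr_ge0; apply: mulr_ge0.
  - exact: (mulr_ge0 (ler0n _ _) (ltW m0)).
  - exact: expR_ge0.
  - exact: (mulr_ge0 (ler0n _ _) (ltW m0)).
  - exact: exprn_ge0.
have -> : 60 * m / (4 * m * N) ^+ 4 = 60 * m * a ^+ 4 by rewrite /a exprVn.
rewrite -/Bd.
have [E0|E0] := eqVneq (T t y) 0.
  rewrite E0 normR0; apply: addr_ge0.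
    exact: (mulr_ge0 (mulr_ge0 (mulr_ge0 (ler0n _ _) (ltW N0)) Bd0) (normR_ge0 _)).
  exact: (mulr_ge0 (divr_ge0 (ler0n _ _) (exprn_ge0 2 (ltW N0))) (normR_ge0 _)).
pose v := T t y.
have nv : 0 < normR v.
  by rewrite lt_neqAle normR_ge0 andbT eq_sym; apply: contra_neq E0 => /normR0_eq0.
pose g := probe ip T N y v t.
pose gam r := g r - g (- r).
pose k s := rip ip (orb y s) v.
pose dgam r := 2 * window_cos (N * r) * (k (t - r) + k (t + r)).
pose K2 := normR (A (A y)) * normR v.
have K20 : 0 <= K2 by rewrite mulr_ge0.
pose V := normR v ^+ 2.
have V0 : 0 <= V by rewrite sqr_ge0.
have dG (r : R) : - t < r -> r < t -> is_derive r 1 gam (dgam r).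
  move=> tr rt.
  have D1 := is_derive_probe ip_norm T_C0 T_contr N1 m1 Nm y v rt.
  have rt' : - r < t by rewrite ltrNl.
  have D2 := is_derive_probe ip_norm T_C0 T_contr N1 m1 Nm y v rt'.
  have nr : is_derive r 1 (fun r : R => - r) (-1).
    have := is_derive_affine 0 (-1) r; by under eq_fun do rewrite mulrN1 add0r.
  apply: (is_derive_feq (is_derive_fB D1 (is_derive_fcomp (u := g) D2 nr))).
  rewrite /dgam [N * - r]mulrN window_cosN opprK /k; ring.
have klow (r : R) : 0 <= r -> r <= t -> 2 * V - r ^+ 2 * K2 <= k (t - r) + k (t + r).
  move=> r0 rt; have := orbit_second_difference ip_norm T_C0 T_contr v Ay r0 rt AAy.
  rewrite /k /orbit !max_r ?subr_ge0 ?addr_ge0 ?(ltW t0)//.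
  rewrite -/v rip_normR// -/V /K2 mulrA; lra.
have iN : 0 < N^-1 by rewrite invr_gt0.
have iN1 : N^-1 <= t / 2 by rewrite -(ler_pM2l N0) divff ?gt_eqF// mulrA ler_pdivlMr// mul1r.
have gam0 : gam 0 = 0 by rewrite /gam oppr0 subrr.
have tt : t / 2 < t by lra.
have inside r : 0 <= r -> r <= t / 2 -> - t < r /\ r < t by move=> r0 rt; split; lra.
have gcont b c : 0 <= b -> c <= t / 2 -> {within `[b, c], continuous gam}.
  move=> b0 ct; apply: derivable_within_continuous => r; rewrite in_itv/= => /andP[br rc].
  have [tr rt] := inside r (le_trans b0 br) (le_trans rc ct).
  by have [] := dG r tr rt.
pose q := K2 / N ^+ 2.
have q0 : 0 <= q by rewrite divr_ge0// exprn_ge0// ltW.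
(* On [[0, 1 / N]] the kernel is bounded below. *)
have P1 : 4 / 5 * V - 2 * q <= N * gam N^-1.
  have [c] : exists2 c, c \in `[0, N^-1] & gam N^-1 - gam 0 = dgam c * (N^-1 - 0).
    apply: MVT_segment; [exact: ltW| |exact: gcont].
    move=> c; rewrite in_itv/= => /andP[/ltW c0 /ltW cN].
    by have [tr rt] := inside c c0 (le_trans cN iN1); exact: dG.
  rewrite in_itv/= gam0 !subr0 => /andP[c0 cN] ->.
  have -> : N * (dgam c / N) = dgam c by rewrite mulrC divfK// gt_eqF.
  rewrite /dgam.
  have ct : c <= t by rewrite (le_trans cN)// (le_trans iN1)// ltW.
  have Nc : 0 <= N * c <= 1.
    by rewrite mulr_ge0 ?(ltW N0)//= -(ler_pM2l iN) mulrA mulVf ?gt_eqF// mul1r mulr1.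
  have c2 : c ^+ 2 * K2 <= q.
    by rewrite [leRHS]mulrC ler_wpM2r// -exprVn lerXn2r ?nnegrE ?(ltW iN).
  apply: (kernel_step_near (window_cos_ge Nc) (window_cos_le1 _) V0 _ c2 (klow c c0 ct)).
  by rewrite mulr_ge0// sqr_ge0.
pose C := 288 * q / N ^+ 2.
have C0 : 0 <= C.
  exact: (divr_ge0 (mulr_ge0 (ler0n _ _) q0) (exprn_ge0 2 (ltW N0))).
(* The function [gam] minus [C / r] is nondecreasing beyond [1 / N]. *)
have P2 : gam N^-1 - C * N <= gam (t / 2).
  pose del r := gam r + - C * r^-1.
  have r0 r : N^-1 <= r -> 0 < r := lt_le_trans iN.
  have dD (r : R) : N^-1 <= r -> r <= t / 2 -> is_derive r 1 del (dgam r + C / r ^+ 2).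
    move=> Nr rt; have [tr rt'] := inside r (ltW (r0 r Nr)) rt.
    have D1 := dG r tr rt'.
    have D2 : is_derive r 1 (fun r : R => r^-1) (- r ^- 2 *: 1).
      by apply: (@is_deriveV _ id r 1 1) => /=; rewrite gt_eqF ?r0.
    apply: (is_derive_feq (is_derive_fD D1 (is_derive_fM (is_derive_cst (- C) r 1) D2))).
    by rewrite mul0r add0r /GRing.scale/= mulr1 mulrNN.
  have [c] : exists2 c, c \in `[N^-1, t / 2] & del (t / 2) - del N^-1 = (dgam c + C / c ^+ 2) * (t / 2 - N^-1).
    apply: MVT_segment => //.
      by move=> c; rewrite in_itv/= => /andP[/ltW ? /ltW ?]; exact: dD.
    apply: derivable_within_continuous => c; rewrite in_itv/= => /andP[c1 c2].
    by have [] := dD c c1 c2.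
  rewrite in_itv/= => /andP[c1 c2] E.
  have c0 := r0 c c1.
  have Nc1 : 1 <= N * c by rewrite -(ler_pM2l iN) mulrA mulVf ?gt_eqF// mul1r mulr1.
  have : 0 <= dgam c + C / c ^+ 2.
    apply: (kernel_step_far (window_cos_ge0 (le_trans ler01 Nc1)) V0 (klow c (ltW c0) (le_trans c2 (ltW tt)))).
    have -> : C / c ^+ 2 / 2 = 144 / (N * c) ^+ 4 * (c ^+ 2 * K2).
      by rewrite /C /q; field; rewrite !gt_eqF.
    by rewrite ler_wpM2r ?window_cos_decay// mulr_ge0// sqr_ge0.
  have tN : 0 <= t / 2 - N^-1 by rewrite subr_ge0.
  move=> dg0; have := mulr_ge0 dg0 tN; rewrite -E subr_ge0 /del invrK => H.
  have : 0 <= C * (t / 2)^-1 by rewrite mulr_ge0// invr_ge0 divr_ge0// ltW.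
  by move: H; clear; lra.
(* The shift [a] is half of the width of the strip. *)
have gB r : `|r| = t / 2 -> `|g r| <= Bd * normR y * normR v.
  move=> rt; rewrite (le_trans (contour_bound ip_norm N1 m1 Nm r _ v a0 ax))// ler_wpM2r//.
  have -> : - (`|r| * N * a) = - (t / (8 * m)) by rewrite rt /a; field; rewrite !gt_eqF.
  by rewrite ler_wpM2l// orbit_normR.
have t20 : 0 <= t / 2 by rewrite divr_ge0// ltW.
have P3 : gam (t / 2) <= 2 * (Bd * normR y * normR v).
  have := gB (t / 2) (ger0_norm t20).
  have := gB (- (t / 2)); rewrite normrN (ger0_norm t20) => /(_ erefl).
  by rewrite /gam; move: (g _) (g (- _)) => g1 g2; clear; rewrite !ler_norml; lra.
have NCN : N * (C * N) = 288 * q by rewrite /C; field; rewrite gt_eqF.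
have B0 : 0 <= N * (Bd * normR y * normR v).
  exact: mulr_ge0 (ltW N0) (mulr_ge0 (mulr_ge0 Bd0 (normR_ge0 _)) (normR_ge0 _)).
rewrite -/v -(ler_pM2r nv) -expr2 -/V mulrDl.
have -> : 363 / N ^+ 2 * normR (A (A y)) * normR v = 363 * q by rewrite /q /K2; ring.
have -> : 3 * N * Bd * normR y * normR v = 3 * (N * (Bd * normR y * normR v)) by ring.
exact: kernel_balance (ltW N0) NCN P1 P2 P3 q0 B0.
Qed.

End LowFrequencyDecay.

(** * Octaves and square summable decay *)

Section SquareFunction.
Context {R : realType} {X : completeNormedModType R[i]}.
Variable ip : {dot X for Num.conj}.
Hypothesis ip_norm : hilbert_norm ip.
Variable T : R -> {linear X -> X}.
Hypothesis T_C0 : C0_semigroup T.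
Hypothesis T_contr : contractive T.
Local Notation A := (generator T).
Variable m0 : R.
Hypothesis m0_gt0 : 0 < m0.
Hypothesis rb0 : resolvent_bound T 0 m0.

Let rbp (l : R) : 0 < l -> resolvent_bound T l%:C l^-1.
Proof. exact: (resolvent_bound_pos ip_norm T_contr m0_gt0 rb0). Qed.

(** The image of [x] under [l (l - A)^-1], which damps the spectral components
    of size much larger than [l]. *)
Definition yosida (l : R) (x : X) : X := l%:C *: res T l%:C x.

Definition generator_inv (x : X) : X := - res T 0 x.

Lemma generator_inv_dom (x : X) : dom A (generator_inv x) /\ A (generator_inv x) = x.
Proof.
have [dN AN] := generatorN (res_dom (x := x) rb0); split => //.
by rewrite AN (resK _ rb0) scale0r sub0r opprK.
Qed.

Lemma generator_inv_normR (x : X) : normR (generator_inv x) <= m0 * normR x.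
Proof. by rewrite normRN (res_normR _ rb0). Qed.

Lemma generator_invB (x y : X) : generator_inv (x - y) = generator_inv x - generator_inv y.
Proof. by rewrite /generator_inv (resB _ _ rb0) opprD. Qed.

Lemma generator_invZ (c : R[i]) (x : X) : generator_inv (c *: x) = c *: generator_inv x.
Proof. by rewrite /generator_inv (resZ _ _ rb0) scalerN. Qed.

Lemma generator_invK (z : X) : dom A z -> generator_inv (A z) = z.
Proof.
move=> Az; rewrite /generator_inv; have -> : res T 0 (A z) = - z; last by rewrite opprK.
have [dN AN] := generatorN Az.
by apply: (res_unique rb0 dN); rewrite AN scale0r sub0r opprK.
Qed.

Section Scale.
Variable l : R.
Hypothesis l0 : 0 < l.

Lemma yosida_dom (x : X) : dom A (yosida l x).
Proof. by have [] := generatorZ l%:C (res_dom (x := x) (rbp l0)). Qed.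

Lemma generator_yosida (x : X) : A (yosida l x) = l%:C *: (yosida l x - x).
Proof.
have [_ ->] := generatorZ l%:C (res_dom (x := x) (rbp l0)).
by rewrite (resK _ (rbp l0)).
Qed.

Lemma yosida_normR (x : X) : normR (yosida l x) <= normR x.
Proof.
rewrite normRZr (gtr0_norm l0) (le_trans (ler_wpM2l (ltW l0) (res_normR x (rbp l0))))//.
by rewrite mulrA divff ?gt_eqF// mul1r.
Qed.

Lemma yosidaB (x y : X) : yosida l (x - y) = yosida l x - yosida l y.
Proof. by rewrite /yosida (resB _ _ (rbp l0)) scalerBr. Qed.

Lemma yosidaZ (c : R[i]) (x : X) : yosida l (c *: x) = c *: yosida l x.
Proof. by rewrite /yosida (resZ _ _ (rbp l0)) !scalerA mulrC. Qed.

Lemma generator_inv_yosida (x : X) : generator_inv (yosida l x - x) = l^-1%:C *: yosida l x.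
Proof.
have E : yosida l x = l%:C *: generator_inv (yosida l x - x).
  by rewrite -generator_invZ -generator_yosida generator_invK//; exact: yosida_dom.
by rewrite [in RHS]E scalerA -rmorphM/= mulVf ?gt_eqF// rmorph1 scale1r.
Qed.

End Scale.
Arguments yosida_dom {l} l0 x.

Section Octave.
Variable l : R.
Hypothesis l0 : 0 < l.
Let l20 : 0 < 2 * l. Proof. by rewrite mulr_gt0. Qed.
Local Notation J := (yosida (2 * l)).
Local Notation J' := (yosida l).

(** The resolvent identity for the parameters [l] and [2 l]. *)
Lemma yosida_octave (x : X) : J (J' x) = (2 : R)%:C *: J' x - J x.
Proof.
have := res_identity x (rbp l20) (rbp l0); rewrite /yosida => /eqP; rewrite subr_eq => /eqP H.
rewrite (resZ _ _ (rbp l20)) H.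
apply: (ip_ext ip_norm) => v; rewrite !(ipE ip) !rmorphM/=; ring.
Qed.

Lemma yosida_comm (x : X) : J' (J x) = J (J' x).
Proof.
by rewrite /yosida (resZ _ _ (rbp l0)) (resZ _ _ (rbp l20)) !scalerA mulrC (res_comm _ (rbp l0) (rbp l20)).
Qed.

Definition octave (x : X) : X := J' x - J x.

(** Dissipativity applied to the vector [2 J' x - J x], whose image under [A]
    is [2 l (J' x - J x)]. *)
Lemma octave_energy (x : X) :
  3 * normR (octave x) ^+ 2 <= normR (J x) ^+ 2 - normR (J' x) ^+ 2.
Proof.
have dJ := yosida_dom l20 x; have dJ' := yosida_dom l0 x.
have [d2 E2] := generatorZ (2 : R)%:C dJ'; have [dB EB] := generatorB d2 dJ.
have := generator_dissipative ip_norm T_contr dB.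
rewrite EB E2 (generator_yosida l0) (generator_yosida l20).
have -> : (2 : R)%:C *: (l%:C *: (J' x - x)) - (2 * l)%:C *: (J x - x) =
    (2 * l)%:C *: (J' x - J x).
  by apply: (ip_ext ip_norm) => v; rewrite !(ipE ip) !rmorphM/=; ring.
rewrite ripZl pmulr_rle0// /octave -!(rip_normR ip_norm); move: (J x) (J' x) => z v.
by rewrite !ripBl !ripBr !ripZr (ripC ip z v); lra.
Qed.

Let Q (x : X) : X := (2 : R)%:C *: J' x - J x.

Let QE x : Q x = J (J' x). Proof. by rewrite /Q yosida_octave. Qed.

Let Q_normR x : normR (Q x) <= normR x.
Proof. by rewrite QE (le_trans (yosida_normR l20 _))// yosida_normR. Qed.

Let Q_dom x : dom A (Q x).
Proof.
by have [d _] := generatorZ (2 : R)%:C (yosida_dom l0 x); have [] := generatorB d (yosida_dom l20 x).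
Qed.

Arguments Q_dom x : clear implicits.

Let generator_Q x : A (Q x) = (2 * l)%:C *: octave x.
Proof.
have [d E] := generatorZ (2 : R)%:C (yosida_dom l0 x).
have [_ ->] := generatorB d (yosida_dom l20 x).
rewrite E (generator_yosida l0) (generator_yosida l20) /octave.
by apply: (ip_ext ip_norm) => v; rewrite !(ipE ip) !rmorphM/=; ring.
Qed.

Let QB x z : Q (x - z) = Q x - Q z.
Proof. by rewrite !QE (yosidaB l0) (yosidaB l20). Qed.

Let octave_Q x : octave (Q x) = Q (octave x).
Proof.
rewrite /octave !QE !(yosidaB l0) !(yosidaB l20) -!yosida_comm; congr (_ - _).
Qed.

(** Let [Q = J J']. The low frequency part is the image of [(2 Q - Q^2) x]
    under [A^-1]. The remainder is the image of [(1 - Q)^2 x], where one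
    factor makes [A^-1] bounded by a multiple of [1 / l], in the form [- (2
    l)^-1 (2 + J) J'], and [J'] times the other factor is the combination [-
    (1 + 2 J')] of octaves. *)
Lemma octave_split (x : X) : exists y, [/\ dom A y, dom A (A y),
  normR (A (A y)) <= 3 * (2 * l) * normR (octave x),
  normR (generator_inv x - y) <= 9 * normR (octave x) / (2 * l) &
  normR y <= m0 * (3 * normR x)].
Proof.
(* The polynomial [2 Q - Q^2 = 1 - (1 - Q)^2] leaves an error that is
   quadratic in [1 - Q]. *)
pose p := (2 : R)%:C *: Q x - Q (Q x).
have [dy Ey] := generator_inv_dom p.
have [d2 E2] := generatorZ (2 : R)%:C (Q_dom x); have [dp Ep] := generatorB d2 (Q_dom (Q x)).
have three (z : X) : normR ((2 : R)%:C *: z - Q z) <= 3 * normR z.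
  rewrite (le_trans (ler_normRB _ _))// normRZr ger0_norm//; have := Q_normR z; lra.
exists (generator_inv p); split => //.
- by rewrite Ey.
- rewrite Ey Ep E2 !generator_Q octave_Q.
  have -> : (2 : R)%:C *: ((2 * l)%:C *: octave x) - (2 * l)%:C *: Q (octave x) =
      (2 * l)%:C *: ((2 : R)%:C *: octave x - Q (octave x)).
    by apply: (ip_ext ip_norm) => v; rewrite !(ipE ip); ring.
  have -> : 3 * (2 * l) * normR (octave x) = 2 * l * (3 * normR (octave x)) by ring.
  by rewrite normRZr (gtr0_norm l20) (ler_wpM2l (ltW l20))//; exact: three.
- rewrite -generator_invB.
  pose w := x - Q x.
  have gJ z := generator_inv_yosida l20 z; have gJ' z := generator_inv_yosida l0 z.
  have gQ z : generator_inv (z - Q z) = - (2 * l)^-1%:C *: ((2 : R)%:C *: J' z + J (J' z)).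
    (* One factor [1 - Q] is absorbed by the inverse of the generator. *)
    have -> : z - Q z = (J z - z) - (2 : R)%:C *: (J' z - z).
      rewrite /Q; apply: (ip_ext ip_norm) => v; rewrite !(ipE ip) rmorph_nat; ring.
    rewrite (generator_invB (J z - z)) generator_invZ gJ gJ' yosida_octave.
    have -> : l^-1%:C = (2 : R)%:C * (2 * l)^-1%:C :> R[i].
      by rewrite -rmorphM/= invfM mulrA divff// mul1r.
    by apply: (ip_ext ip_norm) => v; rewrite !(ipE ip) rmorph_nat; ring.
  have -> : x - p = w - Q w.
    rewrite /w /p.
    rewrite (QB x (Q x)). move: (Q (Q x)) => u'. move: (Q x) => u. apply: (ip_ext ip_norm) => v; rewrite !(ipE ip) rmorph_nat. ring.
  (* The other factor turns [J'] into the octave. *)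
  have Jw : J' w = - (octave x + (2 : R)%:C *: J' (octave x)).
    have e1 : J' (J x) = (2 : R)%:C *: J' x - J x by rewrite yosida_comm yosida_octave.
    rewrite /w (yosidaB l0 x) [Q x]/Q (yosidaB l0 (_ *: _)) (yosidaZ l0) e1 /octave.
    rewrite (yosidaB l0 (J' x)) e1.
    by apply: (ip_ext ip_norm) => v; rewrite !(ipE ip) rmorph_nat; ring.
  rewrite gQ scaleNr normRN normRZr gtr0_norm ?invr_gt0// mulrC ler_wpM2r ?invr_ge0 ?(ltW l20)//.
  have B1 : normR (J' w) <= 3 * normR (octave x).
    rewrite Jw normRN (le_trans (ler_normRD _ _))// normRZr ger0_norm//.
    have := yosida_normR l0 (octave x); lra.
  rewrite (le_trans (ler_normRD _ _))// normRZr ger0_norm//.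
  have := yosida_normR l20 (J' w); lra.
- rewrite (le_trans (generator_inv_normR _))// ler_wpM2l ?(ltW m0_gt0)//.
  by rewrite (le_trans (three _))// ler_wpM2l// Q_normR.
Qed.

End Octave.

(** Telescoping of the energy inequality for the octaves. *)
Lemma sum_octaves (x : X) (n : nat) :
  \sum_(j < n) normR (octave (2 ^+ j / 2) x) ^+ 2 <= normR x ^+ 2.
Proof.
have l0 j : 0 < 2 ^+ j / 2 :> R by rewrite divr_gt0// exprn_gt0.
have H : 3 * \sum_(j < n) normR (octave (2 ^+ j / 2) x) ^+ 2 <=
    normR (yosida (2 ^+ n / 2) x) ^+ 2.
  elim: n => [|n ih]; first by rewrite big_ord0 mulr0 sqr_ge0.
  rewrite big_ord_recr/= mulrDr.
  have := octave_energy (l0 n) x.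
  have -> : 2 * (2 ^+ n / 2) = 2 ^+ n.+1 / 2 :> R by rewrite exprS mulrA.
  lra.
have := yosida_normR (l0 n) x => Y.
have : normR (yosida (2 ^+ n / 2) x) ^+ 2 <= normR x ^+ 2 by rewrite lerXn2r ?nnegrE.
have : 0 <= \sum_(j < n) normR (octave (2 ^+ j / 2) x) ^+ 2.
  by apply: sumr_ge0 => j _; exact: sqr_ge0.
lra.
Qed.

(** The choice of the constant [32 = 8 * 4]: the contour estimate decays like
    [exp(- t / (8 m))], and at this time it is the fourth power of [1 / ((1 +
    m) (1 + N))]. *)
Definition decay_time (N m : R) : R := 32 * (m * (ln (1 + m) + ln (1 + N))).

Lemma decay_time_ge (N m : R) : 1 <= N -> 1 <= m -> 2 <= N * decay_time N m.
Proof.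
move=> N1 m1.
have l2 : 1 - 2^-1 <= ln (1 + m) :> R.
  have m10 : 0 < 1 + m by apply: addr_gt0 => //; exact: lt_le_trans m1.
  have i0 : 0 < (1 + m)^-1 by rewrite invr_gt0.
  have i2 : (1 + m)^-1 <= 2^-1 by rewrite lef_pV2 ?posrE// lerD2l.
  have : ln ((1 + m)^-1) <= (1 + m)^-1 - 1.
    by have := @le_ln1Dx R ((1 + m)^-1 - 1); rewrite [1 + (_ - 1)]addrC subrK; apply; lra.
  rewrite lnV ?posrE//; lra.
have lN : 0 <= ln (1 + N) by rewrite ln_ge0// lerDl (le_trans ler01 N1).
have : 2^-1 <= m * (ln (1 + m) + ln (1 + N)).
  rewrite (_ : 2^-1 = 1 * 2^-1) ?mul1r// -[leLHS]mul1r ler_pM//; lra.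
rewrite /decay_time => H.
have : 1 * 2 <= N * (32 * (m * (ln (1 + m) + ln (1 + N)))) by apply: ler_pM => //; lra.
by rewrite mul1r.
Qed.

Lemma expR_decay_time (N m : R) : 1 <= N -> 1 <= m ->
  m * N * expR (- (decay_time N m / (8 * m))) <= (N ^+ 3)^-1.
Proof.
move=> N1 m1.
have m00 : 0 < m := lt_le_trans ltr01 m1.
have N0 : 0 < N := lt_le_trans ltr01 N1.
have m10 : 0 < 1 + m by exact: addr_gt0.
have N10 : 0 < 1 + N by exact: addr_gt0.
have -> : - (decay_time N m / (8 * m)) = - (ln (((1 + m) * (1 + N)) ^+ 4)).
  rewrite lnXn ?mulr_gt0// lnM ?posrE// /decay_time mulr_natl; congr (- _).
  by field; rewrite gt_eqF.
rewrite -lnV ?posrE ?exprn_gt0 ?mulr_gt0// lnK ?posrE ?invr_gt0 ?exprn_gt0 ?mulr_gt0//.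
rewrite ler_pdivrMr ?exprn_gt0 ?mulr_gt0// [leRHS]mulrC ler_pdivlMr ?exprn_gt0//.
rewrite exprMn -mulrA -exprS; apply: ler_pM.
- exact: ltW.
- by rewrite exprn_ge0// ltW.
- by rewrite (@le_trans _ _ (1 + m)) ?lerDr// ler_eXnr// lerDl (ltW m00).
- by rewrite lerXn2r ?nnegrE ?(ltW N0) ?(ltW N10)// lerDr.
Qed.

(** The time [decay_time] is long enough for the resolvent bound [m] to
    disappear from the estimate. *)
Lemma low_frequency_rate : exists2 C : R, 0 <= C & forall (N m : R) (y : X),
  1 <= N -> 1 <= m -> (forall s, `|s| <= N -> resolvent_bound T (0 +i* s) m) ->
  dom A y -> dom A (A y) ->
  normR (T (decay_time N m) y) <=
    C * (normR y / N ^+ 3 + normR (A (A y)) / N ^+ 2).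
Proof.
have [c1 c10 [c2 c20 [c3 c30 H]]] : exists2 c1 : R, 0 <= c1 & exists2 c2 : R, 0 <= c2 &
  exists2 c3 : R, 0 <= c3 & forall (N m t : R) (y : X), 1 <= N -> 1 <= m ->
  (forall s, `|s| <= N -> resolvent_bound T (0 +i* s) m) ->
  2 <= N * t -> dom A y -> dom A (A y) ->
  normR (T t y) <= 3 * N * (c1 * m * expR (- (t / (8 * m))) + c2 * m / (4 * m * N) ^+ 4) * normR y
    + c3 / N ^+ 2 * normR (A (A y)).
  exists 756; first exact: ler0n.
  exists 60; first exact: ler0n.
  exists 363; first exact: ler0n.
  by move=> *; exact: (low_frequency_decay ip_norm T_C0 T_contr).
exists (3 * c1 + 3 * c2 + c3) => [|N m y N1 m1 Nm Ay AAy].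
  by rewrite !addr_ge0// mulr_ge0.
have m00 : 0 < m := lt_le_trans ltr01 m1.
have N0 : 0 < N := lt_le_trans ltr01 N1.
apply: (le_trans (H N m _ y N1 m1 Nm (decay_time_ge N1 m1) Ay AAy)).
have e1 := expR_decay_time N1 m1.
have e2 : m * N / (4 * m * N) ^+ 4 <= (N ^+ 3)^-1.
  rewrite ler_pdivrMr ?exprn_gt0 ?mulr_gt0// [leRHS]mulrC ler_pdivlMr ?exprn_gt0//.
  have -> : m * N * N ^+ 3 = m * N ^+ 4 by ring.
  rewrite !exprMn ler_pM2r ?exprn_gt0// (@le_trans _ _ (m ^+ 4)) ?ler_eXnr//.
  by rewrite ler_peMl ?exprn_ge0 ?(ltW m00)// exprn_ege1// ler1n.
set E := expR _ in e1 *; set i3 := (N ^+ 3)^-1 in e1 e2 *.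
have n1 := normR_ge0 y; have n2 := normR_ge0 (A (A y)).
have i30 : 0 <= i3 by rewrite invr_ge0 exprn_ge0// ltW.
have -> : 3 * N * (c1 * m * E + c2 * m / (4 * m * N) ^+ 4) =
    3 * c1 * (m * N * E) + 3 * c2 * (m * N / (4 * m * N) ^+ 4) by ring.
have b1 : 3 * c1 * (m * N * E) <= 3 * c1 * i3 by rewrite ler_wpM2l// mulr_ge0.
have b2 : 3 * c2 * (m * N / (4 * m * N) ^+ 4) <= 3 * c2 * i3 by rewrite ler_wpM2l// mulr_ge0.
have p1 := ler_wpM2r n1 (lerD b1 b2).
have q0 : 0 <= normR (A (A y)) / N ^+ 2 by rewrite divr_ge0// exprn_ge0// ltW.
have p0 : 0 <= normR y * i3 by rewrite mulr_ge0.
have -> : c3 / N ^+ 2 * normR (A (A y)) = c3 * (normR (A (A y)) / N ^+ 2) by ring.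
apply: (le_trans (lerD p1 (lexx _))).
have := mulr_ge0 c10 q0; have := mulr_ge0 c20 q0; have := mulr_ge0 c30 p0.
rewrite mulrDr !mulrDl; set u := normR (A (A y)) / _; set w := normR y * i3.
rewrite -!mulrA [i3 * _]mulrC -/w; lra.
Qed.

(** Square summability of the decay of an orbit that starts in the domain,
    sampled at the times where the weight doubles. The octaves contribute a
    square summable sequence and the low frequency error a geometric one. *)
Theorem dyadic_decay (Mf : R -> R) : (forall s, 0 <= s -> 1 <= Mf s) ->
  (forall s t, 0 <= s -> s <= t -> Mf s <= Mf t) ->
  (forall s, resolvent_bound T (0 +i* s) (Mf `|s|)) ->
  forall x, exists C, forall n,
    \sum_(j < n) (2 ^+ j * normR (T (decay_time (2 ^+ j) (Mf (2 ^+ j))) (generator_inv x))) ^+ 2 <= C.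
Proof.
move=> Mf1 Mfi Mfr x; have [C C0 HC] := low_frequency_rate.
pose K := C * (m0 * (3 * normR x)).
have K0 : 0 <= K by rewrite !mulr_ge0// ltW.
pose a j := normR (octave (2 ^+ j / 2) x).
have step j : 2 ^+ j * normR (T (decay_time (2 ^+ j) (Mf (2 ^+ j))) (generator_inv x)) <=
    (9 + 3 * C) * a j + K / 2 ^+ j.
  have p1 : 1 <= 2 ^+ j :> R by rewrite exprn_ege1// ler1n.
  have p0 : 0 < 2 ^+ j :> R := lt_le_trans ltr01 p1.
  have l0 : 0 < 2 ^+ j / 2 :> R by rewrite divr_gt0.
  have [y [dy dAy n1 n2 n3]] := octave_split l0 x.
  have E : 2 * (2 ^+ j / 2) = 2 ^+ j :> R by rewrite mulrC divfK.
  rewrite E -/(a j) in n1 n2.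
  set N := 2 ^+ j in p1 p0 l0 E n1 n2 *.
  have m1 := Mf1 N (ltW p0).
  have t0 : 0 <= decay_time N (Mf N).
    by rewrite -(pmulr_rge0 _ p0) (le_trans _ (decay_time_ge p1 m1)).
  have HL := HC N (Mf N) y p1 m1 _ dy dAy.
  have {}HL : normR (T (decay_time N (Mf N)) y) <= C * (normR y / N ^+ 3 + normR (A (A y)) / N ^+ 2).
    by apply: HL => s sN; exact: resolvent_boundW (Mfi _ _ (normr_ge0 s) sN) (Mfr s).
  have -> : generator_inv x = (generator_inv x - y) + y by rewrite subrK.
  rewrite -[T _ (_ + _)]/(T _ _) linearD.
  have b1 : N * normR (T (decay_time N (Mf N)) (generator_inv x - y)) <= 9 * a j.
    rewrite mulrC -ler_pdivlMr// (le_trans (contr_normR T_contr _ t0))//.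
  have b2 : N * normR (T (decay_time N (Mf N)) y) <= 3 * C * a j + K / N.
    rewrite (le_trans (ler_wpM2l (ltW p0) HL))//.
    have q1 : N * (normR y / N ^+ 3) <= m0 * (3 * normR x) / N.
      have -> : N * (normR y / N ^+ 3) = normR y / N * N^-1 by field; rewrite gt_eqF.
      rewrite ler_wpM2r ?invr_ge0 ?(ltW p0)// ler_pdivrMr// (le_trans n3)//.
      by rewrite ler_peMr// !mulr_ge0// ltW.
    have q2 : N * (normR (A (A y)) / N ^+ 2) <= 3 * a j.
      have -> : N * (normR (A (A y)) / N ^+ 2) = normR (A (A y)) / N by field; rewrite gt_eqF.
      by rewrite ler_pdivrMr// mulrAC.
    have -> : N * (C * (normR y / N ^+ 3 + normR (A (A y)) / N ^+ 2)) =
      C * (N * (normR y / N ^+ 3) + N * (normR (A (A y)) / N ^+ 2)) by ring.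
    have -> : 3 * C * a j + K / N = C * (m0 * (3 * normR x) / N + 3 * a j) by rewrite /K; ring.
    exact: (ler_wpM2l C0 (lerD q1 q2)).
  have := ler_wpM2l (ltW p0) (ler_normRD (T (decay_time N (Mf N)) (generator_inv x - y)) (T (decay_time N (Mf N)) y)).
  rewrite mulrDr; lra.
exists (2 * (9 + 3 * C) ^+ 2 * normR x ^+ 2 + 4 * K ^+ 2) => n.
have D0 : 0 <= 9 + 3 * C by rewrite addr_ge0// mulr_ge0.
have geom : \sum_(j < n) (2 ^+ j)^-1 <= 2 :> R.
  suff : \sum_(j < n) (2 ^+ j)^-1 = 2 - 2 / 2 ^+ n :> R.
    by move=> ->; rewrite lerBlDr lerDl divr_ge0// exprn_ge0.
  elim: (n) => [|k ih]; first by rewrite big_ord0 expr0 divr1 subrr.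
  by rewrite big_ord_recr/= ih exprS; field; rewrite ?expf_neq0.
apply: (@le_trans _ _ (\sum_(j < n) (2 * (9 + 3 * C) ^+ 2 * a j ^+ 2 + 2 * K ^+ 2 * (2 ^+ j)^-1))).
  apply: ler_sum => j _.
  have p1 : 1 <= 2 ^+ j :> R by rewrite exprn_ege1// ler1n.
  have p0 : 0 < 2 ^+ j :> R := lt_le_trans ltr01 p1.
  have i0 : 0 <= (2 ^+ j : R)^-1 by rewrite invr_ge0 ltW.
  have i1 : (2 ^+ j : R)^-1 <= 1 by rewrite invf_le1.
  have s1 : (2 ^+ j * normR (T (decay_time (2 ^+ j) (Mf (2 ^+ j))) (generator_inv x))) ^+ 2 <=
     ((9 + 3 * C) * a j + K / 2 ^+ j) ^+ 2.
    rewrite lerXn2r ?nnegrE ?(step j)// ?mulr_ge0 ?(ltW p0)//.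
    exact: (addr_ge0 (mulr_ge0 D0 (normR_ge0 _)) (mulr_ge0 K0 i0)).
  apply: (le_trans s1).
  have s2 (u w : R) : (u + w) ^+ 2 <= 2 * u ^+ 2 + 2 * w ^+ 2.
    have := sqr_ge0 (u - w); rewrite !expr2; lra.
  have b1 : 2 * ((9 + 3 * C) * a j) ^+ 2 = 2 * (9 + 3 * C) ^+ 2 * a j ^+ 2 by ring.
  have b2 : 2 * (K / 2 ^+ j) ^+ 2 <= 2 * K ^+ 2 * (2 ^+ j)^-1.
    have -> : 2 * (K / 2 ^+ j) ^+ 2 = 2 * K ^+ 2 * ((2 ^+ j)^-1 * (2 ^+ j)^-1) by ring.
    by rewrite ler_wpM2l ?ler_piMl// mulr_ge0// sqr_ge0.
  by rewrite (le_trans (s2 _ _))// b1 lerD.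
rewrite big_split/= -!mulr_sumr lerD//.
  by rewrite ler_wpM2l ?mulr_ge0 ?sqr_ge0// sum_octaves.
have -> : 4 * K ^+ 2 = 2 * K ^+ 2 * 2 by ring.
by rewrite ler_wpM2l// mulr_ge0// sqr_ge0.
Qed.

End SquareFunction.

(** * The energy identity *)

Section SquareRootOfDissipation.
Context {R : realType} {X : completeNormedModType R[i]}.
Variable ip : {dot X for Num.conj}.
Hypothesis ip_norm : hilbert_norm ip.
Variable T : R -> {linear X -> X}.
Hypothesis T_C0 : C0_semigroup T.
Hypothesis T_contr : contractive T.
Local Notation A := (generator T).
Hypothesis domA : dom A = dom (adjoint ip A).
Variables S B : operator X.
Hypothesis S_ext : op_extends S (op_opp (op_add A (adjoint ip A))).
Hypothesis B_sqrt : is_sqrt ip B S.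

Lemma adjointP (V : operator X) (y : X) :
  dom (adjoint ip V) y -> adjoint_at ip V y (adjoint ip V y).
Proof. exact: (@getPex _ [set z | adjoint_at ip V y z]). Qed.

Lemma sqrt_domW (z : X) : dom A z -> dom B z.
Proof.
move=> Az; have [_ _ [[BS _] _]] := B_sqrt; have [AS _] := S_ext.
by have [] : dom (op_comp B B) z by apply/BS/AS; split => //; rewrite -domA.
Qed.

(** By self-adjointness of [B] the square of [|B z|] is the form of [B^2], and
    [B^2] is minus the sum of [A] and its adjoint at [z]. *)
Lemma sqrt_energy (z : X) : dom A z -> normR (B z) ^+ 2 = - 2 * rip ip (A z) z.
Proof.
move=> Az; have dz : dom (adjoint ip A) z by rewrite -domA.
have [[_ _ [_ [BB BE]]] _ [[BS BSE] _]] := B_sqrt; have [AS ASE] := S_ext.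
have Sz : dom S z by apply: AS; split.
have [dBz dBBz] := BS _ Sz.
have := adjointP (BB _ dBz) dBBz; rewrite BE// -[B (B z)]/(op_comp B B z) BSE// ASE ?/=//.
rewrite -(rip_normR ip_norm) {1}/rip => <-.
rewrite -/(rip ip _ _) ripNl ripDl [rip ip (adjoint ip A z) z]ripC.
have := adjointP dz Az; rewrite /rip => <-; lra.
Qed.

(** On the domain of the generator the operator [B] is continuous for the
    graph norm of [A]. *)
Lemma sqrt_sub (u v : X) : dom A u -> dom A v ->
  normR (B u - B v) ^+ 2 <= 2 * (normR (A u - A v) * normR (u - v)).
Proof.
move=> Au Av; have [dB EB] := generatorB Au Av.
have [[[_ _ Blin] _ _] _ _] := B_sqrt.
have -> : B u - B v = B (u - v).
  rewrite addrC -scaleN1r -Blin; [|exact: sqrt_domW..].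
  by rewrite scaleN1r addrC.
rewrite sqrt_energy// EB; have := rip_norm_le ip_norm (A u - A v) (u - v).
have := ler_norm (- rip ip (A u - A v) (u - v)); rewrite normrN; lra.
Qed.

Lemma sqrt_normR (u : X) : dom A u -> normR (B u) ^+ 2 <= 2 * (normR (A u) * normR u).
Proof.
move=> Au; rewrite sqrt_energy//; have := rip_norm_le ip_norm (A u) u.
have := ler_norm (- rip ip (A u) u); rewrite normrN; lra.
Qed.

Variable y : X.
Hypothesis Ay : dom A y.

Lemma sqrt_orbit_continuous : continuous (fun t => B (orbit T y t)).
Proof.
move=> t; apply/cvg_normR => e e0.
have K0 : 0 < 4 * normR (A y) + 1 by apply: ltr_wpDl => //; exact: mulr_ge0.
have e20 : 0 < e ^+ 2 by exact: exprn_gt0.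
have /cvg_normR/(_ _ (divr_gt0 e20 K0)) := @continuous_orbit _ _ _ T_C0 T_contr y t.
apply: filterS => s; rewrite ltr_pdivlMr// => Hd.
have orbA r : dom A (orbit T y r) /\ A (orbit T y r) = orbit T (A y) r.
  by apply: generator_orbit => //; rewrite le_max lexx.
have [[dt Et] [ds Es]] := (orbA t, orbA s).
rewrite -(@ltr_pXn2r _ 2) ?nnegrE ?(ltW e0)//.
apply: (le_lt_trans (sqrt_sub dt ds)); apply: (le_lt_trans _ Hd); rewrite Et Es.
have n0 := normR_ge0 (orbit T y t - orbit T y s).
have n1 : normR (orbit T (A y) t - orbit T (A y) s) <= 2 * normR (A y).
  rewrite (le_trans (ler_normRB _ _))//.
  have := orbit_normR T_contr (A y) t; have := orbit_normR T_contr (A y) s; lra.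
have := ler_wpM2r n0 n1; lra.
Qed.

(** The derivative of [|T(t) y|^2] is [- |B T(t) y|^2]. *)
Lemma sqrt_orbit_energy (a b : R) : 0 <= a -> a < b ->
  (\int[lebesgue_measure]_(t in `[a, b]) (normR (B (orbit T y t)) ^+ 2)%:E =
   (normR (T a y) ^+ 2 - normR (T b y) ^+ 2)%:E)%E.
Proof.
move=> a0 ab; pose E t := - rip ip (orbit T y t) (orbit T y t).
have Ec : continuous E.
  move=> t; have n := normR_continuous (@continuous_orbit _ _ _ T_C0 T_contr y).
  apply: cvgN; rewrite rip_normR// expr2.
  under eq_fun do rewrite rip_normR// expr2.
  by apply: cvgM; exact: n.
have dE (t : R) : 0 < t -> is_derive t 1 E (normR (B (orbit T y t)) ^+ 2).
  move=> t0; have dy := vderiv_orbit T_C0 T_contr t0 Ay.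
  have [dt Et] := generator_orbit T_C0 T_contr (ltW t0) Ay.
  have := is_deriveN (is_derive_rip ip_norm dy dy) => /is_derive_eq; apply.
  have -> : orbit T y t = T t y by rewrite /orbit max_r ?(ltW t0).
  by rewrite sqrt_energy// Et [rip ip (T t y) _]ripC; ring.
rewrite (continuous_FTC2 (F := E) ab).
- rewrite -EFinB /E !rip_normR// /orbit !max_r ?(ltW (le_lt_trans a0 ab))//; congr _%:E; lra.
- have n := normR_continuous sqrt_orbit_continuous.
  by apply: continuous_subspaceT => t; apply: cvgM; exact: n.
- split.
  + move=> t; rewrite in_itv/= => /andP[t1 _]; have := dE _ (le_lt_trans a0 t1).
    by move=> /@ex_derive.
  + apply: cvg_at_right_filter; exact: Ec.
  + apply: cvg_at_left_filter; exact: Ec.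
- move=> t; rewrite in_itv/= => /andP[t1 _]; have D := dE _ (le_lt_trans a0 t1).
  by rewrite derive1E; exact: (@derive_val _ _ _ _ _ _ _ D).
Qed.

Lemma sqrt_orbit_cvg0 : T t y @[t --> +oo] --> 0 ->
  B (T t y) @[t --> +oo] --> 0.
Proof.
move=> /cvg_normR H; apply/cvg_normR => e e0.
have K0 : 0 < 2 * normR (A y) + 1 by apply: ltr_wpDl => //; exact: mulr_ge0.
have e20 : 0 < e ^+ 2 by exact: exprn_gt0.
have := H _ (divr_gt0 e20 K0); move=> Hn; near=> t.
have : normR (0 - T t y) < e ^+ 2 / (2 * normR (A y) + 1) by near: t.
rewrite !sub0r !normRN ltr_pdivlMr// => {}H.
have t0 : 0 <= t by near: t; exact: nbhs_pinfty_ge.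
have [dt Et] := generator_orbit T_C0 T_contr t0 Ay.
rewrite -(@ltr_pXn2r _ 2) ?nnegrE ?(ltW e0)//.
apply: (le_lt_trans (sqrt_normR dt)); apply: (le_lt_trans _ H); rewrite Et.
have := ler_wpM2r (normR_ge0 (T t y)) (contr_normR T_contr (A y) t0).
have := normR_ge0 (T t y); lra.
Unshelve. all: by end_near. Qed.

End SquareRootOfDissipation.

(** * The weight *)

Section LogarithmicWeight.
Context {R : realType}.
Variable M : R -> R.
Hypothesis M_cont : {within `[0, +oo[%classic, continuous M}.
Hypothesis M_incr : forall s t : R, 0 <= s -> s <= t -> M s <= M t.
Hypothesis M_ge2 : forall s : R, 0 <= s -> 2 <= M s.

Lemma Mlog_mono (s t : R) : 0 <= s -> s < t -> Mlog M s < Mlog M t.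
Proof.
move=> s0 st; have t0 : 0 <= t := ltW (le_lt_trans s0 st).
have Ms := M_ge2 s0; have Mst := M_incr s0 (ltW st).
have Ms0 : 0 < M s := lt_le_trans (ltr0n _ 2) Ms.
have l1 : ln (1 + s) < ln (1 + t) by rewrite ltr_ln ?posrE ?ltrD2l// ltr_wpDr.
have l2 : ln (1 + M s) <= ln (1 + M t).
  by rewrite ler_ln ?posrE ?lerD2l// addr_gt0// (lt_le_trans Ms0).
have l3 : 0 <= ln (1 + s) by rewrite ln_ge0// lerDl.
have l4 : 0 <= ln (1 + M s) by rewrite ln_ge0// lerDl ltW.
rewrite /Mlog (@lt_le_trans _ _ (M s * (ln (1 + M t) + ln (1 + t))))//.
  by rewrite ltr_pM2l// ler_ltD.
by rewrite ler_wpM2r// addr_ge0//; [exact: le_trans l2|exact: ltW (le_lt_trans l3 l1)].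
Qed.

Lemma Mlog_mono_le (s t : R) : 0 <= s -> s <= t -> Mlog M s <= Mlog M t.
Proof. by move=> s0; rewrite le_eqVlt => /predU1P[->//|st]; exact/ltW/Mlog_mono. Qed.

(** Unboundedness, in the form used by the intermediate value theorem. *)
Lemma Mlog_ge (t : R) : 0 <= t -> t <= Mlog M (expR t).
Proof.
move=> t0; have e0 : 0 <= expR t := expR_ge0 t; have M2 := M_ge2 e0.
have l1 : t <= ln (1 + expR t).
  by rewrite -{1}(expRK t) ler_ln ?posrE ?expR_gt0 ?addr_gt0 ?expR_gt0// lerDr.
have l2 : 0 <= ln (1 + M (expR t)) by rewrite ln_ge0// lerDl (le_trans _ M2).
rewrite -[leLHS]mul1r /Mlog ler_pM//; lra.
Qed.

Lemma Mlog_continuous : {within `[1, +oo[%classic, continuous (Mlog M)}.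
Proof.
have Mc : {within `[1, +oo[%classic, continuous M}.
  by apply: continuous_subspaceW M_cont => s; rewrite /= !in_itv/= !andbT; exact: le_trans.
have lnc (f : R -> R) : (forall s, 1 <= s -> 0 <= f s) ->
    {within `[1, +oo[%classic, continuous f} ->
    {within `[1, +oo[%classic, continuous (fun s => ln (1 + f s))}.
  move=> f0 fc; apply: (@within_continuous_comp _ _ _ _ f (fun v => ln (1 + v))) => // v.
  rewrite inE => -[s /=]; rewrite in_itv/= andbT => s1 <-.
  apply: (continuous_comp (f := fun v : R => 1 + v) (g := @ln R)); first by apply: cvgD; [exact: cvg_cst|exact: cvg_id].
  by apply: continuous_ln; rewrite ltr_pwDl// f0.
move=> s; apply: cvgM; first exact: Mc.
apply: cvgD; apply: lnc => //.
- by move=> r r1; rewrite (le_trans _ (M_ge2 (le_trans ler01 r1))).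
- by move=> r; exact: le_trans.
- by apply: continuous_subspaceT => r; exact: cvg_id.
Qed.

Lemma Mlog_surj (t : R) : Mlog M 1 <= t -> exists2 s, 1 <= s & Mlog M s = t.
Proof.
move=> t1; have t0 : 0 <= t.
  by apply: le_trans t1; rewrite mulr_ge0 ?addr_ge0 ?ln_ge0 ?lerDl// (le_trans _ (M_ge2 ler01)).
have e1 : 1 <= expR t by rewrite -expR0 ler_expR.
have [|||s] := @IVT _ (Mlog M) 1 (expR t) t => //.
- by apply: continuous_subspaceW Mlog_continuous => s; rewrite /= !in_itv/= andbT => /andP[].
- by rewrite ge_min le_max t1 Mlog_ge ?orbT.
by rewrite in_itv/= => /andP[s1 _]; exists s.
Qed.

Lemma w_Mlog_Mlog (s : R) : 1 <= s -> w_Mlog M (Mlog M s) = s.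
Proof.
move=> s1; rewrite /w_Mlog Mlog_mono_le// /Mlog_inv pinvKV//; last first.
  by rewrite inE/= in_itv/= andbT (le_trans _ s1).
move=> r t; rewrite !inE/= !in_itv/= !andbT => r0 t0 E.
by apply/eqP; case: (ltgtP r t) => // /Mlog_mono; rewrite E ltxx; apply.
Qed.

Lemma w_Mlog_le (s t : R) : 1 <= s -> t <= Mlog M s -> w_Mlog M t <= s.
Proof.
move=> s1 ts; have [t1|t1] := leP (Mlog M 1) t; last by rewrite /w_Mlog (lt_geF t1).
have [r r1 rt] := Mlog_surj t1; rewrite -rt w_Mlog_Mlog//.
rewrite leNgt; apply/negP => /(Mlog_mono (le_trans ler01 s1)).
by rewrite rt ltNge ts.
Qed.

Lemma w_Mlog_ge (s t : R) : 1 <= s -> Mlog M s <= t -> s <= w_Mlog M t.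
Proof.
move=> s1 st; have t1 := le_trans (Mlog_mono_le ler01 s1) st.
have [r r1 rt] := Mlog_surj t1; rewrite -rt w_Mlog_Mlog//.
rewrite leNgt; apply/negP => /(Mlog_mono (le_trans ler01 r1)).
by rewrite rt ltNge st.
Qed.

Lemma w_Mlog_ge1 (t : R) : 1 <= w_Mlog M t.
Proof.
have [t1|t1] := leP (Mlog M 1) t; first exact: w_Mlog_ge.
by rewrite /w_Mlog (lt_geF t1).
Qed.

(** A monotone function that takes all values of an interval has no jumps. *)
Lemma w_Mlog_continuous : continuous (w_Mlog M).
Proof.
move=> t; apply/cvgrPdist_le => e e0; set r := w_Mlog M t.
have r1 : 1 <= r := w_Mlog_ge1 t; have r0 := le_trans ler01 r1.
have tr : t <= Mlog M r.
  have [t1|t1] := leP (Mlog M 1) t; last by rewrite (le_trans (ltW t1))// Mlog_mono_le.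
  by rewrite /r; have [q q1 <-] := Mlog_surj t1; rewrite w_Mlog_Mlog.
have up : t < Mlog M (r + e) by rewrite (le_lt_trans tr)// Mlog_mono// ltrDl.
have lo : 1 < r - e -> Mlog M (r - e) < t.
  move=> re; rewrite (@lt_le_trans _ _ (Mlog M r)) ?Mlog_mono ?(ltW (lt_trans ltr01 re))// ?gtrBl//.
  have [t1|t1] := leP (Mlog M 1) t.
    by rewrite /r; have [q q1 <-] := Mlog_surj t1; rewrite w_Mlog_Mlog.
  by move: re; rewrite /r /w_Mlog (lt_geF t1) => re; exfalso; lra.
have nlo : \forall s \near t, r - e <= w_Mlog M s.
  have [re|re] := leP (r - e) 1.
    by near=> s; exact: le_trans (w_Mlog_ge1 s).
  by apply: filterS (lt_nbhsr (lo re)) => s /ltW; exact: w_Mlog_ge (ltW re).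
near=> s.
have su : w_Mlog M s <= r + e.
  rewrite w_Mlog_le// ?(le_trans r1)// ?lerDl ?(ltW e0)// ltW//.
  by near: s; exact: lt_nbhsl.
have sl : r - e <= w_Mlog M s by near: s.
rewrite ler_norml; apply/andP; split; lra.
Unshelve. all: by end_near. Qed.

End LogarithmicWeight.

(** * Measurability and integration of continuous functions *)

Section SimpleApproximation.
Context {R : realType} {X : completeNormedModType R[i]}.

(** A continuous function is the pointwise limit of its samples on the grids
    of mesh [1 / (n + 1)]. *)
Lemma continuous_strongly_measurable (f g : R -> X) : continuous g ->
  (forall t, 0 <= t -> f t = g t) -> strongly_measurable `[0, +oo[%classic f.
Proof.
move=> gc fg.
pose grid n k : R := k%:R / n.+1%:R.
pose cell n k : set R := `[grid n k, grid n k.+1[%classic.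
pose s n (t : R) : X := if 0 <= t < n%:R then g (grid n (Num.trunc (n.+1%:R * t))) else 0.
have n0 n : 0 < n.+1%:R :> R by rewrite ltr0n.
have cellP n t : 0 <= t -> cell n (Num.trunc (n.+1%:R * t)) t.
  move=> t0; rewrite /cell/= in_itv/= /grid ler_pdivrMr// ltr_pdivlMr// [t * _]mulrC.
  by rewrite truncn_itv// mulr_ge0// ltW.
exists s; split=> [n|].
  split.
    apply: (@sub_finite_set _ _ ([set g (grid n k) | k in `I_(n.+1 * n)] `|` [set 0])).
      move=> _ [t _ <-]; rewrite /s; case: ifPn => [/andP[t0 tn]|_]; last by right.
      left; exists (Num.trunc (n.+1%:R * t)) => //=.
      by rewrite truncn_lt_nat ?mulr_ge0 ?(ltW (n0 n))// natrM ltr_pM2l.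
    by rewrite finite_setU; split=> //; apply: finite_image; exact: finite_II.
  move=> y.
  have -> : s n @^-1` [set y] =
      (\bigcup_(k in [set k | g (grid n k) = y]) (cell n k `&` `[0, n%:R[%classic)) `|`
      (if y == 0 then ~` `[0, n%:R[%classic else set0).
    apply/seteqP; split=> t /=; rewrite /s.
      case: ifPn => [tn sy|tn <-]; last by right; rewrite eqxx /= in_itv/=; exact/negP.
      have /andP[t0 _] := tn.
      by left; exists (Num.trunc (n.+1%:R * t)) => //; split; [exact: cellP|rewrite /= in_itv].
    case=> [[k gk [ck]]|]; last first.
      by case: eqP => // -> /=; rewrite in_itv/= => /negP/negbTE ->.
    rewrite /= in_itv/= => tn; rewrite tn -gk; congr (g (grid n _)); move/andP: tn => [t0 _].
    apply: truncn_def; move: ck; rewrite /cell/= in_itv/= /grid.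
    by rewrite ler_pdivrMr// ltr_pdivlMr// [t * _]mulrC.
  apply: measurableU; first by apply: bigcup_measurable => k _; apply: measurableI; exact: measurable_itv.
  by case: eqP => _ //; apply: measurableC; exact: measurable_itv.
apply: aeW => t; rewrite /= in_itv/= andbT => t0; rewrite fg//.
apply: (@cvg_trans _ (g (grid n (Num.trunc (n.+1%:R * t))) @[n --> \oo])).
  apply: near_eq_cvg; near=> n; rewrite /s t0 /=.
  suff -> : t < n%:R by [].
  by near: n; exact: nbhs_infty_gtr.
apply: (@cvg_comp _ _ _ (fun n => grid n (Num.trunc (n.+1%:R * t))) g _ _ _ _ (gc t)).
apply/cvgrPdist_lt => e e0; near=> n.
have := cellP n t t0; rewrite /cell/= in_itv/= => /andP[c1 c2].
rewrite ger0_norm ?subr_ge0//; apply: (@lt_trans _ _ (n.+1%:R^-1)).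
  by rewrite ltrBlDl; move: c2; rewrite /grid -[in _.+1%:R / _]natr1 mulrDl mul1r.
rewrite invf_plt ?posrE//; near: n.
by apply: filterS (nbhs_infty_gtr e^-1) => n /lt_le_trans; apply; rewrite ler_nat.
Unshelve. all: by end_near. Qed.

End SimpleApproximation.

(** Comparison of an integral with a series along a sequence of times. *)
Lemma ge0_integral_lt_pinfty {R : realType} (phi : R -> R) (tau a : nat -> R) (c : R) :
  continuous phi -> (forall t, 0 <= phi t) ->
  0 <= tau 0%N -> nondecreasing_seq tau -> (forall b, exists n, b <= tau n) ->
  (\int[lebesgue_measure]_(t in `[0%R, tau 0%N]) (phi t)%:E <= (a 0%N)%:E)%E ->
  (forall n, (\int[lebesgue_measure]_(t in `[tau n, tau n.+1]) (phi t)%:E <= (a n.+1)%:E)%E) ->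
  (forall n, \sum_(j < n) a j <= c) ->
  (\int[lebesgue_measure]_(t in `[0%R, +oo[) (phi t)%:E < +oo)%E.
Proof.
move=> phic phi0 tau0 taui tauy a0 aS ac.
have mphi (D : set R) : measurable_fun D (fun t => (phi t)%:E).
  apply/measurable_EFinP; apply: measurable_funTS; exact: continuous_measurable_fun.
pose F n := `[0%R, tau n]%classic.
have IF n : (\int[lebesgue_measure]_(t in F n) (phi t)%:E <= (\sum_(j < n.+1) a j)%:E)%E.
  elim: n => [|n ih]; first by rewrite big_ord1.
  have tn0 : 0 <= tau n by rewrite (le_trans tau0)// taui.
  have -> : F n.+1 = F n `|` `]tau n, tau n.+1]%classic.
    by rewrite /F -itv_bndbnd_setU// bnd_simp// taui.
  rewrite ge0_integral_setU//=; first last.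
  - rewrite disj_set2E; apply/eqP/seteqP; split => // t [] /=; rewrite !in_itv/=.
    by move=> /andP[_ ?] /andP[]; rewrite ltNge => /negP.
  - by move=> t _; rewrite lee_fin.
  - exact: mphi.
  - exact: measurable_itv.
  rewrite big_ord_recr/= EFinD leeD// (le_trans _ (aS n))//.
  apply: ge0_subset_integral => //.
  - exact: mphi.
  - by move=> t _; rewrite lee_fin.
  - by apply: subset_itvr; rewrite bnd_simp.
have -> : `[0%R, +oo[%classic = \bigcup_n F n.
  apply/seteqP; split=> [t|t [n _]]; rewrite /F/= !in_itv/= ?andbT.
    by move=> t0; have [n tn] := tauy t; exists n => //=; rewrite in_itv/= t0.
  by case/andP.
have FH : nondecreasing_seq F.
  move=> n m nm; apply/subsetPset; apply: subset_itvl; rewrite bnd_simp; exact: taui.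
have H := @ge0_nondecreasing_set_cvg_integral _ (measurableTypeR R) R F (fun t => (phi t)%:E) lebesgue_measure FH.
have {}H := H (fun n => measurable_itv _) (fun n => mphi _) (fun n t _ => phi0 t).
rewrite -(cvg_lim _ H)//; apply: (@le_lt_trans _ _ c%:E); last exact: ltry.
apply: lime_le; first by apply/cvg_ex; eexists; exact: H.
by apply: nearW => n; rewrite (le_trans (IF n))// lee_fin.
Qed.

(** * Weighted square integrability *)

Lemma continuous_scale {R : realType} {X : completeNormedModType R[i]}
    (c : R -> R) (F : R -> X) : continuous c -> continuous F ->
  continuous (fun t => (c t)%:C *: F t).
Proof.
move=> cc Fc t; apply: cvgZ; last exact: Fc.
apply/cvgrPdist_lt => e e0.
have er : e = (ReC e)%:C by rewrite RRe_real// gtr0_real.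
have : 0 < ReC e by rewrite -ltcR -er.
have /cvgrPdist_lt ct := cc t; move=> /ct; apply: filterS => s.
by rewrite er -rmorphB/= cabsE cabs_real ltcR.
Qed.

Lemma exp2_unbounded {R : realType} (b : R) : exists n : nat, b <= 2 ^+ n.
Proof.
exists (Num.bound `|b|); apply: (@le_trans _ _ (Num.bound `|b|)%:R).
  by rewrite ltW// (le_lt_trans (ler_norm b))// archi_boundP.
by rewrite -natrX ler_nat ltnW// ltn_expl.
Qed.

Section WeightedDecay.
Context {R : realType} {X : completeNormedModType R[i]}.
Variable ip : {dot X for Num.conj}.
Hypothesis ip_norm : hilbert_norm ip.
Variable T : R -> {linear X -> X}.
Hypothesis T_C0 : C0_semigroup T.
Hypothesis T_contr : contractive T.
Local Notation A := (generator T).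
Hypothesis domA : dom A = dom (adjoint ip A).
Variables S B : operator X.
Hypothesis S_ext : op_extends S (op_opp (op_add A (adjoint ip A))).
Hypothesis B_sqrt : is_sqrt ip B S.
Variable M : R -> R.
Hypothesis M_cont : {within `[0, +oo[%classic, continuous M}.
Hypothesis M_incr : forall s t : R, 0 <= s -> s <= t -> M s <= M t.
Hypothesis M_ge2 : forall s : R, 0 <= s -> 2 <= M s.
Variable y : X.
Hypothesis Ay : dom A y.

Let tau (n : nat) : R := decay_time (2 ^+ n) (M (2 ^+ n)).

Variable C : R.
Hypothesis decay : forall n,
  \sum_(j < n) (2 ^+ j * normR (T (tau j) y)) ^+ 2 <= C.

Let p0 (n : nat) : 0 <= 2 ^+ n :> R. Proof. exact: exprn_ge0. Qed.
Let p1 (n : nat) : 1 <= 2 ^+ n :> R. Proof. by rewrite exprn_ege1// ler1n. Qed.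

Let tauE n : tau n = 32 * Mlog M (2 ^+ n). Proof. by []. Qed.

Let tau_lt n : tau n < tau n.+1.
Proof.
by rewrite !tauE ltr_pM2l// (Mlog_mono M_incr M_ge2)// exprS ltr_pMl ?exprn_gt0// ltr1n.
Qed.

Let tau_gt0 n : 0 < tau n.
Proof.
rewrite tauE mulr_gt0// (le_lt_trans _ (Mlog_mono M_incr M_ge2 (lexx 0) _)) ?exprn_gt0//.
by rewrite mulr_ge0 ?addr_ge0 ?ln_ge0 ?lerDl// (le_trans _ (M_ge2 (lexx 0))).
Qed.

Let tau_unbounded b : exists n, b <= tau n.
Proof.
have [n nb] := exp2_unbounded (expR `|b|); exists n.
apply: (le_trans (ler_norm b)); rewrite tauE.
have h1 := Mlog_ge M_ge2 (normr_ge0 b).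
have h2 := Mlog_mono_le M_incr M_ge2 (expR_ge0 _) nb.
have := normr_ge0 b; lra.
Qed.

Let w (t : R) : R := w_Mlog M (32^-1 * t).

Let w_le n t : t <= tau n -> w t <= 2 ^+ n.
Proof.
move=> tn; apply: (w_Mlog_le M_cont M_incr M_ge2) => //.
by rewrite mulrC ler_pdivrMr// mulrC.
Qed.

Let w_ge0 t : 0 <= w t.
Proof. exact: le_trans ler01 (w_Mlog_ge1 M_cont M_incr M_ge2 _). Qed.

Let w_continuous : continuous w.
Proof.
move=> t; apply: (continuous_comp (f := fun v : R => 32^-1 * v) (g := w_Mlog M)).
  exact: mulrl_continuous.
exact: w_Mlog_continuous.
Qed.

Let F (t : R) : X := B (orbit T y t).

Let F_continuous : continuous F.
Proof. exact: (sqrt_orbit_continuous ip_norm T_C0 T_contr domA S_ext B_sqrt Ay). Qed.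

(** The norm of the orbit is nonincreasing, so its decay along a sequence of
    times is enough. *)
Lemma orbit_cvg0 : T t y @[t --> +oo] --> 0.
Proof.
apply/cvg_normR => e e0.
have [n nb] := exp2_unbounded ((`|C| + 2) / e).
near=> t; have nt : tau n <= t by near: t; apply: nbhs_pinfty_ge; exact: num_real.
have t0 : 0 <= tau n := ltW (tau_gt0 n).
have : normR (T t y) <= normR (T (tau n) y).
  by rewrite -(subrK (tau n) t) (semigroupD T_C0) ?subr_ge0// (contr_normR T_contr)// subr_ge0.
rewrite sub0r normRN => /le_lt_trans; apply.
rewrite -(ltr_pM2l (lt_le_trans ltr01 (p1 n))).
have bn : (2 ^+ n * normR (T (tau n) y)) ^+ 2 <= (`|C| + 1) ^+ 2.
  apply: (@le_trans _ _ C).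
    apply: le_trans (decay n.+1); rewrite big_ord_recr/= lerDr.
    by apply: sumr_ge0 => j _; exact: sqr_ge0.
  have := ler_norm C; have := mulr_ge0 (normr_ge0 C) (normr_ge0 C); have := normr_ge0 C.
  by rewrite expr2; lra.
move: bn; rewrite ler_pXn2r ?nnegrE ?mulr_ge0 ?addr_ge0//.
by move: nb; rewrite ler_pdivrMr//; lra.
Unshelve. all: by end_near. Qed.

Let phi (t : R) : R := w t ^+ 2 * normR (F t) ^+ 2.

Let phi_ge0 t : 0 <= phi t. Proof. by rewrite mulr_ge0// sqr_ge0. Qed.

Let phi_continuous : continuous phi.
Proof.
have n := normR_continuous F_continuous.
by move=> t; apply: cvgM; [apply: cvgM; exact: w_continuous|apply: cvgM; exact: n].
Qed.

(** The weight is replaced by its value at the end of the interval and the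
    energy that is lost by the energy at its start. *)
Let phi_piece (a b W : R) : 0 <= a -> a < b -> (forall t, t <= b -> w t <= W) ->
  (\int[lebesgue_measure]_(t in `[a, b]) (phi t)%:E <= ((W * normR (T a y)) ^+ 2)%:E)%E.
Proof.
move=> a0 ab wW.
have W0 : 0 <= W := le_trans (w_ge0 b) (wW b (lexx b)).
have mF : measurable_fun `[a, b] (fun t => (normR (F t) ^+ 2)%:E).
  apply/measurable_EFinP; apply: measurable_funTS; apply: continuous_measurable_fun => t.
  by apply: cvgM; exact: (normR_continuous F_continuous).
apply: (@le_trans _ _ (\int[lebesgue_measure]_(t in `[a, b]) ((W ^+ 2)%:E * (normR (F t) ^+ 2)%:E))%E).
  apply: ge0_le_integral => //.
  - by move=> t _; rewrite lee_fin.
  - apply/measurable_EFinP; apply: measurable_funTS; exact: continuous_measurable_fun.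
  - exact: measurable_funeM.
  - move=> t /=; rewrite in_itv/= => /andP[_ tb]; rewrite -EFinM lee_fin ler_wpM2r ?sqr_ge0//.
    by rewrite lerXn2r ?nnegrE ?wW.
rewrite ge0_integralZl_EFin ?sqr_ge0//; last by move=> t _; rewrite lee_fin sqr_ge0.
rewrite (sqrt_orbit_energy ip_norm T_C0 T_contr domA S_ext B_sqrt Ay a0 ab) -EFinM lee_fin exprMn.
by rewrite ler_wpM2l ?sqr_ge0// gerBl sqr_ge0.
Qed.

Lemma sqrt_orbit_weighted_L2 :
  in_weighted_L2 `[0, +oo[%classic w (fun t => B (T t y)).
Proof.
have FE t : 0 <= t -> B (T t y) = F t by move=> t0; rewrite /F /orbit max_r.
split.
  apply: (continuous_strongly_measurable (g := fun t => (w t)%:C *: F t)).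
    exact: continuous_scale.
  by move=> t t0; rewrite FE.
have -> : (\int[lebesgue_measure]_(t in `[0%R, +oo[) (normR ((w t)%:C *: B (T t y)) ^+ 2)%:E =
    \int[lebesgue_measure]_(t in `[0%R, +oo[) (phi t)%:E)%E.
  apply: eq_integral => t; rewrite inE/= in_itv/= andbT => t0.
  by rewrite FE// normRZr exprMn real_normK ?num_real.
pose a n := if n is n'.+1 then 4 * (2 ^+ n' * normR (T (tau n') y)) ^+ 2 else normR y ^+ 2.
apply: (@ge0_integral_lt_pinfty _ phi tau a (normR y ^+ 2 + 4 * C)) => //.
- exact: ltW.
- by apply/nondecreasing_seqP => n; exact: ltW.
- rewrite /a -[in normR y](semigroup0 T_C0 y) -[normR _]mul1r.
  by apply: phi_piece => // t /w_le; rewrite expr0.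
- move=> n; rewrite /a; have -> : 4 = 2 ^+ 2 :> R by rewrite -natrX.
  rewrite -exprMn mulrA -exprS.
  by apply: phi_piece => // [|t]; [exact: ltW|exact: w_le].
- case=> [|n]; first by rewrite big_ord0 addr_ge0 ?sqr_ge0// mulr_ge0// (le_trans _ (decay 0)) ?big_ord0.
  rewrite big_ord_recl/= lerD2l.
  rewrite (eq_bigr (fun j : 'I_n => 4 * (2 ^+ j * normR (T (tau j) y)) ^+ 2))//.
  by rewrite -mulr_sumr; exact: (ler_wpM2l (ler0n _ 4) (decay n)).
Qed.

Lemma sqrt_orbit_C0 : in_C0 (fun t => B (T t y)).
Proof.
split; last first.
  exact: (sqrt_orbit_cvg0 ip_norm T_C0 T_contr domA S_ext B_sqrt Ay orbit_cvg0).
apply: (@subspace_eq_continuous R `[0, +oo[%classic X F (fun t => B (T t y))).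
  by move=> t; rewrite inE/= in_itv/= andbT => t0; rewrite /F /orbit max_r.
exact: continuous_subspaceT.
Qed.

End WeightedDecay.

Theorem theorem6p3 (R : realType) (X : completeNormedModType R[i])
  (ip : {dot X for Num.conj}) (ip_norm : hilbert_norm ip)
  (T : R -> {linear X -> X}) (T_C0 : C0_semigroup T) (T_contr : contractive T)
  (A : operator X) (A_gen : A = generator T)
  (domA : dom A = dom (adjoint ip A))
  (specA : spectrum A `&` [set l : R[i] | complex.Re l = 0] = set0)
  (M : R -> R)
  (M_cont : {within `[0, +oo[%classic, continuous M})
  (M_incr : forall s t : R, 0 <= s -> s <= t -> M s <= M t)
  (M_ge2 : forall s : R, 0 <= s -> 2 <= M s)
  (M_res : forall s : R, (opnorm (resolvent (0 +i* s)%R A) <= (M `|s|%R)%:E)%E)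
  (S : operator X) (S_sa : selfadjoint ip S) (S_ge0 : op_nonneg ip S)
  (S_ext : op_extends S (op_opp (op_add A (adjoint ip A))))
  (B : operator X) (B_sqrt : is_sqrt ip B S) :
  exists2 k : R, 0 < k &
    forall x : X,
      in_weighted_L2 `[0, +oo[%classic (fun t => w_Mlog M (k * t))
        (fun t => B (T t (op_inv A x))) /\
      in_C0 (fun t => B (T t (op_inv A x))).
Proof.
subst A; set A := generator T.
(* The imaginary axis consists of regular points, so the bound on the norm of
   the resolvent is a bound in the sense of [resolvent_bound]. *)
have rb s : resolvent_bound T (0 +i* s) (M `|s|).
  apply: resolvent_bound_opnorm (M_res s); apply: contrapT => ns.
  by have : set0 (0 +i* s : R[i]) by rewrite -specA.
have rb0 : resolvent_bound T 0 (M 0) by have := rb 0; rewrite normr0.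
have m0 : 0 < M 0 := lt_le_trans (ltr0n _ 2) (M_ge2 _ (lexx 0)).
have invE x : op_inv A x = generator_inv T x.
  have [iA iE] : dom A (op_inv A x) /\ A (op_inv A x) = x.
    apply: (@getPex _ [set z | dom A z /\ A z = x]).
    by exists (generator_inv T x); exact: (generator_inv_dom rb0 x).
  by rewrite -[in RHS]iE (generator_invK rb0).
(* The factor cancels the constant in [decay_time]. *)
exists 32^-1; first by rewrite invr_gt0.
move=> x; have [Ay _] := generator_inv_dom rb0 x.
have M1 s : 0 <= s -> 1 <= M s by move=> /M_ge2; apply: le_trans; rewrite ler1n.
have [C HC] := dyadic_decay ip_norm T_C0 T_contr m0 rb0 M1 M_incr rb x.
rewrite invE; split.
- exact: (sqrt_orbit_weighted_L2 ip_norm T_C0 T_contr domA S_ext B_sqrt M_cont M_incr M_ge2 Ay HC).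
- exact: (sqrt_orbit_C0 ip_norm T_C0 T_contr domA S_ext B_sqrt M_incr M_ge2 Ay HC).
Qed.
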